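(* Let $\lambda\in\mathbb{R}\setminus\{0\}$ and $1\le p,q\le\infty$. The definition of $M_\lambda^{p,q}(\mathbb{R}^{2n})$ is independent of the window $g$: if $f$ is a tempered distribution on $\mathbb{R}^{2n}$ and $(\xi,\eta)\mapsto\langle f,\Pi_\lambda(\xi,\eta)g\rangle$ belongs to $L^{p,q}(\mathbb{R}^{2n}\times\mathbb{R}^{2n})$ for some nonzero $g\in\mathcal S(\mathbb{R}^{2n})$, then $(\xi,\eta)\mapsto\langle f,\Pi_\lambda(\xi,\eta)g'\rangle$ also belongs to $L^{p,q}(\mathbb{R}^{2n}\times\mathbb{R}^{2n})$ for any other $g'\in\mathcal S(\mathbb{R}^{2n})$. Different nonzero windows $g$ define equivalent norms on $M_\lambda^{p,q}(\mathbb{R}^{2n})$.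
   Context: Symplectic form on $\mathbb{R}^{2n}$: $[(x,u),(y,v)]=u\cdot y-v\cdot x$. For $\lambda\neq0$, acting on functions on $\mathbb{R}^{2n}$: twisted translations $\tau_\lambda(\eta)g(\xi)=g(\xi-\eta)e^{-i\frac{\lambda}{2}[\xi,\eta]}$; twisted modulations $e_\lambda(a,b)g(x,u)=g\big(x-\tanh(\tfrac\lambda2)b,\,u+\tanh(\tfrac\lambda2)a\big)e^{-i\frac\lambda2\coth(\frac\lambda2)(x\cdot a+u\cdot b)}$; and $\Pi_\lambda(\xi,\eta)=e^{i\frac\lambda2(\coth\lambda)\xi\cdot\eta}e_\lambda(\eta)\tau_\lambda(\xi)$ for $\xi,\eta\in\mathbb{R}^{2n}$. The bracket $\langle f,g\rangle$ is linear in $f$, conjugate-linear in $g$, and extends to $f\in\mathcal S'(\mathbb{R}^{2n})$, $g\in\mathcal S(\mathbb{R}^{2n})$. $L^{p,q}(\mathbb{R}^{2n}\times\mathbb{R}^{2n})$ has norm $\|F\|_{p,q}=\big(\int(\int|F(\xi,\eta)|^pd\xi)^{q/p}d\eta\big)^{1/q}$ (usual modification for $\infty$). The twisted modulation space $M_\lambda^{p,q}(\mathbb{R}^{2n})$ is the space of tempered distributions $f$ such that $\langle f,\Pi_\lambda(\xi,\eta)g\rangle\in L^{p,q}(\mathbb{R}^{2n}\times\mathbb{R}^{2n})$ for some nonzero window $g\in\mathcal S(\mathbb{R}^{2n})$, with norm (associated to $g$) equal to the $L^{p,q}$ norm of $(\xi,\eta)\mapsto\langle f,\Pi_\lambda(\xi,\eta)g\rangle$.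 *)

(* Defs.v *)
From HB Require Import structures.
From mathcomp Require Import all_boot all_order all_algebra.
From mathcomp Require Import all_classical all_reals all_analysis.
From mathcomp Require Import complex.

Set Implicit Arguments.
Unset Strict Implicit.
Unset Printing Implicit Defensive.

Import Order.TTheory GRing.Theory Num.Theory.
Import numFieldNormedType.Exports.
Import Normc.

Local Open Scope classical_set_scope.
Local Open Scope complex_scope.
Local Open Scope ring_scope.

(* The product sigma-algebra lives on tuples, the norm on row vectors:
   integrals over R^m are taken over m-tuples of reals and transported to
   'rV[R]_m by row_of_tuple. *)
Notation rtuple R m := (m.-tuple (measurableTypeR R)).

Section lebesgue_tuple.
Context {R : realType}.

Section lebesgue_cons.
Local Open Scope ereal_scope.
Variables (m : nat) (mu : {sigma_finite_measure set (rtuple R m) -> \bar R}).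

Definition rtuple_cons (z : measurableTypeR R * rtuple R m) : rtuple R m.+1 :=
  [tuple of z.1 :: z.2].

Lemma measurable_rtuple_cons : measurable_fun [set: _] rtuple_cons.
Proof. exact: measurable_cons. Qed.

Definition lebesgue_cons : set (rtuple R m.+1) -> \bar R :=
  pushforward (@lebesgue_measure R \x mu) rtuple_cons.

Let preimage_cons_measurable A : measurable A -> measurable (rtuple_cons @^-1` A).
Proof.
by move=> mA; rewrite -[X in measurable X]setTI; exact: measurable_rtuple_cons.
Qed.

Let lebesgue_cons0 : lebesgue_cons set0 = 0.
Proof. by rewrite /lebesgue_cons /pushforward preimage_set0 measure0. Qed.

Let lebesgue_cons_ge0 A : 0 <= lebesgue_cons A.
Proof. by rewrite /lebesgue_cons /pushforward. Qed.

Let lebesgue_cons_sigma_additive : semi_sigma_additive lebesgue_cons.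
Proof.
move=> F mF tF mUF; rewrite /lebesgue_cons /pushforward preimage_bigcup.
apply: measure_semi_sigma_additive.
- by move=> k; exact: preimage_cons_measurable.
- apply/trivIsetP => /= i j _ _ ij; rewrite -preimage_setI.
  by move/trivIsetP : tF => /(_ _ _ _ _ ij) ->//; rewrite preimage_set0.
- by rewrite -preimage_bigcup; exact: preimage_cons_measurable.
Qed.

HB.instance Definition _ := isMeasure.Build _ _ _
  lebesgue_cons lebesgue_cons0 lebesgue_cons_ge0 lebesgue_cons_sigma_additive.

Let lebesgue_cons_sigma_finite : sigma_finite setT lebesgue_cons.
Proof.
have /sigma_finiteP[F [TF ndF Foo]] := sigma_finiteT (@lebesgue_measure R).
have /sigma_finiteP[G [TG ndG Goo]] := sigma_finiteT mu.
pose un (t : rtuple R m.+1) : measurableTypeR R * rtuple R m :=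
  (thead t, [tuple of behead t]).
have unK : un \o rtuple_cons = id.
  by apply/funext => -[x t]; rewrite /un /=; congr pair; exact/val_inj.
have mun : measurable_fun setT un.
  by apply/measurable_fun_pair; [exact: measurable_tnth|exact: measurable_behead].
exists (fun k => un @^-1` (F k `*` G k)).
  apply/seteqP; split=> // t _.
  have [i _ Fi] : (\bigcup_i F i) (thead t) by rewrite -TF.
  have [j _ Gj] : (\bigcup_j G j) [tuple of behead t] by rewrite -TG.
  exists (maxn i j) => //; split => /=.
    by move: Fi; exact/subsetPset/ndF/leq_maxl.
  by move: Gj; exact/subsetPset/ndG/leq_maxr.
move=> k; have [mFk Fkoo] := Foo k; have [mGk Gkoo] := Goo k; split.
  by rewrite -[X in measurable X]setTI; apply: mun => //; exact: measurableX.
rewrite /lebesgue_cons /pushforward -comp_preimage unK preimage_id.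
by rewrite product_measure1E// lte_mul_pinfty// ge0_fin_numE.
Qed.

HB.instance Definition _ := @Measure_isSigmaFinite.Build _ _ _
  lebesgue_cons lebesgue_cons_sigma_finite.

End lebesgue_cons.

Fixpoint lebesgue_tuple m : {sigma_finite_measure set (rtuple R m) -> \bar R} :=
  match m with
  | 0 => \d_([tuple] : rtuple R 0)
  | k.+1 => lebesgue_cons (lebesgue_tuple k)
  end.

End lebesgue_tuple.

Definition row_of_tuple (R : realType) m (t : rtuple R m) : 'rV[R]_m :=
  \row_i tnth t i.

Section mixed_norm.
Context {R : realType} {m : nat}.
Implicit Types (p q : \bar R) (F : 'rV[R]_m -> 'rV[R]_m -> R[i]).

Definition mixed_norm p q F : \bar R :=
  Lnorm (lebesgue_tuple m) q (fun eta =>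
    Lnorm (lebesgue_tuple m) p (fun xi =>
      (normc (F (row_of_tuple xi) (row_of_tuple eta)))%:E)).

Definition Lpq p q F : Prop :=
  [/\ measurable_fun [set: rtuple R m * rtuple R m]
        (fun z => complex.Re (F (row_of_tuple z.1) (row_of_tuple z.2))),
      measurable_fun [set: rtuple R m * rtuple R m]
        (fun z => complex.Im (F (row_of_tuple z.1) (row_of_tuple z.2)))
    & (mixed_norm p q F < +oo)%E].

End mixed_norm.

Section schwartz.
Context {R : realType} {m : nat}.
Implicit Types (h phi psi : 'rV[R]_m -> R[i]) (s : seq 'I_m).

(* R[i] is not a normed module over R, so that derivatives and continuity are
   taken on real and imaginary parts. Mixed partial derivatives are indexed by
   the sequence of the coordinates along which one differentiates. *)
Definition partial (i : 'I_m) h : 'rV[R]_m -> R[i] := fun x =>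
  'D_(delta_mx 0 i) (fun y => complex.Re (h y)) x +i*
  'D_(delta_mx 0 i) (fun y => complex.Im (h y)) x.

Definition partials s h := foldr partial h s.

Definition smooth h : Prop := forall s,
  [/\ continuous (fun x => complex.Re (partials s h x)),
      continuous (fun x => complex.Im (partials s h x))
    & forall (i : 'I_m) x,
        derivable (fun y => complex.Re (partials s h y)) x (delta_mx 0 i) /\
        derivable (fun y => complex.Im (partials s h y)) x (delta_mx 0 i)].

Definition seminorm k s h : \bar R :=
  ereal_sup [set ((1 + `|x|) ^+ k * normc (partials s h x))%:E
            | x in [set: 'rV[R]_m]].

Definition schwartz h : Prop :=
  smooth h /\ forall k s, (seminorm k s h < +oo)%E.

(* Tempered distributions are represented by functionals on all functions, of
   which only the values on Schwartz functions matter. The continuity clause is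
   continuity on the Schwartz space for the topology generated by the seminorms:
   the bound N on the indices selects a finite subfamily of them. *)
Definition tempered (f : ('rV[R]_m -> R[i]) -> R[i]) : Prop :=
  (forall (a : R[i]) phi psi, schwartz phi -> schwartz psi ->
     f (fun x => a * phi x + psi x) = a * f phi + f psi) /\
  (forall phi, schwartz phi -> forall e : R, 0 < e ->
     exists (N : nat) (d : R), 0 < d /\
       forall psi, schwartz psi ->
         (forall k s, (k <= N)%N -> (size s <= N)%N ->
            (seminorm k s (fun x => psi x - phi x)%R < d%:E)%E) ->
         normc (f psi - f phi) < e).

(* The bracket is sesquilinear and extends the one of L^2, while f acts
   linearly on its argument. *)
Definition bracket (f : ('rV[R]_m -> R[i]) -> R[i]) (g : 'rV[R]_m -> R[i]) :=
  f (fun x => conjc (g x)).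

End schwartz.

Section twisted.
Context {R : realType} {n : nat}.
Implicit Types (lambda : R) (xi eta : 'rV[R]_(n + n))
  (g : 'rV[R]_(n + n) -> R[i]).

Definition expi (t : R) : R[i] := cos t +i* sin t.

Definition tanh (t : R) : R := (expR t - expR (- t)) / (expR t + expR (- t)).
Definition coth (t : R) : R := (expR t + expR (- t)) / (expR t - expR (- t)).

Definition dot m (x y : 'rV[R]_m) : R := \sum_(i < m) x 0 i * y 0 i.

(* A point (x, u) of R^(2n) is row_mx x u. *)
Definition symplectic xi eta : R :=
  dot (rsubmx xi) (lsubmx eta) - dot (rsubmx eta) (lsubmx xi).

Definition twisted_translation lambda eta g : 'rV[R]_(n + n) -> R[i] :=
  fun xi => g (xi - eta) * expi (- (lambda / 2 * symplectic xi eta)).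

Definition twisted_modulation lambda eta g : 'rV[R]_(n + n) -> R[i] :=
  let a := lsubmx eta in let b := rsubmx eta in
  fun xi => let x := lsubmx xi in let u := rsubmx xi in
    g (row_mx (x - tanh (lambda / 2) *: b) (u + tanh (lambda / 2) *: a)) *
    expi (- (lambda / 2 * coth (lambda / 2) * (dot x a + dot u b))).

Definition Pi lambda xi eta g : 'rV[R]_(n + n) -> R[i] :=
  fun z => expi (lambda / 2 * coth lambda * dot xi eta) *
    twisted_modulation lambda eta (twisted_translation lambda xi g) z.

Definition twisted_stft lambda (f : ('rV[R]_(n + n) -> R[i]) -> R[i]) g :
    'rV[R]_(n + n) -> 'rV[R]_(n + n) -> R[i] :=
  fun xi eta => bracket f (Pi lambda xi eta g).

Definition modulation_norm lambda (p q : \bar R) g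
    (f : ('rV[R]_(n + n) -> R[i]) -> R[i]) : \bar R :=
  mixed_norm p q (twisted_stft lambda f g).

Definition modulation_space lambda (p q : \bar R) :
    set (('rV[R]_(n + n) -> R[i]) -> R[i]) :=
  [set f | tempered f /\ exists g,
     [/\ schwartz g, g <> (fun=> 0) & Lpq p q (twisted_stft lambda f g)]].

End twisted.

(* Main.v *)
Require Import Defs.
From mathcomp Require Import all_boot all_order all_algebra.
From mathcomp Require Import all_classical all_reals all_analysis.
From mathcomp Require Import measurable_realfun ess_sup_inf complex.
From mathcomp Require Import ring lra zify.

(* Pi_lambda(xi, eta) is, up to a unimodular phase, an ordinary time-frequency
   shift whose parameters depend linearly and bijectively on (xi, eta).
   Replacing the window by one of its time-frequency shifts therefore only
   translates the twisted transform in (xi, eta) and multiplies it by a phase.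
   Mixed norms are invariant under translations, subadditive and, by Fatou,
   lower semicontinuous for pointwise limits, so the norm of the transform is
   controlled for every window in the closed hull of the combinations, with
   l^1-bounded coefficients, of time-frequency shifts of g. Every Schwartz
   function h is in such a hull: h(x) times a Riemann sum of |g(x - y)|^2 over
   y is a sum of shifts g(x - y) multiplied by h(x) conj(g(x - y)), the Riemann
   sum is asymptotically independent of x and bounded away from 0, and a
   Schwartz multiplier is the limit of its discrete Fourier interpolants, which
   are trigonometric polynomials with bounded l^1 norm. *)

Set Implicit Arguments.
Unset Strict Implicit.
Unset Printing Implicit Defensive.
Import Order.TTheory GRing.Theory Num.Theory.
Import numFieldNormedType.Exports.
Import Normc.
Local Open Scope classical_set_scope.
Local Open Scope complex_scope.
Local Open Scope ring_scope.

(** The usual route expresses the transform for $g'$ through a convolution with the transform for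
    $g$, by an inversion formula, and applies Young's inequality; this moves $f$ under vector-valued
    integrals. Here integrals over windows are replaced by finite sums over a grid, so that only
    linearity of $f$ and sequential limits are used; the price is that every estimate must be
    uniform in the grid. The grid has mesh $1/(L+1)$ and half-width $L+1$: one parameter refines it
    and exhausts the space, and the boundary terms of summation by parts decay faster than any fixed
    power of $L$. The Riemann sum is normalized by its own value at one point, so its limit is never
    computed. Convergence of windows is checked as boundedness in all seminorms plus locally uniform
    convergence; Landau's inequality supplies the derivatives. The final constant depends on the two
    windows but not on $f$, so one induction on [hull] gives both membership and the equivalence of
    norms; measurability, being part of [Lpq], is carried along. *)

Local Notation Re := complex.Re.
Local Notation Im := complex.Im.

(** * Moduli and phases of complex numbers *)

Section complex_modulus.
Context {R : realType}.
Implicit Types (z w : R[i]) (t : R).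

Lemma normc_ge0 z : 0 <= normc z.
Proof. by case: z => a b; exact: sqrtr_ge0. Qed.

Lemma Re_le_normc z : `|Re z| <= normc z.
Proof.
case: z => a b /=; rewrite -sqrtr_sqr; apply: ler_wsqrtr.
by rewrite lerDl sqr_ge0.
Qed.

Lemma Im_le_normc z : `|Im z| <= normc z.
Proof.
case: z => a b /=; rewrite -sqrtr_sqr; apply: ler_wsqrtr.
by rewrite lerDr sqr_ge0.
Qed.

Lemma normc_conj z : normc (conjc z) = normc z.
Proof. by case: z => a b /=; rewrite sqrrN. Qed.

Lemma normc_expi t : normc (expi t) = 1.
Proof. by rewrite /= cos2Dsin2 sqrtr1. Qed.

Lemma normc_real t : normc (real_complex R t) = `|t|.
Proof. by rewrite /= expr0n /= addr0 sqrtr_sqr. Qed.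

Lemma normc_le_ReIm z : normc z <= `|Re z| + `|Im z|.
Proof.
rewrite [z in leLHS]complexE; apply: le_trans (le_normcD _ _) _.
by rewrite normcM !normc_real /= !expr0n expr1n /= add0r sqrtr1 mul1r.
Qed.

Lemma normc_sum (I : Type) (r : seq I) (P : pred I) (F : I -> R[i]) :
  normc (\sum_(i <- r | P i) F i) <= \sum_(i <- r | P i) normc (F i).
Proof.
elim/big_ind2: _ => [|x1 x2 y1 y2 h1 h2|//].
  by rewrite normc0.
by apply: le_trans (le_normcD _ _) _; exact: lerD.
Qed.

Lemma normc_prod (I : Type) (r : seq I) (P : pred I) (F : I -> R[i]) :
  normc (\prod_(i <- r | P i) F i) = \prod_(i <- r | P i) normc (F i).
Proof.
elim/big_ind2: _ => [|x1 x2 y1 y2 <- <-|//]; first exact: normc1.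
by rewrite normcM.
Qed.

Lemma Re_addc z w : Re (z + w) = Re z + Re w. Proof. by case: z w => ? ? [? ?]. Qed.
Lemma Im_addc z w : Im (z + w) = Im z + Im w. Proof. by case: z w => ? ? [? ?]. Qed.
Lemma Re_mulc z w : Re (z * w) = Re z * Re w - Im z * Im w.
Proof. by case: z w => ? ? [? ?]. Qed.
Lemma Im_mulc z w : Im (z * w) = Re z * Im w + Im z * Re w.
Proof. by case: z w => ? ? [? ?]. Qed.

Lemma expiD s t : expi (s + t) = expi s * expi t :> R[i].
Proof.
by apply/eqP; rewrite eq_complex /= cosD sinD !eqxx /= addrC eqxx.
Qed.

Lemma expi0 : expi 0 = 1 :> R[i].
Proof. by rewrite /expi cos0 sin0. Qed.

Lemma expiN t : expi (- t) = conjc (expi t) :> R[i].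
Proof. by rewrite /expi cosN sinN. Qed.

Lemma expiX n t : expi t ^+ n = expi (t *+ n) :> R[i].
Proof.
elim: n => [|n IH]; first by rewrite expr0 mulr0n expi0.
by rewrite exprS IH mulrS expiD.
Qed.

Lemma expi_sum (I : Type) (r : seq I) (F : I -> R) :
  expi (\sum_(i <- r) F i) = \prod_(i <- r) expi (F i) :> R[i].
Proof.
elim: r => [|i r IH]; first by rewrite !big_nil expi0.
by rewrite !big_cons expiD IH.
Qed.

End complex_modulus.

(** * Partial derivatives and smooth functions *)

Section partial_calculus.
Context {R : realType} {m : nat}.
Local Notation V := 'rV[R]_m.
Local Notation e := (fun i => delta_mx 0 i : V).
Implicit Types (h a b : V -> R[i]) (x y : V) (c d : R[i]) (s : seq 'I_m) (i : 'I_m).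

Definition is_partial i h x d :=
  is_derive x (e i) (fun y => Re (h y)) (Re d) /\
  is_derive x (e i) (fun y => Im (h y)) (Im d).

Lemma partialE i h x d : is_partial i h x d -> partial i h x = d.
Proof. by move=> [[_ h1] [_ h2]]; rewrite /partial h1 h2; case: d {h1 h2}. Qed.

Lemma is_partialP i h x :
  derivable (fun y => Re (h y)) x (e i) -> derivable (fun y => Im (h y)) x (e i) ->
  is_partial i h x (partial i h x).
Proof. by move=> /derivableP h1 /derivableP h2; split. Qed.

Lemma is_partialD i a b x c d : is_partial i a x c -> is_partial i b x d ->
  is_partial i (fun y => a y + b y) x (c + d).
Proof.
move=> [a1 a2] [b1 b2]; split.
  rewrite Re_addc (_ : (fun y => _) = (fun y => Re (a y)) \+ (fun y => Re (b y))).
    exact: is_deriveD.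
  by apply/funext => y /=; rewrite Re_addc.
rewrite Im_addc (_ : (fun y => _) = (fun y => Im (a y)) \+ (fun y => Im (b y))).
  exact: is_deriveD.
by apply/funext => y /=; rewrite Im_addc.
Qed.

Lemma is_partialM i a b x c d : is_partial i a x c -> is_partial i b x d ->
  is_partial i (fun y => a y * b y) x (c * b x + a x * d).
Proof.
move=> [a1 a2] [b1 b2]; split.
  rewrite (_ : (fun y => _) = (fun y => Re (a y)) \* (fun y => Re (b y))
     - (fun y => Im (a y)) \* (fun y => Im (b y))); last first.
    by apply/funext => y /=; rewrite Re_mulc.
  apply: is_derive_eq.
  by rewrite Re_addc !Re_mulc /GRing.scale /=; ring.
rewrite (_ : (fun y => _) = (fun y => Re (a y)) \* (fun y => Im (b y))
     + (fun y => Im (a y)) \* (fun y => Re (b y))); last first.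
  by apply/funext => y /=; rewrite Im_mulc.
apply: is_derive_eq.
by rewrite Im_addc !Im_mulc /GRing.scale /=; ring.
Qed.

Lemma is_partial_cst i c x : is_partial i (fun=> c) x 0.
Proof. by split; exact: is_derive_cst. Qed.

Lemma is_partial_conj i h x d : is_partial i h x d ->
  is_partial i (fun y => conjc (h y)) x (conjc d).
Proof.
move=> [h1 h2]; split.
  rewrite (_ : (fun y => _) = (fun y => Re (h y))); last first.
    by apply/funext => y; case: (h y).
  by apply: is_derive_eq; case: d {h1 h2}.
rewrite (_ : (fun y => _) = - (fun y => Im (h y))); last first.
  by apply/funext => y; rewrite fctE; case: (h y).
by apply: is_derive_eq; case: d {h1 h2}.
Qed.

Lemma derive_translate (f : V -> R) x y v :
  'D_v (fun z => f (z + y)) x = 'D_v f (x + y) /\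
  (derivable (fun z => f (z + y)) x v <-> derivable f (x + y) v).
Proof.
have E : (fun h : R => h^-1 *: (((fun z => f (z + y)) \o shift x) (h *: v)
     - (fun z => f (z + y)) x)) =
  (fun h : R => h^-1 *: ((f \o shift (x + y)) (h *: v) - f (x + y))).
  by apply/funext => h /=; rewrite addrA.
by rewrite /derive /derivable E.
Qed.

Lemma is_partial_translate i h x y d : is_partial i h (x + y) d ->
  is_partial i (fun z => h (z + y)) x d.
Proof.
move=> [[h1 h2] [h3 h4]]; split; split.
- by apply/(derive_translate (fun z => Re (h z)) _ _ _).2.
- by rewrite (derive_translate (fun z => Re (h z)) _ _ _).1.
- by apply/(derive_translate (fun z => Im (h z)) _ _ _).2.
- by rewrite (derive_translate (fun z => Im (h z)) _ _ _).1.
Qed.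

Definition regular_at s h :=
  [/\ continuous (fun x => Re (partials s h x)),
      continuous (fun x => Im (partials s h x))
    & forall i x, is_partial i (partials s h) x (partial i (partials s h) x)].

(** Truncating smoothness at order [n] gives an induction parameter: the product rule turns
    [partial i] of a product into a sum of products whose regularity is known one order lower. *)
Definition regular n h := forall s, (size s <= n)%N -> regular_at s h.

Lemma smooth_regular h : smooth h <-> forall n, regular n h.
Proof.
split=> [H n s _|H s].
  have [H1 H2 H3] := H s; split=> // i x.
  by have [] := H3 i x; exact: is_partialP.
have [//|H1 H2 H3] := H (size s) s; split=> // i x.
by have [[h1 _] [h2 _]] := H3 i x; exact: conj h1 h2.
Qed.

Lemma partials_rcons s i h : partials (rcons s i) h = partials s (partial i h).
Proof. by rewrite /partials foldr_rcons. Qed.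

Local Opaque smooth.

(** [partials] is a right fold, so the last entry of the sequence is the derivative taken first.
    Peeling it off lets a formula for [partial i h] be used before the remaining derivatives are
    considered. *)
Lemma regularS n h : regular 0 h -> (forall i, regular n (partial i h)) ->
  regular n.+1 h.
Proof.
move=> h0 hn s; case/lastP: s => [_|s i]; first exact: h0.
rewrite size_rcons ltnS => sn; have := hn i s sn.
by rewrite /regular_at partials_rcons.
Qed.

Lemma regular_partial n h i : regular n.+1 h -> regular n (partial i h).
Proof.
move=> H s sn; have := H (rcons s i); rewrite size_rcons ltnS => /(_ sn).
by rewrite /regular_at partials_rcons.
Qed.

Lemma smooth_is_partial h s i x : smooth h ->
  is_partial i (partials s h) x (partials (i :: s) h x).
Proof. by move=> /smooth_regular/(_ (size s) s)[//|_ _]; exact. Qed.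

Lemma smooth_partial h i : smooth h -> smooth (partial i h).
Proof.
move=> /smooth_regular H; apply/smooth_regular => n.
exact: regular_partial.
Qed.

Lemma smooth_partials h s : smooth h -> smooth (partials s h).
Proof.
by move=> hs; elim: s => [|i s IH]; [exact: hs|exact: smooth_partial IH].
Qed.

(** The bound [n.+1] exceeds the order of regularity by one because [regular_at s] already contains
    the existence of one further derivative of [partials s]. *)
Lemma regular_partialsD n a b s : regular n a -> regular n b -> (size s <= n.+1)%N ->
  partials s (fun x => a x + b x) = (fun x => partials s a x + partials s b x).
Proof.
move=> sa sb; elim: s => //= i s IH sn; rewrite IH; last exact: ltnW.
apply/funext => x; apply: partialE; apply: is_partialD.
  by have [_ _] := sa _ sn; exact.
by have [_ _] := sb _ sn; exact.
Qed.

Lemma partialsD a b s : smooth a -> smooth b ->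
  partials s (fun x => a x + b x) = (fun x => partials s a x + partials s b x).
Proof.
move=> /smooth_regular sa /smooth_regular sb.
by apply: (@regular_partialsD (size s)).
Qed.

Lemma continuous_ReImD a b :
  continuous (fun x => Re (a x)) -> continuous (fun x => Im (a x)) ->
  continuous (fun x => Re (b x)) -> continuous (fun x => Im (b x)) ->
  continuous (fun x => Re (a x + b x)) /\ continuous (fun x => Im (a x + b x)).
Proof.
move=> a1 a2 b1 b2; split => x.
  under eq_fun do rewrite Re_addc.
  exact: (cvgD (a1 x) (b1 x)).
under eq_fun do rewrite Im_addc.
exact: (cvgD (a2 x) (b2 x)).
Qed.

Lemma continuous_ReImM a b :
  continuous (fun x => Re (a x)) -> continuous (fun x => Im (a x)) ->
  continuous (fun x => Re (b x)) -> continuous (fun x => Im (b x)) ->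
  continuous (fun x => Re (a x * b x)) /\ continuous (fun x => Im (a x * b x)).
Proof.
move=> a1 a2 b1 b2; split => x.
  under eq_fun do rewrite Re_mulc.
  exact: (cvgB (cvgM (a1 x) (b1 x)) (cvgM (a2 x) (b2 x))).
under eq_fun do rewrite Im_mulc.
exact: (cvgD (cvgM (a1 x) (b2 x)) (cvgM (a2 x) (b1 x))).
Qed.

Lemma regularD n a b : regular n a -> regular n b -> regular n (fun x => a x + b x).
Proof.
move=> ra rb s sn; rewrite /regular_at (regular_partialsD ra rb); last exact: leqW.
have [a1 a2 a3] := ra s sn; have [b1 b2 b3] := rb s sn.
have [c1 c2] := continuous_ReImD a1 a2 b1 b2; split=> // i x.
have h := is_partialD (a3 i x) (b3 i x).
by rewrite (partialE h).
Qed.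

Lemma smoothD a b : smooth a -> smooth b -> smooth (fun x => a x + b x).
Proof.
move=> /smooth_regular sa /smooth_regular sb; apply/smooth_regular => n.
exact: regularD.
Qed.

Lemma partialM i a b : smooth a -> smooth b ->
  partial i (fun x => a x * b x) = (fun x => partial i a x * b x + a x * partial i b x).
Proof.
move=> sa sb; apply/funext => x; apply: partialE; apply: is_partialM.
  exact: (smooth_is_partial [::] i x sa).
exact: (smooth_is_partial [::] i x sb).
Qed.

Lemma smoothM a b : smooth a -> smooth b -> smooth (fun x => a x * b x).
Proof.
move=> sa sb; apply/smooth_regular => n.
elim: n a b sa sb => [|n IH] a b sa sb.
  case=> // _.
  have [//|a1 a2 a3] := (smooth_regular a).1 sa 0 [::].
  have [//|b1 b2 b3] := (smooth_regular b).1 sb 0 [::].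
  have [c1 c2] := continuous_ReImM a1 a2 b1 b2; split=> // i x.
  have h := is_partialM (a3 i x) (b3 i x).
  by rewrite /= (partialE h).
apply: regularS => [|i]; last first.
  have [sa' sb'] := (smooth_partial i sa, smooth_partial i sb).
  by rewrite (partialM i sa sb); exact: regularD (IH _ _ sa' sb) (IH _ _ sa sb').
by move=> s s0; apply: (IH a b sa sb); exact: leq_trans s0 _.
Qed.

Lemma smooth_cst c : smooth (fun _ : V => c).
Proof.
apply/smooth_regular => n; elim: n c => [|n IH] c.
  case=> // _; split => [x|x|i x] /=.
  - exact: cst_continuous.
  - exact: cst_continuous.
  - by rewrite (partialE (is_partial_cst i c x)); exact: is_partial_cst.
apply: regularS => [s s0|i]; first by apply: IH; exact: leq_trans s0 _.
rewrite (_ : partial i _ = (fun=> 0)); first exact: IH.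
by apply/funext => x; apply: partialE; exact: is_partial_cst.
Qed.

Lemma partials_translate h y s :
  partials s (fun x => h (x + y)) = (fun x => partials s h (x + y)).
Proof.
elim: s => //= i s ->; apply/funext => x; rewrite /partial.
by congr (_ +i* _); exact: (derive_translate (fun z => _ (partials s h z)) _ _ _).1.
Qed.

Lemma smooth_translate h y : smooth h -> smooth (fun x => h (x + y)).
Proof.
move=> /smooth_regular sh; apply/smooth_regular => n s sn.
rewrite /regular_at partials_translate; have [h1 h2 h3] := sh n s sn; split=> [x|x|i x].
- apply: (@continuous_comp _ _ _ (fun x => x + y) (fun x => Re (partials s h x))).
    exact: (cvgD cvg_id (cvg_cst _)).
  exact: h1.
- apply: (@continuous_comp _ _ _ (fun x => x + y) (fun x => Im (partials s h x))).
    exact: (cvgD cvg_id (cvg_cst _)).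
  exact: h2.
- have := is_partial_translate (h3 i (x + y)).
  by move=> H; rewrite (partialE H).
Qed.

Lemma partials_conj h s : smooth h ->
  partials s (fun x => conjc (h x)) = (fun x => conjc (partials s h x)).
Proof.
move=> sh; elim: s => //= i s ->; apply/funext => x; apply: partialE.
exact: (is_partial_conj (smooth_is_partial s i x sh)).
Qed.

Lemma smooth_conj h : smooth h -> smooth (fun x => conjc (h x)).
Proof.
move=> sh; have /smooth_regular H := sh; apply/smooth_regular => n s sn.
rewrite /regular_at partials_conj//; have [h1 h2 h3] := H n s sn.
split=> [x|x|i x].
- rewrite (_ : (fun x => _) = (fun x => Re (partials s h x))); last first.
    by apply/funext => z; case: (partials s h z).
  exact: h1.
- rewrite (_ : (fun x => _) = (fun x => - Im (partials s h x))); last first.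
    by apply/funext => z; case: (partials s h z).
  exact: (cvgN (h2 x)).
- by have H' := is_partial_conj (h3 i x); rewrite (partialE H').
Qed.

Lemma partialsZ c h s : smooth h ->
  partials s (fun x => c * h x) = (fun x => c * partials s h x).
Proof.
move=> sh; elim: s => //= i s ->; apply/funext => x; apply: partialE.
have := is_partialM (is_partial_cst i c x) (smooth_is_partial s i x sh).
by rewrite mul0r add0r.
Qed.

Lemma smoothZ c h : smooth h -> smooth (fun x => c * h x).
Proof. exact: smoothM (smooth_cst c). Qed.

Lemma smooth_partials_sum (I : Type) (r : seq I) (F : I -> V -> R[i]) :
  (forall j, smooth (F j)) -> smooth (fun x => \sum_(j <- r) F j x) /\
  forall s, partials s (fun x => \sum_(j <- r) F j x) =
            (fun x => \sum_(j <- r) partials s (F j) x).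
Proof.
move=> sF; elim: r => [|j r [IH1 IH2]].
  split; first by under eq_fun do rewrite big_nil; exact: smooth_cst.
  move=> s; under eq_fun do rewrite big_nil.
  under [RHS]eq_fun do rewrite big_nil.
  elim: s => //= i s ->; apply/funext => x; apply: partialE; exact: is_partial_cst.
split; first by under eq_fun do rewrite big_cons; exact: (smoothD (sF j) IH1).
move=> s; under eq_fun do rewrite big_cons; rewrite (partialsD s (sF j) IH1) IH2.
by under [RHS]eq_fun do rewrite big_cons.
Qed.

Lemma smooth_sum (I : Type) (r : seq I) (F : I -> V -> R[i]) :
  (forall j, smooth (F j)) -> smooth (fun x => \sum_(j <- r) F j x).
Proof. by move=> /(smooth_partials_sum r)[]. Qed.

Lemma partials_sum (I : Type) (r : seq I) (F : I -> V -> R[i]) s :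
  (forall j, smooth (F j)) -> partials s (fun x => \sum_(j <- r) F j x) =
            (fun x => \sum_(j <- r) partials s (F j) x).
Proof. by move=> /(smooth_partials_sum r)[]. Qed.

Definition character (w x : V) : R[i] := expi (dot w x).

End partial_calculus.

Section lines.
Context {R : realType} {V : normedModType R}.

(** The difference quotients on both sides are the same function. One-variable results (chain rule,
    mean value theorem) thereby apply to directional derivatives. *)
Lemma is_derive_line (f : V -> R) x v (t d : R) :
  is_derive (x + t *: v) v f d <-> is_derive t 1 (fun s => f (x + s *: v)) d.
Proof.
have E : (fun h : R => h^-1 *: (((fun s => f (x + s *: v)) \o shift t) (h *: 1)
     - f (x + t *: v))) =
  (fun h : R => h^-1 *: ((f \o shift (x + t *: v)) (h *: v) - f (x + t *: v))).
  apply/funext => h /=; congr (_ *: (f _ - _)).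
  by rewrite -[h *: 1]/(h * 1) mulr1 scalerDl addrCA.
by split=> -[H1 H2]; split; move: H1 H2; rewrite /derivable /derive E.
Qed.

End lines.

(** * Characters and their derivatives *)

Section characters.
Context {R : realType} {m : nat}.
Local Notation V := 'rV[R]_m.
Implicit Types (x y w : V) (i : 'I_m).

Lemma dotDr w x y : dot w (x + y) = dot w x + dot w y.
Proof. by rewrite /dot -big_split; apply: eq_bigr => i _; rewrite mxE mulrDr. Qed.

Lemma dotDl w x y : dot (x + y) w = dot x w + dot y w.
Proof. by rewrite /dot -big_split; apply: eq_bigr => i _; rewrite mxE mulrDl. Qed.

Lemma dotZr w (k : R) x : dot w (k *: x) = k * dot w x.
Proof. by rewrite /dot mulr_sumr; apply: eq_bigr => i _; rewrite mxE mulrCA. Qed.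

Lemma dotZl w (k : R) x : dot (k *: x) w = k * dot x w.
Proof. by rewrite /dot mulr_sumr; apply: eq_bigr => i _; rewrite mxE mulrA. Qed.

Lemma dot_delta w i : dot w (delta_mx 0 i) = w 0 i.
Proof.
rewrite /dot (bigD1 i)//= mxE !eqxx mulr1 big1 ?addr0// => j /negbTE ji.
by rewrite mxE ji andbF mulr0.
Qed.

Lemma characterD w x y : character w (x + y) = character w x * character w y.
Proof. by rewrite /character dotDr expiD. Qed.

Lemma normc_character w x : normc (character w x) = 1.
Proof. exact: normc_expi. Qed.

Lemma is_partial_character w i x :
  is_partial i (character w) x ((0 +i* w 0 i) * character w x).
Proof.
have E s : dot w (x + s *: delta_mx 0 i) = dot w x + s * w 0 i.
  by rewrite dotDr dotZr dot_delta.
have dl (a k : R) : is_derive (0 : R) 1 (fun s => a + s * k) k.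
  rewrite (_ : (fun s => _) = cst a + k *: id); last first.
    by apply/funext => s; rewrite !fctE mulrC.
  have := is_deriveD (is_derive_cst a (0 : R) 1) (is_deriveZ k (is_derive_id (0 : R) 1)).
  by rewrite add0r -[k *: 1]/(k * 1) mulr1.
have x0 : x = x + 0 *: delta_mx 0 i by rewrite scale0r addr0.
split; rewrite [X in is_derive X]x0; apply/is_derive_line.
  rewrite (_ : (fun s => _) = cos \o (fun s : R => dot w x + s * w 0 i)); last first.
    by apply/funext => s /=; rewrite E.
  have d := @is_derive1_comp _ cos (fun s => dot w x + s * w 0 i) 0 _ _
    (is_derive_cos _) (dl _ _).
  by apply: is_derive_eq; rewrite Re_mulc /= -E scale0r addr0; ring.
rewrite (_ : (fun s => _) = sin \o (fun s : R => dot w x + s * w 0 i)); last first.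
  by apply/funext => s /=; rewrite E.
have d := @is_derive1_comp _ sin (fun s => dot w x + s * w 0 i) 0 _ _
  (is_derive_sin _) (dl _ _).
by apply: is_derive_eq; rewrite Im_mulc /= -E scale0r addr0; ring.
Qed.

Lemma partials_character w s : partials s (character w) =
  (fun x => (\prod_(i <- s) (0 +i* w 0 i)) * character w x).
Proof.
elim: s => [|i s IH] /=.
  by apply/funext => x; rewrite big_nil mul1r.
rewrite IH; apply/funext => x; apply: partialE.
have := is_partialM (is_partial_cst i (\prod_(j <- s) (0 +i* w 0 j)) x)
  (is_partial_character w i x).
rewrite mul0r add0r big_cons mulrA => H; rewrite [X in is_partial _ _ _ (X * _)]mulrC.
exact: H.
Qed.

Lemma continuous_dot w : continuous (dot w : V -> R).
Proof.
move=> x; rewrite /dot; elim: (index_enum _) => [|i r IH].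
  by under eq_fun do rewrite big_nil; exact: cst_continuous.
under eq_fun do rewrite big_cons.
exact: (cvgD (cvgM (cvg_cst _) (@coord_continuous R 1 m 0 i x)) IH).
Qed.

Lemma continuous_character w :
  continuous (fun x => Re (character w x)) /\ continuous (fun x => Im (character w x)).
Proof.
split=> x.
  apply: (@continuous_comp _ _ _ (dot w) cos x); first exact: continuous_dot.
  exact: continuous_cos.
apply: (@continuous_comp _ _ _ (dot w) sin x); first exact: continuous_dot.
  exact: continuous_sin.
Qed.

Lemma smooth_character w : smooth (character w).
Proof.
apply/smooth_regular => n s _; rewrite /regular_at partials_character.
have [c1 c2] := continuous_character w.
set c := \prod_(i <- s) _.
have cc (f : R[i] -> R) : continuous (fun _ : V => f c) by move=> x; exact: cst_continuous.
have [d1 d2] := continuous_ReImM (cc (@complex.Re R)) (cc (@complex.Im R)) c1 c2; split=> // i x.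
have H := is_partialM (is_partial_cst i c x) (is_partial_character w i x).
by rewrite (partialE H).
Qed.

End characters.

(** * Families of functions with uniform weighted bounds *)

Section bounded_families.
Context {R : realType} {m : nat}.
Local Notation V := 'rV[R]_m.

(** The constant depends on [s] only, not on the index: later estimates rely on this uniformity over
    meshes and translations. *)
Definition bounded_family (T : Type) (w : T -> V -> R) (a : T -> V -> R[i]) :=
  (forall t, smooth (a t)) /\
  forall s, exists C : R, forall t x, w t x * normc (partials s (a t) x) <= C.

Section closure.
Context {T : Type}.
Implicit Types (w : T -> V -> R) (a b : T -> V -> R[i]).

Lemma bounded_familyW w w' (K : R) a : 0 <= K ->
  (forall t x, w' t x <= K * w t x) -> bounded_family w a -> bounded_family w' a.
Proof.
move=> K0 ww [sa Ba]; split=> // s; have [C HC] := Ba s.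
exists (K * C) => t x; apply: (@le_trans _ _ (K * w t x * normc (partials s (a t) x))).
  by rewrite ler_wpM2r ?normc_ge0.
by rewrite -mulrA ler_wpM2l.
Qed.

Lemma bounded_family_partial w a i :
  bounded_family w a -> bounded_family w (fun t => partial i (a t)).
Proof.
move=> [sa Ba]; split=> [t|s]; first exact: smooth_partial.
by have [C HC] := Ba (rcons s i); exists C => t x; rewrite -partials_rcons.
Qed.

Lemma bounded_familyD w a b : (forall t x, 0 <= w t x) ->
  bounded_family w a -> bounded_family w b ->
  bounded_family w (fun t x => a t x + b t x).
Proof.
move=> w0 [sa Ba] [sb Bb]; split=> [t|s]; first exact: smoothD.
have [[C HC] [D HD]] := (Ba s, Bb s); exists (C + D) => t x.
rewrite (partialsD s (sa t) (sb t)).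
apply: le_trans (lerD (HC t x) (HD t x)); rewrite -mulrDr.
by rewrite ler_wpM2l// le_normcD.
Qed.

Lemma bounded_familyM w1 w2 a b :
  (forall t x, 0 <= w1 t x) -> (forall t x, 0 <= w2 t x) ->
  bounded_family w1 a -> bounded_family w2 b ->
  bounded_family (fun t x => w1 t x * w2 t x) (fun t x => a t x * b t x).
Proof.
move=> w10 w20 Fa Fb; split=> [t|s]; first exact: smoothM (Fa.1 t) (Fb.1 t).
elim/last_ind: s a b Fa Fb => [|s i IH] a b Fa Fb.
  have [[C HC] [D HD]] := (Fa.2 [::], Fb.2 [::]); exists (C * D) => t x.
  rewrite /= normcM mulrACA; apply: ler_pM => //;
    by rewrite mulr_ge0// normc_ge0.
have [C HC] := IH _ _ (bounded_family_partial i Fa) Fb.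
have [D HD] := IH _ _ Fa (bounded_family_partial i Fb).
exists (C + D) => t x; rewrite partials_rcons partialM; [|exact: Fa.1|exact: Fb.1].
have s1 := smoothM (smooth_partial i (Fa.1 t)) (Fb.1 t).
have s2 := smoothM (Fa.1 t) (smooth_partial i (Fb.1 t)).
rewrite (partialsD s s1 s2).
apply: le_trans (lerD (HC t x) (HD t x)); rewrite -mulrDr.
by rewrite ler_wpM2l ?mulr_ge0// le_normcD.
Qed.

Lemma bounded_familyZ w a (c : T -> R[i]) (K : R) : (forall t x, 0 <= w t x) ->
  (forall t, normc (c t) <= K) ->
  bounded_family w a -> bounded_family w (fun t x => c t * a t x).
Proof.
move=> w0 cK [sa Ba]; split=> [t|s]; first exact: smoothZ.
have [C HC] := Ba s; exists (K * C) => t x.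
rewrite (partialsZ (c t) s (sa t)) normcM mulrCA ler_pM ?normc_ge0//.
by rewrite mulr_ge0// normc_ge0.
Qed.

Lemma bounded_family_conj w a :
  bounded_family w a -> bounded_family w (fun t x => conjc (a t x)).
Proof.
move=> [sa Ba]; split=> [t|s]; first exact: smooth_conj.
have [C HC] := Ba s; exists C => t x.
by rewrite (partials_conj s (sa t)) normc_conj.
Qed.

Lemma bounded_family_translate w a (y : T -> V) : bounded_family w a ->
  bounded_family (fun t x => w t (x + y t)) (fun t x => a t (x + y t)).
Proof.
move=> [sa Ba]; split=> [t|s]; first exact: smooth_translate.
by have [C HC] := Ba s; exists C => t x; rewrite partials_translate.
Qed.

Lemma bounded_family_character (w : V) :
  bounded_family (fun (_ : T) _ => 1) (fun _ => character w).
Proof.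
split=> [t|s]; first exact: smooth_character.
exists (normc (\prod_(i <- s) (0 +i* w 0 i))) => t x.
by rewrite partials_character normcM normc_character mulr1 mul1r.
Qed.

(** Each term is at most a constant over its weight, so the sum of the inverse weights controls a
    sum whose number of terms may grow with the index. *)
Lemma bounded_family_sum (J : Type) (r : T -> seq J) w (w1 : T * J -> V -> R)
    (F : T * J -> V -> R[i]) (K : R) :
  (forall p x, 0 < w1 p x) -> (forall t x, 0 <= w t x) ->
  (forall t x, w t x * \sum_(j <- r t) (w1 (t, j) x)^-1 <= K) ->
  bounded_family w1 F ->
  bounded_family w (fun t x => \sum_(j <- r t) F (t, j) x).
Proof.
move=> w10 w0 wK [sF BF]; split=> [t|s].
  by apply: (smooth_sum (r t) (F := fun j => F (t, j))) => j; exact: sF.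
have [C HC] := BF s; exists (K * Num.max C 0) => t x.
rewrite (partials_sum (r t) (F := fun j => F (t, j)) s (fun j => sF (t, j))).
apply: le_trans (_ : w t x * \sum_(j <- r t) ((w1 (t, j) x)^-1 * Num.max C 0) <= _).
  rewrite ler_wpM2l//; apply: le_trans (normc_sum _ _ _) _.
  apply: ler_sum => j _; rewrite ler_pdivlMl// (le_trans (HC (t, j) x))//.
  by rewrite le_max lexx.
by rewrite -mulr_suml mulrA ler_wpM2r// le_max lexx orbT.
Qed.

End closure.

Lemma bounded_family_reindex (T T' : Type) (f : T' -> T) w (a : T -> V -> R[i]) :
  bounded_family w a -> bounded_family (fun t => w (f t)) (fun t => a (f t)).
Proof.
move=> [sa Ba]; split=> [t|s]; first exact: sa.
by have [C HC] := Ba s; exists C => t x.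
Qed.

Definition bracket_pow k (x : V) : R := (1 + `|x|) ^+ k.

Lemma bracket_pow_gt0 k x : 0 < bracket_pow k x.
Proof. by rewrite exprn_gt0// ltr_pwDl. Qed.

Lemma bracket_pow_ge0 k x : 0 <= bracket_pow k x.
Proof. exact: ltW (bracket_pow_gt0 k x). Qed.

Lemma bracket_powD k l x : bracket_pow (k + l) x = bracket_pow k x * bracket_pow l x.
Proof. exact: exprD. Qed.

Lemma bracket_pow_mono k l x : (k <= l)%N -> bracket_pow k x <= bracket_pow l x.
Proof. by move=> kl; rewrite ler_weXn2l// lerDl. Qed.

Lemma bracket_pow_ge1 k x : 1 <= bracket_pow k x.
Proof. exact: (@bracket_pow_mono 0 k). Qed.

(** Peetre's inequality, from $1+|x|+|y|\le(1+|x|)(1+|y|)$; it moves weights through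
    translations. *)
Lemma bracket_pow_add k x y : bracket_pow k (x + y) <= bracket_pow k x * bracket_pow k y.
Proof.
rewrite /bracket_pow -exprMn lerXn2r ?nnegrE ?addr_ge0 ?mulr_ge0 ?addr_ge0//.
have := ler_normD x y; have : 0 <= `|x| * `|y| by rewrite mulr_ge0.
by move=> h1 h2; rewrite mulrDl mul1r mulrDr mulr1; lra.
Qed.

Lemma bracket_powN k x : bracket_pow k (- x) = bracket_pow k x.
Proof. by rewrite /bracket_pow normrN. Qed.

(** Bounded subsets of the Schwartz space, given as indexed families. *)
Definition schwartz_family (T : Type) (a : T -> V -> R[i]) :=
  forall k, bounded_family (fun _ => bracket_pow k) a.

Lemma schwartzP (h : V -> R[i]) : schwartz h <-> schwartz_family (fun _ : unit => h).
Proof.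
split=> [[sh Bh] k|H].
  split=> // s; have := Bh k s.
  case E : (seminorm k s h) => [C| |]//= _.
    exists C => t x; rewrite -lee_fin -E; apply: ereal_sup_ubound.
    by exists x.
  suff : (((1 + `|0 : V|) ^+ k * normc (partials s h 0))%:E <= -oo)%E by [].
  by rewrite -E; apply: ereal_sup_ubound; exists 0.
split; first exact: (H 0%N).1 tt.
move=> k s; have [C HC] := (H k).2 s.
apply: (@le_lt_trans _ _ C%:E); last exact: ltry.
by apply: ub_ereal_sup => _ [x _ <-]; rewrite lee_fin; exact: HC tt x.
Qed.

End bounded_families.

(** * Convergence of Schwartz functions *)

Lemma Re_subc (R : realType) (z w : R[i]) : complex.Re (z - w) = complex.Re z - complex.Re w.
Proof. by case: z w => ? ? [? ?]. Qed.

Lemma Im_subc (R : realType) (z w : R[i]) : complex.Im (z - w) = complex.Im z - complex.Im w.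
Proof. by case: z w => ? ? [? ?]. Qed.

Section mean_value.
Context {R : realType} {m : nat}.
Local Notation V := 'rV[R]_m.
Local Notation e_ i := (delta_mx 0 i : V).
Implicit Types (x y : V) (h : V -> R[i]) (i : 'I_m) (t r K : R).

Lemma rV_norm_le x r : 0 <= r -> `|x| <= r <-> forall j, `|x 0 j| <= r.
Proof.
move=> r0; rewrite -[`|x|]/(mx_norm x) mx_normrE; split.
  move=> /bigmax_leP[_ H] j; exact: (H (0, j)).
by move=> H; apply/bigmax_leP; split=> // -[k j] _ /=; rewrite (ord1 k).
Qed.

Lemma rV_coord_le x j : `|x 0 j| <= `|x|.
Proof. by apply: (rV_norm_le x (normr_ge0 x)).1. Qed.

Lemma norm_delta_le i t : `|t *: e_ i| <= `|t|.
Proof.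
apply/rV_norm_le => // j; rewrite !mxE /=.
by case: (j == i); rewrite ?mulr1// mulr0 normr0.
Qed.

Lemma MVT_line (f df : V -> R) x (v : V) t : 0 <= t ->
  (forall s : R, 0 <= s <= t -> is_derive (x + s *: v) v f (df (x + s *: v))) ->
  exists2 c : R, 0 <= c <= t & f (x + t *: v) - f x = df (x + c *: v) * t.
Proof.
move=> t0 H.
pose g (s : R) : R := f (x + s *: v); pose dg (s : R) : R := df (x + s *: v).
have D (s : R) : s \in `[0, t] -> is_derive s 1 g (dg s).
  rewrite in_itv /= => sI; exact: (is_derive_line f x v s _).1 (H s sI).
have cg : {within `[0, t], continuous g}.
  by apply: derivable_within_continuous => s /D[].
have [c cI E] := MVT_segment t0 (fun s sI => D s (subset_itv_oo_cc sI)) cg.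
exists c; first by move: cI; rewrite in_itv.
by move: E; rewrite /g /dg scale0r addr0 subr0.
Qed.

Lemma smooth_is_partial0 h i x : smooth h -> is_partial i h x (partial i h x).
Proof. exact: (smooth_is_partial [::]). Qed.

(** The mean value theorem is applied to the real and imaginary parts separately, at two different
    points; adding the two bounds gives the factor 2. *)
Lemma partial_increment_le h i x t K : smooth h -> 0 <= t ->
  (forall s : R, 0 <= s <= t -> normc (partial i h (x + s *: e_ i)) <= K) ->
  normc (h (x + t *: e_ i) - h x) <= 2 * (K * t).
Proof.
move=> sh t0 HK.
have [c1 I1 E1] := MVT_line (df := fun y => complex.Re (partial i h y)) t0
  (fun s _ => (smooth_is_partial0 i (x + s *: e_ i) sh).1).
have [c2 I2 E2] := MVT_line (df := fun y => complex.Im (partial i h y)) t0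
  (fun s _ => (smooth_is_partial0 i (x + s *: e_ i) sh).2).
apply: le_trans (normc_le_ReIm _) _; rewrite mulr_natl mulr2n.
have B (z : R[i]) : `|complex.Re z| <= normc z /\ `|complex.Im z| <= normc z.
  by split; [exact: Re_le_normc|exact: Im_le_normc].
have -> : complex.Re (h (x + t *: e_ i) - h x) =
    complex.Re (partial i h (x + c1 *: e_ i)) * t.
  by rewrite -E1 -Re_subc.
have -> : complex.Im (h (x + t *: e_ i) - h x) =
    complex.Im (partial i h (x + c2 *: e_ i)) * t.
  by rewrite -E2 -Im_subc.
rewrite !normrM (ger0_norm t0); apply: lerD; apply: ler_wpM2r => //.
  exact: le_trans (B _).1 (HK _ I1).
exact: le_trans (B _).2 (HK _ I2).
Qed.

(* Landau's inequality: a derivative is controlled by the function and the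
   second derivative. *)
Lemma partial_landau h i x t K : smooth h -> 0 <= t ->
  (forall s : R, 0 <= s <= t -> normc (partial i (partial i h) (x + s *: e_ i)) <= K) ->
  t * normc (partial i h x) <= 2 * (normc (h (x + t *: e_ i) - h x) + 2 * (K * t) * t).
Proof.
move=> sh t0 HK.
have [c1 I1 E1] := MVT_line (df := fun y => complex.Re (partial i h y)) t0
  (fun s _ => (smooth_is_partial0 i (x + s *: e_ i) sh).1).
have [c2 I2 E2] := MVT_line (df := fun y => complex.Im (partial i h y)) t0
  (fun s _ => (smooth_is_partial0 i (x + s *: e_ i) sh).2).
have D c : 0 <= c <= t ->
    normc (partial i h (x + c *: e_ i) - partial i h x) <= 2 * (K * t).
  move=> /andP[c0 ct]; apply: le_trans (_ : 2 * (K * c) <= _).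
    apply: partial_increment_le (smooth_partial i sh) c0 _.
    by move=> s /andP[s0 sc]; apply: HK; rewrite s0 (le_trans sc).
  rewrite ler_wpM2l// ler_wpM2l//.
  by apply: le_trans (normc_ge0 _) (HK 0 _); rewrite lexx.
have B (z : R[i]) : `|complex.Re z| <= normc z /\ `|complex.Im z| <= normc z.
  by split; [exact: Re_le_normc|exact: Im_le_normc].
set d := h (x + t *: e_ i) - h x.
have dR : complex.Re d = complex.Re (partial i h (x + c1 *: e_ i)) * t.
  by rewrite -E1 -Re_subc.
have dI : complex.Im d = complex.Im (partial i h (x + c2 *: e_ i)) * t.
  by rewrite -E2 -Im_subc.
have P (a b w : R) : `|b - a| <= w -> t * `|a| <= `|b * t| + w * t.
  move=> H; rewrite normrM (ger0_norm t0) -mulrDl [leRHS]mulrC ler_wpM2l//.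
  rewrite -[X in `|X|](subKr b); apply: le_trans (ler_normB _ _) _.
  by rewrite lerD2l.
apply: le_trans (ler_wpM2l t0 (normc_le_ReIm _)) _; rewrite mulrDr mulr_natl mulr2n.
apply: lerD.
  apply: le_trans (P _ (complex.Re (partial i h (x + c1 *: e_ i))) (2 * (K * t)) _) _.
    by apply: le_trans (D _ I1); rewrite -Re_subc; exact: (B _).1.
  by rewrite -dR lerD2r (B _).1.
apply: le_trans (P _ (complex.Im (partial i h (x + c2 *: e_ i))) (2 * (K * t)) _) _.
  by apply: le_trans (D _ I2); rewrite -Im_subc; exact: (B _).2.
by rewrite -dI lerD2r (B _).2.
Qed.

(** The segment is replaced by a path that changes one coordinate at a time, so that only partial
    derivatives occur; it stays in the ball because the norm is the maximum of the coordinates. *)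
Lemma partial_lipschitz h x y r K : smooth h -> `|x| <= r -> `|y| <= r ->
  (forall i z, `|z| <= r -> normc (partial i h z) <= K) ->
  normc (h y - h x) <= \sum_i 2 * (K * `|y 0 i - x 0 i|).
Proof.
move=> sh xr yr HK; have r0 : 0 <= r by exact: le_trans (normr_ge0 x) xr.
pose p (s : seq 'I_m) : V := \row_j (if j \in s then y 0 j else x 0 j).
have p0 : p [::] = x by apply/rowP => j; rewrite mxE.
have p1 : p (index_enum 'I_m) = y.
  by apply/rowP => j; rewrite mxE mem_index_enum.
have pr s z i : `|z| <= r -> `|p s + (z - p s 0 i) *: e_ i| <= r.
  move=> zr; apply/rV_norm_le => // j; rewrite !mxE eqxx /=.
  case: eqP => [->|_]; first by rewrite mulr1 addrC subrK.
  by rewrite mulr0 addr0; case: ifP => _; exact: le_trans (rV_coord_le _ _) _.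
have step s i : i \notin s ->
    normc (h (p (i :: s)) - h (p s)) <= 2 * (K * `|y 0 i - x 0 i|).
  move=> si; have pi : p s 0 i = x 0 i by rewrite mxE (negbTE si).
  have E : p (i :: s) = p s + (y 0 i - x 0 i) *: e_ i.
    apply/rowP => j; rewrite !mxE eqxx /= inE; case: eqP => [->|_] /=.
      by rewrite (negbTE si) mulr1 subrKC.
    by rewrite mulr0 addr0.
  (* [partial_increment_le] moves in the positive direction only, so the step starts from the
     endpoint with the smaller coordinate. *)
  have [xy|xy] := leP (x 0 i) (y 0 i).
    rewrite E ger0_norm ?subr_ge0//; apply: partial_increment_le => //.
      by rewrite subr_ge0.
    move=> u /andP[u0 u1]; apply: HK.
    rewrite -[u](addrK (x 0 i)) -{2}pi; apply: pr.
    have := rV_coord_le x i; have := rV_coord_le y i.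
    by rewrite !ler_norml => /andP[h1 h2] /andP[h3 h4]; apply/andP; split; lra.
  have -> : p s = p (i :: s) + (x 0 i - y 0 i) *: e_ i.
    by rewrite E -addrA -scalerDl addrC addrA subrK subrr scale0r add0r.
  rewrite -normcN opprB distrC ger0_norm ?subr_ge0 ?(ltW xy)//.
  apply: partial_increment_le => //; first by rewrite subr_ge0 ltW.
  move=> u /andP[u0 u1]; apply: HK.
  rewrite E -addrA -scalerDl -[_ + u](addrK (x 0 i)) -{3}pi; apply: pr.
  have := rV_coord_le x i; have := rV_coord_le y i.
  by rewrite !ler_norml => /andP[h1 h2] /andP[h3 h4]; apply/andP; split; lra.
rewrite -p1 -{1}p0.
suff : forall s, uniq s ->
    normc (h (p s) - h (p [::])) <= \sum_(i <- s) 2 * (K * `|y 0 i - x 0 i|).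
  by rewrite {2}p1; apply; exact: index_enum_uniq.
elim=> [_|i s IH /andP[si us]]; first by rewrite subrr normc0 big_nil.
rewrite big_cons -(subrKA (h (p s))); apply: le_trans (le_normcD _ _) _.
by apply: lerD; [exact: step|exact: IH].
Qed.

End mean_value.

Section convergence.
Context {R : realType} {m : nat}.
Local Notation V := 'rV[R]_m.
Local Notation e_ i := (delta_mx 0 i : V).
Implicit Types (h : V -> R[i]) (a : nat -> V -> R[i]).

Definition locally_vanishing a := forall r e : R, 0 < e ->
  exists N, forall n, (N <= n)%N -> forall x, `|x| <= r -> normc (a n x) <= e.

(** Landau's inequality with a small step [t]: the second derivatives are bounded uniformly in [n],
    and the functions tend to 0. *)
Lemma locally_vanishing_partial a i : schwartz_family a -> locally_vanishing a ->
  locally_vanishing (fun n => partial i (a n)).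
Proof.
move=> Fa La r e e0; have [C0 HC0] := (Fa 0%N).2 [:: i; i].
pose C := Num.max C0 1.
have C1 : 1 <= C by rewrite le_max lexx orbT.
have HC n x : normc (partial i (partial i (a n)) x) <= C.
  by have := HC0 n x; rewrite /bracket_pow expr0 mul1r le_max => ->.
have C0' : 0 < C by exact: lt_le_trans C1.
(* The right-hand side of Landau's inequality will be $2(2\cdot et/8+2Ct^2)=et/2+4Ct^2$, which is at
   most $et$ once $8Ct\le e$. *)
pose t := Num.min 1 (e / (8 * C)).
have t0 : 0 < t by rewrite lt_min ltr01 divr_gt0// mulr_gt0.
have t1 : t <= 1 by rewrite ge_min lexx.
have te : 8 * C * t <= e.
  by rewrite mulrC -ler_pdivlMr ?mulr_gt0// ge_min lexx orbT.
have [N HN] := La (r + 1) (e * t / 8) ltac:(by rewrite !mulr_gt0).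
exists N => n Nn x xr; rewrite -(ler_pM2l t0).
have lan := partial_landau ((Fa 0%N).1 n) (ltW t0) (fun s _ => HC n (x + s *: e_ i)).
apply: le_trans lan _.
have b1 := HN n Nn x ltac:(by rewrite (le_trans xr)// lerDl).
have b2 : normc (a n (x + t *: e_ i)) <= e * t / 8.
  apply: HN => //; apply: le_trans (ler_normD _ _) (lerD xr _).
  by apply: le_trans (norm_delta_le _ _) _; rewrite gtr0_norm.
have b3 : normc (a n (x + t *: e_ i) - a n x) <= e * t / 8 + e * t / 8.
  by apply: le_trans (le_normcD _ _) _; rewrite normcN; exact: lerD.
have : 8 * C * t * t <= e * t by rewrite ler_wpM2r// ltW.
lra.
Qed.

Lemma schwartz_family_partial T (a : T -> V -> R[i]) i : schwartz_family a ->
  schwartz_family (fun t => partial i (a t)).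
Proof. by move=> Fa k; exact: bounded_family_partial. Qed.

(** One extra power of the weight is spent: a bound $C$ with exponent [k.+1] gives $C/(1+|x|)\le e$
    outside the ball of radius $C/e$, and local convergence covers the ball. *)
Lemma vanishing_uniformly a k (e : R) : schwartz_family a -> locally_vanishing a -> 0 < e ->
  exists N, forall n, (N <= n)%N -> forall x, bracket_pow k x * normc (a n x) <= e.
Proof.
move=> Fa La e0; have [C0 HC0] := (Fa k.+1).2 [::].
pose C := Num.max C0 1.
have C1 : 1 <= C by rewrite le_max lexx orbT.
have C0' : 0 < C by exact: lt_le_trans C1.
have HC n x : bracket_pow k.+1 x * normc (a n x) <= C.
  by have := HC0 n x; rewrite le_max => ->.
pose r := C / e; have r0 : 0 < r by rewrite divr_gt0.
have [N HN] := La r (e / (1 + r) ^+ k) ltac:(by rewrite divr_gt0// exprn_gt0// addr_gt0).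
exists N => n Nn x; have [xr|xr] := leP `|x| r.
  apply: (@le_trans _ _ ((1 + r) ^+ k * (e / (1 + r) ^+ k))).
    apply: ler_pM; rewrite ?normc_ge0 ?bracket_pow_ge0//; last exact: HN.
    by rewrite lerXn2r ?nnegrE ?addr_ge0 ?lerD2l// ltW.
  by rewrite mulrC divfK// gt_eqF// exprn_gt0// addr_gt0.
have x0 : 0 < 1 + `|x| by rewrite ltr_pwDl.
rewrite -(ler_pM2l x0) mulrA -exprS; apply: le_trans (HC n x) _.
rewrite mulrC -ler_pdivrMl// mulrC -/r; lra.
Qed.

Lemma vanishing_partials a k (e : R) l : schwartz_family a -> locally_vanishing a ->
  0 < e -> exists N, forall n, (N <= n)%N -> forall s x, (size s <= l)%N ->
     bracket_pow k x * normc (partials s (a n) x) <= e.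
Proof.
move=> Fa La e0; elim: l a Fa La => [|l IH] a Fa La.
  have [N HN] := vanishing_uniformly k Fa La e0.
  by exists N => n Nn s x; rewrite leqn0 size_eq0 => /eqP ->; exact: HN.
have [N0 HN0] := vanishing_uniformly k Fa La e0.
have /choice[N HN] i := IH _ (schwartz_family_partial i Fa) (locally_vanishing_partial i Fa La).
exists (maxn N0 (\max_i N i)) => n; rewrite geq_max => /andP[n0 nN] s x.
case/lastP: s => [_|s i]; first exact: HN0.
rewrite size_rcons ltnS partials_rcons => sl; apply: HN => //.
by apply: leq_trans nN; exact: leq_bigmax.
Qed.

Lemma schwartz_familyD T (a b : T -> V -> R[i]) : schwartz_family a -> schwartz_family b ->
  schwartz_family (fun t x => a t x + b t x).
Proof. by move=> Fa Fb k; apply: bounded_familyD => // t x; exact: bracket_pow_ge0. Qed.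

Lemma schwartz_familyZ T (a : T -> V -> R[i]) (c : T -> R[i]) (K : R) :
  (forall t, normc (c t) <= K) -> schwartz_family a ->
  schwartz_family (fun t x => c t * a t x).
Proof.
by move=> cK Fa k; apply: bounded_familyZ cK _ => // t x; exact: bracket_pow_ge0.
Qed.

Lemma schwartz_familyN T (a : T -> V -> R[i]) : schwartz_family a ->
  schwartz_family (fun t x => - a t x).
Proof.
move=> Fa; have := @schwartz_familyZ T a (fun=> -1) 1 _ Fa.
rewrite (_ : (fun t x => -1 * a t x) = (fun t x => - a t x)).
  by apply=> t; rewrite normcN normc1.
by apply/funext => t; apply/funext => x; rewrite mulN1r.
Qed.

Lemma schwartz_familyB T (a b : T -> V -> R[i]) : schwartz_family a -> schwartz_family b ->
  schwartz_family (fun t x => a t x - b t x).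
Proof. by move=> Fa /schwartz_familyN; exact: schwartz_familyD. Qed.

Lemma schwartz_family_at T (a : T -> V -> R[i]) t : schwartz_family a -> schwartz (a t).
Proof.
move=> Fa; apply/schwartzP => k.
exact: (bounded_family_reindex (fun _ : unit => t) (Fa k)).
Qed.

Lemma schwartz_family_cst T h : schwartz h -> schwartz_family (fun _ : T => h).
Proof.
move=> /schwartzP H k; exact: (bounded_family_reindex (fun _ : T => tt) (H k)).
Qed.

Lemma schwartzD (f g : V -> R[i]) : schwartz f -> schwartz g ->
  schwartz (fun x => f x + g x).
Proof.
by move=> /schwartzP sf /schwartzP sg; apply/schwartzP; exact: schwartz_familyD.
Qed.

Lemma schwartzZ c (f : V -> R[i]) : schwartz f -> schwartz (fun x => c * f x).
Proof.
move=> /schwartzP sf; apply/schwartzP.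
by apply: (@schwartz_familyZ _ _ (fun=> c) (normc c)).
Qed.

(** By [vanishing_partials], boundedness together with locally uniform convergence makes the
    finitely many seminorms selected by the continuity of [f] small. *)
Lemma tempered_cvg f a h (e : R) : tempered f -> schwartz h ->
  (forall n, schwartz (a n)) ->
  schwartz_family (fun n x => a n x - h x) ->
  locally_vanishing (fun n x => a n x - h x) -> 0 < e ->
  exists N, forall n, (N <= n)%N -> normc (f (a n) - f h) < e.
Proof.
move=> [_ cf] sh sa Fa La e0; have [M [d [d0 Hd]]] := cf h sh e e0.
have [N HN] := vanishing_partials M M Fa La (divr_gt0 d0 (ltr0n _ 2)).
exists N => n Nn; apply: Hd => // k s kM sM.
apply: (@le_lt_trans _ _ (d / 2)%:E); last by rewrite lte_fin; lra.
apply: ub_ereal_sup => _ [x _ <-]; rewrite lee_fin.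
apply: le_trans (HN n Nn s x sM); rewrite ler_wpM2r ?normc_ge0//.
exact: bracket_pow_mono.
Qed.

End convergence.

(** * Lattice sums over boxes *)

Section box.
Context {R : realType}.
Variable K : nat.
Local Notation M := (2 * K).+1.

Definition centered (j : 'I_M) : R := j%:R - K%:R.

Lemma centered_le j : `|centered j| <= K%:R.
Proof.
have : (j : nat)%:R <= (2 * K)%:R :> R by rewrite ler_nat -ltnS.
rewrite natrM ler_norml /centered => h; have := ler0n R j; move=> h0.
by apply/andP; split; lra.
Qed.

(** Comparison with $\int(1+x)^{-2}dx$, done by telescoping: with $a=1+en$, one has $e/(a+e)^2\le
    e/(a(a+e))=1/a-1/(a+e)$. *)
Lemma sum_inv_square_le (e : R) n : 0 < e -> e <= 1 ->
  \sum_(0 <= j < n) e * (1 + e * j.+1%:R) ^- 2 <= 1 - (1 + e * n%:R)^-1.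
Proof.
move=> e0 e1; elim: n => [|n IH].
  by rewrite big_geq// mulr0 addr0 invr1 subrr.
rewrite big_nat_recr//=; apply: le_trans (lerD IH (lexx _)) _.
have a0 : 0 < 1 + e * n%:R by rewrite ltr_pwDl// mulr_ge0// ltW.
set a := 1 + e * n%:R in a0 *.
have -> : 1 + e * n.+1%:R = a + e by rewrite /a -natr1 mulrDr mulr1 addrA.
have b0 : 0 < a + e by rewrite addr_gt0.
have H : e * (a + e) ^- 2 <= a^-1 - (a + e)^-1.
  have -> : a^-1 - (a + e)^-1 = e * (a * (a + e))^-1.
    by field; rewrite !gt_eqF.
  rewrite ler_wpM2l ?(ltW e0)// lef_pV2 ?posrE ?exprn_gt0 ?mulr_gt0//.
  by rewrite expr2 ler_wpM2r ?(ltW b0)// lerDl ltW.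
lra.
Qed.

(** Each side of the origin contributes at most 1, and so does the central term [e]. *)
Lemma sum_centered_le (e : R) : 0 < e -> e <= 1 ->
  \sum_(j < M) e * (1 + e * `|centered j|) ^- 2 <= 3.
Proof.
move=> e0 e1; pose F (n : nat) : R := e * (1 + e * `|n%:R - K%:R|) ^- 2.
rewrite -(big_mkord xpredT F) (@big_cat_nat _ _ _ K)//=; last by lia.
have S1 : \sum_(0 <= j < K) F j <= 1.
  rewrite big_nat_rev /= (eq_big_nat _ _ (F2 := fun j => e * (1 + e * j.+1%:R) ^- 2)).
    apply: le_trans (sum_inv_square_le _ e0 e1) _.
    by rewrite gerBl invr_ge0 addr_ge0// mulr_ge0// ltW.
  move=> j /andP[_ jK]; rewrite /F add0n natrB// distrC opprD opprK addrA subrr add0r.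
  by rewrite normr_nat.
have S2 : \sum_(K <= j < M) F j <= 2.
  rewrite big_ltn; last by lia.
  rewrite (_ : F K = e); last by rewrite /F subrr normr0 mulr0 addr0 expr1n invr1 mulr1.
  rewrite -{1}[K.+1]add0n big_addn (eq_big_nat _ _ (F2 := fun j => e * (1 + e * j.+1%:R) ^- 2)).
    have := sum_inv_square_le (M - K.+1)%N e0 e1.
    suff : 0 <= (1 + e * (M - K.+1)%:R)^-1 by lra.
    by rewrite invr_ge0 addr_ge0// mulr_ge0// ltW.
  move=> j _; rewrite /F (_ : (j + K.+1)%N = (j.+1 + K)%N); last by lia.
  by rewrite natrD addrK normr_nat.
lra.
Qed.

Context {m : nat}.
Local Notation V := 'rV[R]_m.
Local Notation e_ i := (delta_mx 0 i : V).
Local Notation J := {ffun 'I_m -> 'I_M}.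

Definition grid_point (e : R) (j : J) : V := \row_i (e * centered (j i)).

(** Every coordinate is at most the norm. This is the origin of the exponent [2 * m]: it yields an
    inverse square in each coordinate, which is summable. *)
Lemma prod_le_bracket (x : V) : \prod_i (1 + `|x 0 i|) ^+ 2 <= bracket_pow (2 * m) x.
Proof.
rewrite /bracket_pow exprM -[X in _ ^+ X]card_ord -prodr_const.
apply: ler_prod => i _; rewrite exprn_ge0 ?addr_ge0//=.
by rewrite lerXn2r ?nnegrE ?addr_ge0// lerD2l rV_coord_le.
Qed.

Lemma sum_prod_centered_le (e : R) : 0 < e -> e <= 1 ->
  e ^+ m * \sum_(j : J) \prod_i (1 + e * `|centered (j i)|) ^- 2 <= 3 ^+ m.
Proof.
move=> e0 e1.
have -> : e ^+ m * \sum_(j : J) \prod_i (1 + e * `|centered (j i)|) ^- 2 =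
    \sum_(j : J) \prod_i (e * (1 + e * `|centered (j i)|) ^- 2).
  rewrite mulr_sumr; apply: eq_bigr => j _; rewrite big_split /=.
  by rewrite prodr_const card_ord.
rewrite -(bigA_distr_bigA (fun=> fun k => e * (1 + e * `|centered k|) ^- 2)).
rewrite -[X in _ ^+ X]card_ord -prodr_const; apply: ler_prod => i _.
rewrite sum_centered_le// andbT sumr_ge0// => j _.
by rewrite mulr_ge0 ?invr_ge0 ?exprn_ge0 ?addr_ge0 ?mulr_ge0 ?(ltW e0).
Qed.

Lemma sum_bracket_le (e : R) : 0 < e -> e <= 1 ->
  e ^+ m * \sum_(j : J) (bracket_pow (2 * m) (grid_point e j))^-1 <= 3 ^+ m.
Proof.
move=> e0 e1; apply: le_trans (sum_prod_centered_le e0 e1).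
rewrite ler_wpM2l ?exprn_ge0 ?(ltW e0)//; apply: ler_sum => j _.
rewrite prodfV lef_pV2 ?posrE ?bracket_pow_gt0//; last first.
  by apply: prodr_gt0 => i _; rewrite exprn_gt0// ltr_pwDl// mulr_ge0// ltW.
apply: le_trans (prod_le_bracket _); apply: ler_prod => i _.
by rewrite exprn_ge0 ?addr_ge0 ?mulr_ge0 ?(ltW e0)//= mxE normrM (gtr0_norm e0).
Qed.

Definition box_sum (e : R) (G : V -> R[i]) : R[i] :=
  (e ^+ m)%:C * \sum_(j : J) G (grid_point e j).

Lemma box_sum_le (e B : R) (G : V -> R[i]) : 0 < e -> e <= 1 ->
  (forall x, bracket_pow (2 * m) x * normc (G x) <= B) ->
  normc (box_sum e G) <= 3 ^+ m * B.
Proof.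
move=> e0 e1 GB; rewrite /box_sum normcM normc_real ger0_norm ?exprn_ge0 ?(ltW e0)//.
have B0 : 0 <= B.
  by apply: le_trans (GB 0); rewrite mulr_ge0 ?normc_ge0 ?bracket_pow_ge0.
apply: le_trans (ler_wpM2r B0 (sum_bracket_le e0 e1)).
rewrite -mulrA ler_wpM2l ?exprn_ge0 ?(ltW e0)// mulr_suml.
apply: le_trans (normc_sum _ _ _) _; apply: ler_sum => j _.
by rewrite mulrC ler_pdivlMr ?bracket_pow_gt0// mulrC.
Qed.

Lemma box_sumD e (F G : V -> R[i]) :
  box_sum e (fun x => F x + G x) = box_sum e F + box_sum e G.
Proof. by rewrite /box_sum big_split mulrDr. Qed.

Lemma box_sumZ e c (F : V -> R[i]) : box_sum e (fun x => c * F x) = c * box_sum e F.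
Proof. by rewrite /box_sum -mulr_sumr mulrCA. Qed.

Definition cycle_at (i : 'I_m) (j : J) : J :=
  [ffun l => if l == i then ordS (j l) else j l].

Lemma cycle_at_inj i : injective (cycle_at i).
Proof.
move=> j1 j2 /ffunP E; apply/ffunP => l; have := E l; rewrite !ffunE.
by case: eqP => // _; exact: ordS_inj.
Qed.

Lemma grid_point_cycle e i (j : J) : (j i != ord_max) ->
  grid_point e (cycle_at i j) = grid_point e j + e *: e_ i.
Proof.
move=> ji; apply/rowP => l; rewrite !mxE ffunE eqxx /=.
case: eqP => [->|_]; last by rewrite mulr0 addr0.
rewrite mulr1 /centered /= modn_small; last first.
  by move: (j i) ji => k; rewrite -val_eqE /=; have := ltn_ord k; lia.
by rewrite -natr1; ring.
Qed.

(** At the last index of coordinate [i], the grid point, its translate out of the box and the point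
    it wraps to all have norm at least [e * K], where a rapidly decaying function is small. *)
Lemma grid_point_cycle_max (e : R) i (j : J) : 0 < e -> j i = ord_max ->
  `|grid_point e j| <= `|grid_point e (cycle_at i j)| /\
  `|grid_point e j| <= `|grid_point e j + e *: e_ i| /\
  e * K%:R <= `|grid_point e j|.
Proof.
move=> e0 ji.
have cK : centered (j i) = K%:R by rewrite /centered ji /= natrM; ring.
split; [|split].
- apply/rV_norm_le => // l; rewrite mxE; case: (eqVneq l i) => [->|li].
    rewrite cK; apply: le_trans (rV_coord_le _ i); rewrite mxE ffunE eqxx.
    rewrite /centered ji /= modnn sub0r normrM [leRHS]normrM normrN//.
  apply: le_trans (rV_coord_le _ l); rewrite mxE ffunE (negbTE li)//.
- apply/rV_norm_le => // l; apply: le_trans (rV_coord_le _ l); rewrite !mxE eqxx /=.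
  case: (eqVneq l i) => [->|li]; last by rewrite mulr0 addr0.
  have K0 : 0 <= K%:R :> R by [].
  rewrite cK mulr1 !ger0_norm ?addr_ge0 ?mulr_ge0 ?(ltW e0)//.
  by rewrite lerDl ltW.
- apply: le_trans (rV_coord_le _ i); rewrite mxE cK ger0_norm//.
  by rewrite mulr_ge0// ltW.
Qed.

(* Cyclic reindexing of the i-th coordinate: only the points of one face of
   the box contribute. *)
Lemma box_sum_shift (e B : R) q i (G : V -> R[i]) : 0 < e -> e <= 1 ->
  (forall x, bracket_pow (2 * m + q) x * normc (G x) <= B) ->
  normc (box_sum e (fun x => G (x + e *: e_ i)) - box_sum e G)
    <= 2 * 3 ^+ m * B / (1 + e * K%:R) ^+ q.
Proof.
move=> e0 e1 GB.
have B0 : 0 <= B.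
  by apply: le_trans (GB 0); rewrite mulr_ge0 ?normc_ge0 ?bracket_pow_ge0.
have a0 : 0 < (1 + e * K%:R) ^+ q by rewrite exprn_gt0// ltr_pwDl// mulr_ge0// ltW.
rewrite /box_sum [X in _ - _ * X](reindex_inj (@cycle_at_inj i)) -mulrBr -sumrB.
rewrite normcM normc_real ger0_norm ?exprn_ge0 ?(ltW e0)//.
(* Off the last face the translate is again a grid point and the two terms cancel. On it both are
   small, and their sum gives the factor 2. *)
have H (j : J) : normc (G (grid_point e j + e *: e_ i) - G (grid_point e (cycle_at i j)))
    <= (bracket_pow (2 * m) (grid_point e j))^-1 * (2 * B / (1 + e * K%:R) ^+ q).
  have [ji|/grid_point_cycle ->] := eqVneq (j i) ord_max; last first.
    rewrite subrr normc0 mulr_ge0// ?invr_ge0 ?bracket_pow_ge0//.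
    by rewrite divr_ge0 ?mulr_ge0// ltW.
  have [h1 [h2 h3]] := grid_point_cycle_max e0 ji.
  have P (y : V) : `|grid_point e j| <= `|y| ->
      normc (G y) <= (bracket_pow (2 * m) (grid_point e j))^-1 * (B / (1 + e * K%:R) ^+ q).
    move=> hy; rewrite mulrC -mulrA -invfM ler_pdivlMr; last first.
      by rewrite mulr_gt0// bracket_pow_gt0.
    apply: le_trans (GB y); rewrite [leRHS]mulrC ler_wpM2l ?normc_ge0//.
    rewrite bracket_powD mulrC; apply: ler_pM.
    - exact: bracket_pow_ge0.
    - exact: ltW.
    - by rewrite /bracket_pow lerXn2r ?nnegrE ?addr_ge0// lerD2l.
    - rewrite /bracket_pow lerXn2r ?nnegrE ?addr_ge0 ?mulr_ge0 ?(ltW e0)//.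
      by rewrite lerD2l (le_trans h3).
  apply: le_trans (le_normcD _ _) _; rewrite normcN.
  apply: le_trans (lerD (P _ h2) (P _ h1)) _; rewrite -mulrDr.
  by apply: ler_wpM2l; [rewrite invr_ge0 bracket_pow_ge0|lra].
apply: le_trans (_ : e ^+ m * \sum_(j : J)
   (bracket_pow (2 * m) (grid_point e j))^-1 * (2 * B / (1 + e * K%:R) ^+ q) <= _).
  rewrite ler_wpM2l ?exprn_ge0 ?(ltW e0)//; apply: le_trans (normc_sum _ _ _) _.
  by apply: ler_sum => j _; exact: H.
rewrite -mulr_suml mulrA; apply: le_trans (ler_wpM2r _ (sum_bracket_le e0 e1)) _.
  by rewrite divr_ge0 ?mulr_ge0// ltW.
by rewrite !mulrA [3 ^+ m * 2]mulrC.
Qed.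

End box.

(** * Discrete Fourier interpolation *)

Lemma conjcM (R : realType) (z w : R[i]) : conjc (z * w) = conjc z * conjc w.
Proof. exact: rmorphM. Qed.

Section trigonometry.
Context {R : realType}.

(** Jordan's inequality with a weaker constant: $\sin y=2\sin(y/2)\cos(y/2)$, the mean value theorem
    gives $\sin(y/2)\ge(y/2)\cos(y/2)$, and $2\cos^2(y/2)=1+\cos y\ge1$. *)
Lemma sin_ge_half (y : R) : 0 <= y <= pi / 2 -> y / 2 <= sin y.
Proof.
move=> /andP[y0 y1]; have p0 : 0 < pi :> R := pi_gt0 R.
have [c cI E] := @MVT_segment R sin cos 0 (y / 2) ltac:(by rewrite divr_ge0)
  (fun s _ => is_derive_sin s) (continuous_subspaceT (@continuous_sin R)).
move: cI; rewrite in_itv /= => /andP[c0 c1].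
rewrite sin0 !subr0 in E.
have cc : cos (y / 2) <= cos c.
  rewrite leNgt ltr_cos ?in_itv/=; [by rewrite -leNgt| |]; apply/andP; split; lra.
have ch : 0 <= cos (y / 2) by apply: cos_ge0_pihalf; apply/andP; split; lra.
have c2 : 1 <= cos (y / 2) ^+ 2 *+ 2.
  rewrite -subr_ge0 -cos_mulr2n (_ : y / 2 *+ 2 = y); last first.
    by rewrite -mulr_natr divfK ?pnatr_eq0.
  by apply: cos_ge0_pihalf; apply/andP; split; lra.
have -> : sin y = 2 * (sin (y / 2) * cos (y / 2)).
  have {1}-> : y = (y / 2) *+ 2 by rewrite -mulr_natr divfK.
  by rewrite sin_mulr2n -mulr_natl [cos _ * _]mulrC.
rewrite E.
have : cos (y / 2) * cos (y / 2) <= cos c * cos (y / 2) by rewrite ler_wpM2r.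
rewrite -expr2 => c3.
have : y * (1 / 2) <= y * (cos c * cos (y / 2)).
  by rewrite ler_wpM2l//; move: c2; rewrite -mulr_natl; lra.
lra.
Qed.

Lemma normc_subexpi_ge (t : R) : 2 * `|sin (t / 2)| <= normc (1 - expi t : R[i]).
Proof.
have E : normc (1 - expi t : R[i]) = Num.sqrt ((1 - cos t) ^+ 2 + (sin t) ^+ 2).
  by rewrite /= sub0r sqrrN.
have tE : t = (t / 2) *+ 2 by rewrite -mulr_natr divfK ?pnatr_eq0.
have cs : sin (t / 2) ^+ 2 = 1 - cos (t / 2) ^+ 2 by have := cos2Dsin2 (t / 2); lra.
have C := cos_mulr2n (t / 2); rewrite -tE in C.
have S := sin2cos2 t.
rewrite E -[2 * _]ger0_norm ?mulr_ge0// -sqrtr_sqr ler_wsqrtr//.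
rewrite exprMn real_normK ?num_real// cs S C -mulr_natl; lra.
Qed.

(** The real part $1+a(1-\cos t)$ is at least 1, and adding 1 to $a(1-e^{it})$ only increases the
    modulus since $a(1-\cos t)\ge0$. The two lower bounds are added. *)
Lemma normc_symbol_ge (a t : R) : 0 <= a ->
  1 + a * normc (1 - expi t : R[i]) <= 2 * normc (1 + a%:C * (1 - expi t) : R[i]).
Proof.
move=> a0; set z := 1 + a%:C * (1 - expi t).
have n0 : 0 <= 1 - cos t by rewrite subr_ge0 cos_le1.
have Rz : complex.Re z = 1 + a * (1 - cos t) by rewrite /= mul0r subr0.
have h1 : 1 <= normc z.
  apply: le_trans (Re_le_normc z); rewrite Rz ger0_norm ?lerDl ?mulr_ge0//.
  by rewrite addr_ge0 ?mulr_ge0.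
have h2 : a * normc (1 - expi t : R[i]) <= normc z.
  rewrite -{1}(ger0_norm a0) -normc_real -normcM.
  rewrite /z /= !mul0r !subr0 !addr0 ler_wsqrtr//.
  have : 0 <= a * (1 - cos t) by rewrite mulr_ge0.
  set b := a * (1 - cos t) => b0.
  by rewrite !add0r lerD2r lerXn2r ?nnegrE//; lra.
lra.
Qed.

End trigonometry.

Section dft.
Context {R : realType} {m : nat}.
Local Notation V := 'rV[R]_m.
Local Notation e_ i := (delta_mx 0 i : V).
Implicit Types (u : V -> R[i]) (L : nat).

(** With [L.+1 ^ 2] steps of this size on each side of the origin, the box has half-width [L.+1]:
    the grid becomes finer and larger at once. *)
Definition mesh L : R := L.+1%:R^-1.
Local Notation half L := (L.+1 ^ 2)%N.
Local Notation M L := ((2 * (L.+1 ^ 2)%N).+1).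
Local Notation J L := {ffun 'I_m -> 'I_(M L)}.

Definition period L : R := (M L)%:R * mesh L.

Lemma mesh_gt0 L : 0 < mesh L. Proof. by rewrite invr_gt0. Qed.

Lemma mesh_le1 L : mesh L <= 1. Proof. by rewrite invf_le1// ler1n. Qed.

Lemma mesh_half L : mesh L * (half L)%:R = L.+1%:R.
Proof. by rewrite /mesh natrX expr2 mulKf// pnatr_eq0. Qed.

Lemma period_ge1 L : 1 <= period L.
Proof.
rewrite /period /mesh ler_pdivlMr ?ltr0n// mul1r ler_nat.
by rewrite expnS expn1; nia.
Qed.

Lemma period_gt0 L : 0 < period L. Proof. exact: lt_le_trans (period_ge1 L). Qed.

(** Frequencies of the characters that are periodic with [period L] in each coordinate. Centering
    them is what allows the lower bound [symbol_ge]. *)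
Definition freq L (k : J L) : V :=
  \row_i (2 * pi * ((period L)^-1 * centered (k i))).

Definition dft L (k : J L) u : R[i] :=
  box_sum (half L) (mesh L) (fun x => u x * conjc (character (freq k) x)).

(* The multiplier of [u |-> u + backward difference quotient] in direction i:
   dividing by it gains decay in frequency, uniformly in the mesh. *)
Definition symbol L (k : J L) i : R[i] :=
  1 + ((mesh L)^-1)%:C * (1 - expi (- (freq k 0 i * mesh L))).

(** Up to sign the phase is $2\pi k/M$ for the centered index $k$, so the difference is bounded
    below by $2|\sin(\pi k/M)|$. Since $|k|\le M/2$, the argument stays in $[-\pi/2,\pi/2]$, where
    [sin_ge_half] applies. *)
Lemma symbol_ge L (k : J L) i :
  1 + (period L)^-1 * `|centered (k i) : R| <= 2 * normc (symbol k i).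
Proof.
have e0 := mesh_gt0 L; have ei0 : 0 <= (mesh L)^-1 by rewrite invr_ge0 ltW.
apply: le_trans (normc_symbol_ge (- (freq k 0 i * mesh L)) ei0).
rewrite lerD2l; apply: le_trans (ler_wpM2l ei0 (normc_subexpi_ge _)).
set c : R := centered (k i).
have E : freq k 0 i * mesh L / 2 = pi * (c / (M L)%:R).
  by rewrite mxE /period -/c; field; rewrite !gt_eqF ?mesh_gt0.
rewrite mulNr sinN normrN E.
have p2 : 2 <= pi :> R by have := pi_ge2 R.
have M0 : 0 < (M L)%:R :> R by rewrite ltr0n.
have cM : `|c| / (M L)%:R <= 2^-1.
  rewrite ler_pdivrMr// (le_trans (centered_le _))//.
  by rewrite -[(M L)%:R]natr1 [(2 * _)%:R]natrM; lra.
have -> : `|sin (pi * (c / (M L)%:R))| = `|sin (pi * (`|c| / (M L)%:R))|.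
  have [c0|c0] := ger0P c; first by [].
  by rewrite mulNr mulrN sinN normrN.
have d0 : 0 <= `|c| / (M L)%:R by rewrite divr_ge0// ltW.
have sy : pi * (`|c| / (M L)%:R) / 2 <= sin (pi * (`|c| / (M L)%:R)).
  apply: sin_ge_half; rewrite mulr_ge0 ?ler_wpM2l//; lra.
have H : pi * (`|c| / (M L)%:R) <= 2 * `|sin (pi * (`|c| / (M L)%:R))|.
  by move: sy; set a := pi * _; have := ler_norm (sin a); lra.
apply: le_trans (ler_wpM2l ei0 H).
rewrite /period invfM mulrAC mulrC ler_wpM2l// mulrC.
by rewrite ler_peMl//; lra.
Qed.

(** A crude bound, growing with [L]; it serves for the boundary terms in [dft_decay], whose decay
    absorbs it. *)
Lemma symbol_le L (k : J L) i : normc (symbol k i) <= 3 * L.+1%:R.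
Proof.
apply: le_trans (le_normcD _ _) _; rewrite normc1 normcM normc_real.
rewrite /mesh invrK ger0_norm//.
have h : normc (1 - expi (- (freq k 0 i * L.+1%:R^-1)) : R[i]) <= 2.
  by apply: le_trans (le_normcD _ _) _; rewrite normcN normc1 normc_expi.
have : L.+1%:R * normc (1 - expi (- (freq k 0 i * L.+1%:R^-1)) : R[i]) <= L.+1%:R * 2.
  by rewrite ler_wpM2l.
have : 1 <= L.+1%:R :> R by rewrite ler1n.
lra.
Qed.

Definition backward L i u : V -> R[i] :=
  fun x => u x + ((mesh L)^-1)%:C * (u x - u (x - mesh L *: e_ i)).

(** Summation by parts. The box is not invariant under translation by one step, and the difference
    of box sums is the resulting boundary term. *)
Lemma symbol_dft L (k : J L) i u :
  let G x := u (x - mesh L *: e_ i) * conjc (character (freq k) x) in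
  symbol k i * dft k u = dft k (backward L i u) -
   ((mesh L)^-1)%:C * (box_sum (half L) (mesh L) (fun x => G (x + mesh L *: e_ i))
       - box_sum (half L) (mesh L) G).
Proof.
move=> G; set a := ((mesh L)^-1)%:C.
have E1 : box_sum (half L) (mesh L) (fun x => G (x + mesh L *: e_ i)) =
    expi (- (freq k 0 i * mesh L)) * dft k u.
  rewrite /dft -box_sumZ; congr box_sum; apply/funext => x.
  have E : conjc (character (freq k) (mesh L *: e_ i)) = expi (- (freq k 0 i * mesh L)).
    by rewrite /character dotZr dot_delta [mesh L * _]mulrC expiN.
  by rewrite /G addrK characterD conjcM E mulrA mulrC.
have E2 : dft k (backward L i u) =
    dft k u + a * (dft k u - box_sum (half L) (mesh L) G).
  rewrite -[- box_sum _ _ G]mulN1r -box_sumZ -box_sumD -box_sumZ -box_sumD.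
  congr box_sum; apply/funext => x; rewrite /backward /G -/a; ring.
rewrite E1 E2 /symbol -/a; ring.
Qed.

(** The weight [w t] records how fast the functions decrease with the index; in [schwartz_in_hull]
    the index is a translation parameter and [w] a power of its size. *)
Definition weighted_schwartz T (w : T -> R) (u : T -> V -> R[i]) :=
  forall k, bounded_family (fun t x => w t * bracket_pow k x) u.

(** A difference quotient is bounded by the derivative on a short segment, whatever the mesh.
    Letting the mesh vary with the index makes one constant serve all [L]. *)
Lemma weighted_backward T (w : T -> R) (u : T -> V -> R[i]) (Lf : T -> nat) i :
  (forall t, 0 < w t) -> weighted_schwartz w u ->
  weighted_schwartz w (fun t => backward (Lf t) i (u t)).
Proof.
move=> w0 Hu k.
have w1 t x : 0 <= w t * bracket_pow k x.
  by rewrite mulr_ge0 ?bracket_pow_ge0// ltW.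
apply: bounded_familyD => //; split=> [t|s].
  have su := (Hu k).1 t; have s1 := smoothZ (-1) (smooth_translate (- (mesh (Lf t) *: e_ i)) su).
  have := smoothZ ((mesh (Lf t))^-1)%:C (smoothD su s1).
  by congr smooth; apply/funext => x; rewrite mulN1r.
have [C HC] := (Hu k).2 (i :: s).
(* The first 2 comes from [partial_increment_le]; $2^k$ is Peetre's inequality for a displacement of
   length at most 1. *)
exists (2 * (C * 2 ^+ k)) => t x.
have su := (Hu k).1 t; have e0 := mesh_gt0 (Lf t); set e := mesh (Lf t) in e0 *.
have -> : partials s (fun x => (e^-1)%:C * (u t x - u t (x - e *: e_ i))) x =
    (e^-1)%:C * (partials s (u t) x - partials s (u t) (x - e *: e_ i)).
  have s1 := smooth_translate (- (e *: e_ i)) su.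
  have s2 := smoothZ (-1) s1.
  rewrite (_ : (fun x => _) =
     (fun x => (e^-1)%:C * (u t x + (-1) * u t (x + - (e *: e_ i))))); last first.
    by apply/funext => y; rewrite mulN1r.
  rewrite (partialsZ _ s (smoothD su s2)) (partialsD s su s2) (partialsZ _ s s1).
  by rewrite partials_translate mulN1r.
have W : 0 < w t * bracket_pow k x by rewrite mulr_gt0 ?bracket_pow_gt0.
rewrite normcM normc_real ger0_norm ?invr_ge0 ?(ltW e0)//.
have := @partial_increment_le R m (partials s (u t)) i (x - e *: e_ i) e
  (C * 2 ^+ k / (w t * bracket_pow k x)) (smooth_partials s su) (ltW e0).
rewrite subrK => H.
have {}H : normc (partials s (u t) x - partials s (u t) (x - e *: e_ i)) <=
    2 * (C * 2 ^+ k / (w t * bracket_pow k x) * e).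
  apply: H => r /andP[r0 r1]; rewrite ler_pdivlMr//.
  set z := x - e *: e_ i + r *: e_ i.
  have bz : bracket_pow k x <= bracket_pow k z * 2 ^+ k.
    rewrite -[x in leLHS](addrNK z) [_ - z + z]addrC; apply: le_trans (bracket_pow_add _ _ _) _.
    rewrite ler_wpM2l ?bracket_pow_ge0// lerXn2r ?nnegrE ?addr_ge0//.
    rewrite /z opprD opprB addrA [x + _]addrC subrK -scalerBl.
    rewrite (_ : 2 = 1 + 1 :> R)// lerD2l (le_trans (norm_delta_le _ _))//.
    rewrite ger0_norm ?subr_ge0//.
    by have := mesh_le1 (Lf t); rewrite -/e; lra.
  apply: le_trans (_ : normc (partials (i :: s) (u t) z) * (w t * bracket_pow k z) * 2 ^+ k <= _).
    rewrite -!mulrA ler_wpM2l ?normc_ge0// ler_wpM2l// ltW//.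
  by rewrite ler_wpM2r// mulrC; exact: HC.
apply: le_trans (ler_wpM2l (ltW W) (ler_wpM2l _ H)) _.
  by rewrite invr_ge0 ltW.
have -> // : w t * bracket_pow k x * (e^-1 * (2 * (C * 2 ^+ k / (w t * bracket_pow k x) * e)))
  = 2 * (C * 2 ^+ k).
by field; rewrite !gt_eqF ?bracket_pow_gt0.
Qed.

(** Each symbol is traded for a backward difference, which preserves the hypothesis on [u]; the
    boundary terms are estimated separately. *)
Lemma dft_decay (s : seq 'I_m) T (w : T -> R) (u : T -> V -> R[i]) (Lf : T -> nat) :
  (forall t, 0 < w t) -> weighted_schwartz w u ->
  exists C, forall t (k : J (Lf t)),
    w t * (\prod_(i <- s) normc (symbol k i)) * normc (dft k (u t)) <= C.
Proof.
elim: s u => [|i s IH] u w0 Hu.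
  have [C HC] := (Hu (2 * m)%N).2 [::]; exists (3 ^+ m * C) => t k.
  rewrite big_nil mulr1 -[w t]gtr0_norm// -normc_real -normcM -box_sumZ.
  apply: box_sum_le (mesh_gt0 _) (mesh_le1 _) _ => x.
  rewrite !normcM normc_conj normc_character mulr1 normc_real gtr0_norm// mulrCA mulrA.
  exact: HC.
have [C1 HC1] := IH _ w0 (weighted_backward Lf i w0 Hu).
(* The boundary term is multiplied by the remaining symbols, at most $3(L+1)$ each, and by the
   inverse mesh $L+1$. Decay of order [size s + 1] compensates for all of these factors. *)
set q := (size s).+1.
have [C2 HC2] := (Hu (2 * m + q)%N).2 [::].
pose N := (2 * m + q)%N.
exists (C1 + 3 ^+ size s * (2 * 3 ^+ m * (2 ^+ N * C2))) => t k.
pose e := mesh (Lf t); have e0 : 0 < e := mesh_gt0 _; have e1 : e <= 1 := mesh_le1 _.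
pose G x := u t (x - e *: e_ i) * conjc (character (freq k) x).
have GB x : bracket_pow N x * normc (G x) <= 2 ^+ N * C2 / w t.
  rewrite ler_pdivlMr// normcM normc_conj normc_character mulr1.
  apply: le_trans (ler_wpM2l (_ : 0 <= 2 ^+ N) (HC2 t (x - e *: e_ i))) => //.
  have bx : bracket_pow N x <= 2 ^+ N * bracket_pow N (x - e *: e_ i).
    rewrite -[x in leLHS](subrK (e *: e_ i)).
    apply: le_trans (bracket_pow_add _ _ _) _.
    rewrite mulrC ler_wpM2r ?bracket_pow_ge0// lerXn2r ?nnegrE ?addr_ge0//.
    rewrite (_ : 2 = 1 + 1 :> R)// lerD2l (le_trans (norm_delta_le _ _))//.
    by rewrite gtr0_norm.
  have U0 : 0 <= normc (u t (x - e *: e_ i)) * w t.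
    by rewrite mulr_ge0 ?normc_ge0// ltW.
  apply: le_trans (_ : 2 ^+ N * bracket_pow N (x - e *: e_ i) * (normc (u t (x - e *: e_ i)) * w t) <= _).
    by rewrite -[leLHS]mulrA ler_wpM2r.
  by rewrite le_eqVlt; apply/orP; left; apply/eqP; rewrite /= -/N; ring.
have := box_sum_shift (half (Lf t)) i e0 e1 GB; rewrite mesh_half.
set D := box_sum _ _ _ - _ => HD.
set A := \prod_(j <- s) normc (symbol k j).
have A0 : 0 <= A by apply: prodr_ge0 => j _; exact: normc_ge0.
have AL : A <= (3 * (Lf t).+1%:R) ^+ size s.
  rewrite /A; elim: (s) => [|j s' IH']; first by rewrite big_nil.
  rewrite big_cons exprS; apply: ler_pM; rewrite ?normc_ge0 ?symbol_le//.
  by apply: prodr_ge0 => j' _; exact: normc_ge0.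
have main : normc (symbol k i) * normc (dft k (u t)) <=
    normc (dft k (backward (Lf t) i (u t))) + (Lf t).+1%:R * normc D.
  rewrite -normcM symbol_dft; apply: le_trans (le_normcD _ _) _.
  rewrite lerD2l normcN normcM normc_real (_ : (Lf t).+1%:R = e^-1); last first.
    by rewrite /e /mesh invrK.
  by rewrite ger0_norm ?invr_ge0 ?(ltW e0)//; exact: lexx.
rewrite big_cons -/A.
have -> : w t * (normc (symbol k i) * A) * normc (dft k (u t)) =
    w t * A * (normc (symbol k i) * normc (dft k (u t))) by ring.
have wA : 0 <= w t * A by rewrite mulr_ge0// ltW.
apply: le_trans (ler_wpM2l wA main) _; rewrite mulrDr; apply: lerD; first exact: HC1.
have l1 : 1 <= (Lf t).+1%:R :> R by rewrite ler1n.
set l : R := (Lf t).+1%:R in HD AL l1 *.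
have B0 : 0 <= 2 * 3 ^+ m * (2 ^+ N * C2).
  rewrite !mulr_ge0// ?exprn_ge0//; apply: le_trans (HC2 t 0).
  by rewrite !mulr_ge0 ?normc_ge0 ?bracket_pow_ge0// ltW.
have lq : 0 < (1 + l) ^+ q by rewrite exprn_gt0//; lra.
have -> : w t * A * (l * normc D) = A * l * (w t * normc D) by ring.
have wD : w t * normc D <= 2 * 3 ^+ m * (2 ^+ N * C2) / (1 + l) ^+ q.
  apply: le_trans (ler_wpM2l (ltW (w0 t)) HD) _; rewrite le_eqVlt; apply/orP; left.
  by apply/eqP; field; rewrite !gt_eqF.
apply: le_trans (ler_wpM2l _ wD) _; first by rewrite mulr_ge0//; lra.
have Al : A * l <= 3 ^+ size s * (1 + l) ^+ q.
  have l0 : 0 <= l by lra.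
  apply: le_trans (ler_wpM2r l0 AL) _.
  rewrite exprMn -mulrA ler_wpM2l ?exprn_ge0// /q exprSr.
  by apply: ler_pM; rewrite ?exprn_ge0 ?lerXn2r ?nnegrE ?addr_ge0//; lra.
by rewrite mulrCA [leRHS]mulrC ler_wpM2l// ler_pdivrMr.
Qed.


(** The factor at [i] suffices, the others being at least 1. A derivative of a character thus costs
    one power of the product that measures decay. *)
Lemma normc_freq_le L (k : J L) i :
  normc (0 +i* freq k 0 i) <= 2 * pi * \prod_j (1 + (period L)^-1 * `|centered (k j) : R|).
Proof.
have n0 : 0 <= (period L)^-1 by rewrite invr_ge0 ltW// period_gt0.
rewrite /= expr0n /= add0r sqrtr_sqr mxE normrM [`|(period L)^-1 * _|]normrM.
have p0 := pi_gt0 R; rewrite ger0_norm ?mulr_ge0 ?(ltW p0)// ler_wpM2l ?mulr_ge0 ?(ltW p0)//.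
rewrite ger0_norm// (bigD1 i)//=.
have h : 1 <= \prod_(j < m | j != i) (1 + (period L)^-1 * `|centered (k j) : R|).
  elim/big_ind: _ => // [a b a1 b1|j _]; last by rewrite lerDl mulr_ge0.
  by rewrite -[1]mulr1 ler_pM.
apply: le_trans (_ : 1 + (period L)^-1 * `|centered (k i) : R| <= _).
  by rewrite lerDr.
by rewrite ler_peMr// addr_ge0// mulr_ge0.
Qed.

Lemma dft_decay_pow (q : nat) T (w : T -> R) (u : T -> V -> R[i]) (Lf : T -> nat) :
  (forall t, 0 < w t) -> weighted_schwartz w u ->
  exists C, forall t (k : J (Lf t)), w t * normc (dft k (u t)) *
    (\prod_i (1 + (period (Lf t))^-1 * `|centered (k i) : R|)) ^+ q <= C.
Proof.
(* Each coordinate is repeated [q] times, so that the product of symbols is a [q]-th power;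
   [symbol_ge] then costs a factor 2 per coordinate and per power. *)
move=> w0 Hu; pose s : seq 'I_m := flatten (nseq q (index_enum 'I_m)).
have [C HC] := dft_decay s Lf w0 Hu.
exists (C * (2 ^+ m) ^+ q) => t k.
have n0 : 0 <= (period (Lf t))^-1 by rewrite invr_ge0 ltW// period_gt0.
have P0 : 0 <= \prod_i (1 + (period (Lf t))^-1 * `|centered (k i) : R|).
  by apply: prodr_ge0 => i _; rewrite addr_ge0// mulr_ge0.
have E : \prod_(i <- s) normc (symbol k i) = (\prod_i normc (symbol k i)) ^+ q.
  by rewrite /s; elim: (q) => [|q' IH]; rewrite /= ?big_nil// big_cat IH exprS.
apply: le_trans (ler_wpM2r _ (HC t k)); last by rewrite !exprn_ge0.
have -> : w t * (\prod_(i <- s) normc (symbol k i)) * normc (dft k (u t)) * 2 ^+ m ^+ q =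
  w t * normc (dft k (u t)) * (2 ^+ m * \prod_i normc (symbol k i)) ^+ q.
  by rewrite E exprMn; ring.
rewrite ler_wpM2l ?mulr_ge0 ?normc_ge0 ?(ltW (w0 t))//.
rewrite lerXn2r ?nnegrE//.
  by rewrite mulr_ge0 ?exprn_ge0// prodr_ge0// => i _; exact: normc_ge0.
rewrite -[X in 2 ^+ X]card_ord -prodr_const -big_split /=.
apply: ler_prod => i _; rewrite symbol_ge andbT addr_ge0// mulr_ge0//.
Qed.

(** Together with the factor [mesh L ^+ m] inside [dft], the factor in front makes $M^{-m}$, the
    normalization of discrete Fourier inversion. *)
Definition interpolant L u : V -> R[i] := fun x =>
  \sum_(k : J L) (((period L)^-1) ^+ m)%:C * dft k u * character (freq k) x.

Lemma expi_neq1 (t : R) : 0 < `|t| < 2 * pi -> expi t != 1 :> R[i].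
Proof.
move=> /andP[t0 t1]; apply/eqP => -[ct _].
have : 0 < 1 - cos t.
  have tE : t = (t / 2) *+ 2 by rewrite -mulr_natr divfK ?pnatr_eq0.
  have C := cos_mulr2n (t / 2); rewrite -tE -mulr_natr in C.
  have S := cos2Dsin2 (t / 2).
  have : 0 < sin (t / 2) ^+ 2.
    rewrite exprn_even_gt0//=.
    have : 0 < sin (`|t| / 2) by apply: sin_gt0_pi; apply/andP; split; lra.
    have [_|_] := ger0P t; first by move/gt_eqF => ->.
    by rewrite mulNr sinN oppr_gt0 => /lt_eqF ->.
  lra.
by rewrite ct subrr ltxx.
Qed.

(** Orthogonality of the characters of $\mathbb{Z}/M$. The centering of [k] contributes a phase; the
    rest is a geometric sum of powers of $z=e^{2\pi i(a-b)/M}$, where $z^M=1$ and, for $a\ne b$,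
    $z\ne1$ because $0<|a-b|<M$. *)
Lemma dirichlet_sum K (d : R) (a b : 'I_(2 * K).+1) : d = (2 * K).+1%:R ->
  \sum_(k < (2 * K).+1) expi (2 * pi * (centered k * (centered a - centered b) / d)) =
    (d *+ (a == b))%:C :> R[i].
Proof.
move=> dE; set M := (2 * K).+1 in dE *.
have d0 : 0 < d by rewrite dE ltr0n.
have [->|ab] := eqVneq a b.
  rewrite subrr; under eq_bigr do rewrite mulr0 mul0r mulr0 expi0.
  by rewrite sumr_const card_ord mulr1n dE /= rmorph_nat.
rewrite mulr0n.
have cab : centered a - centered b = (a : nat)%:R - (b : nat)%:R :> R.
  by rewrite /centered; ring.
set th := 2 * pi * ((centered a - centered b) / d).
have E (k : 'I_M) : expi (2 * pi * (centered k * (centered a - centered b) / d)) =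
    expi (- (K%:R * th)) * expi th ^+ k :> R[i].
  rewrite expiX -expiD; congr expi; rewrite /th /centered -mulr_natl; ring.
under eq_bigr do rewrite E.
rewrite -mulr_sumr; set z : R[i] := expi th.
have zM : z ^+ M = 1.
  rewrite /z expiX -mulr_natl -dE /th cab.
  have -> : d * (2 * pi * ((a%:R - b%:R) / d)) = 2 * pi * (a%:R - b%:R).
    by field; rewrite gt_eqF.
  have e2p (n : nat) : expi (2 * pi * n%:R) = 1 :> R[i].
    rewrite mulr_natr -expiX mulr_natl.
    by rewrite /expi cos2pi sin2pi expr1n.
  by rewrite mulrBr expiD expiN !e2p mul1r conjc1.
have z1 : z != 1.
  apply: expi_neq1; have p0 := pi_gt0 R.
  rewrite /th cab normrM (ger0_norm (_ : 0 <= 2 * pi)) ?mulr_ge0 ?(ltW p0)//.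
  have ab0 : 0 < `|(a : nat)%:R - (b : nat)%:R : R|.
    by rewrite normr_gt0 subr_eq0 eqr_nat.
  have ab1 : `|(a : nat)%:R - (b : nat)%:R : R| < d.
    have ha : (a : nat)%:R < d :> R by rewrite dE ltr_nat.
    have hb : (b : nat)%:R < d :> R by rewrite dE ltr_nat.
    have := ler0n R a; have := ler0n R b.
    by rewrite ltr_norml => h1 h2; apply/andP; split; lra.
  rewrite normrM normfV (gtr0_norm d0); apply/andP; split.
    by rewrite !mulr_gt0// invr_gt0.
  by rewrite gtr_pMr ?mulr_gt0// ltr_pdivrMr// mul1r.
have := subrX1 z M; rewrite zM subrr => /esym/eqP.
rewrite mulf_eq0 subr_eq0 (negbTE z1) /= => /eqP.
by move=> ->; rewrite mulr0.
Qed.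

(** Exchanging the two sums leaves, for each grid point [j], a product of Dirichlet sums over the
    coordinates, which vanishes as soon as one coordinate of [j] differs from that of [l]. *)
Lemma interpolant_grid L (l : J L) u :
  interpolant L u (grid_point (mesh L) l) = u (grid_point (mesh L) l).
Proof.
have e0 := mesh_gt0 L; have P0 := period_gt0 L.
have M0 : 0 < (M L)%:R :> R by rewrite ltr0n.
have E : interpolant L u (grid_point (mesh L) l) =
   \sum_(j : J L) u (grid_point (mesh L) j) * (((M L)%:R^-1 ^+ m)%:C *
     \sum_(k : J L) \prod_i expi (2 * pi * (centered (k i) *
         (centered (l i) - centered (j i)) / (M L)%:R))).
  rewrite /interpolant /dft /box_sum.
  under eq_bigr => k _ do rewrite mulrA mulr_sumr mulr_suml.
  rewrite exchange_big /=; apply: eq_bigr => j _; rewrite !mulr_sumr.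
  apply: eq_bigr => k _.
  have -> : \prod_i expi (2 * pi * (centered (k i) *
      (centered (l i) - centered (j i)) / (M L)%:R)) =
      conjc (character (freq k) (grid_point (mesh L) j)) *
      character (freq k) (grid_point (mesh L) l).
    rewrite -expi_sum -expiN -expiD; congr expi.
    rewrite /dot -sumrN -big_split /=; apply: eq_bigr => i _.
    rewrite !mxE /period; field.
    by rewrite !gt_eqF.
  rewrite -[X in X * _ * _ = _]rmorphM /= -exprMn.
  have -> : (period L)^-1 * mesh L = (M L)%:R^-1.
    by rewrite /period; field; rewrite !gt_eqF.
  ring.
rewrite E (bigD1 l)//= [X in _ + X]big1 ?addr0 => [|j jl].
  under eq_bigr => k _.
    rewrite big1; last by move=> i _; rewrite subrr mulr0 mul0r mulr0 expi0.
    over.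
  have -> : \sum_(k : J L) (1 : R[i]) = ((M L)%:R ^+ m)%:C.
    by rewrite sumr_const card_ffun !card_ord natrX rmorphXn rmorph_nat.
  rewrite -[X in _ * X]rmorphM /= exprVn mulVf ?mulr1// expf_neq0// gt_eqF//.
rewrite -(bigA_distr_bigA (fun i (k : 'I_(M L)) => expi (2 * pi * (centered k *
         (centered (l i) - centered (j i)) / (M L)%:R)))).
have [i ji] : exists i, l i != j i.
  by apply/existsP; rewrite -negb_forall; apply: contra jl => /forallP H;
    apply/eqP/ffunP => i; apply/eqP; rewrite eq_sym.
by rewrite (bigD1 i)//= (dirichlet_sum (l i) (j i) erefl) (negbTE ji) mul0r !mulr0.
Qed.

End dft.

(** * The closed absolutely convex hull of time-frequency shifts *)

Section hull.
Context {R : realType} {m : nat}.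
Local Notation V := 'rV[R]_m.
Implicit Types (g h : V -> R[i]) (w y : V) (C D : R).

Definition tf_shift w y h : V -> R[i] := fun x => character w x * h (x - y).

(** Convergence in the Schwartz space in a form easy to verify: derivatives are only required to be
    bounded, and [vanishing_partials] recovers their convergence. *)
Definition schwartz_cvg (a : nat -> V -> R[i]) h :=
  [/\ schwartz_family a, schwartz h & locally_vanishing (fun n x => a n x - h x)].

(* [hull g C h]: h is a limit of combinations of time-frequency shifts of g
   whose coefficients have absolute sum at most C. *)
Inductive hull g : R -> (V -> R[i]) -> Prop :=
| hull_refl : hull g 1 g
| hull_le C D h : hull g C h -> C <= D -> hull g D h
| hull_add C D a b : hull g C a -> hull g D b -> hull g (C + D) (fun x => a x + b x)
| hull_scale C h (c : R[i]) : hull g C h -> hull g (normc c * C) (fun x => c * h x)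
| hull_shift C h w y : hull g C h -> hull g C (tf_shift w y h)
| hull_cvg C a h : (forall n, hull g C (a n)) -> schwartz_cvg a h -> hull g C h.

Lemma hull_sum g (I : Type) (r : seq I) (C : I -> R) (F : I -> V -> R[i]) :
  (forall i, hull g (C i) (F i)) ->
  hull g (\sum_(i <- r) C i) (fun x => \sum_(i <- r) F i x).
Proof.
move=> H; elim: r => [|i r IH].
  rewrite big_nil (_ : (fun x => _) = (fun x => 0 * g x)).
    by have := hull_scale 0 (hull_refl g); rewrite normc0 mul0r.
  by apply/funext => x; rewrite big_nil mul0r.
rewrite big_cons (_ : (fun x => _) = (fun x => F i x + \sum_(j <- r) F j x)).
  exact: hull_add.
by apply/funext => x; rewrite big_cons.
Qed.

End hull.

(** * Trigonometric interpolation of Schwartz multipliers *)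

Section multipliers.
Context {R : realType} {m : nat}.
Local Notation V := 'rV[R]_m.
Local Notation e_ i := (delta_mx 0 i : V).
Local Notation M L := ((2 * (L.+1 ^ 2)%N).+1).
Local Notation J L := {ffun 'I_m -> 'I_(M L)}.
Implicit Types (g h : V -> R[i]).

Lemma weighted_reindex T T' (f : T' -> T) w (u : T -> V -> R[i]) :
  weighted_schwartz w u -> weighted_schwartz (fun t => w (f t)) (fun t => u (f t)).
Proof. by move=> Hu k; exact: (bounded_family_reindex f (Hu k)). Qed.

(** Two of the [q + 2] available powers are spent on summing over the frequencies: the factor
    [(period L)^-1 ^+ m] turns this into a Riemann sum of step at most 1, bounded uniformly in
    [L]. *)
Lemma interpolant_coef_le q T (w : T -> R) (u : T -> V -> R[i]) :
  (forall t, 0 < w t) -> weighted_schwartz w u ->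
  exists2 C, 0 <= C & forall t L, \sum_(k : J L)
     normc ((((period L)^-1) ^+ m)%:C * dft k (u t)) *
     (\prod_i (1 + (period L)^-1 * `|centered (k i) : R|)) ^+ q <= C / w t.
Proof.
move=> w0 Hu.
have [C HC] := dft_decay_pow (q + 2) (fun p : T * nat => p.2)
  (fun p => w0 p.1) (weighted_reindex fst Hu).
exists (3 ^+ m * Num.max C 0) => [|t L]; first by rewrite mulr_ge0 ?exprn_ge0// le_max lexx orbT.
have P0 := @period_gt0 R L; have n0 : 0 < (period L)^-1 :> R by rewrite invr_gt0.
have n1 : (period L)^-1 <= 1 :> R by rewrite invf_le1 ?period_ge1.
have W : 0 <= Num.max C 0 / w t by rewrite divr_ge0 ?(ltW (w0 t))// le_max lexx orbT.
rewrite -mulrA; apply: le_trans (ler_wpM2r W (sum_prod_centered_le _ n0 n1)).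
rewrite mulr_sumr mulr_suml; apply: ler_sum => k _.
rewrite normcM normc_real ger0_norm ?exprn_ge0 ?(ltW n0)// -!mulrA ler_wpM2l ?exprn_ge0 ?(ltW n0)//.
set P := \prod_i _.
have P1 : 0 < P by apply: prodr_gt0 => i _; rewrite ltr_pwDl// mulr_ge0// ltW.
have -> : \prod_i (1 + (period L)^-1 * `|centered (k i) : R|) ^- 2 = P ^- 2.
  by rewrite prodfV prodrXl.
have w1 := w0 t.
rewrite [leRHS]mulrC ler_pdivlMr ?exprn_gt0// ler_pdivlMr//.
rewrite (_ : _ * w t = w t * normc (dft k (u t)) * P ^+ (q + 2)); last first.
  by rewrite exprD; ring.
by rewrite (le_trans (HC (t, L) k))// le_max lexx.
Qed.

Lemma interpolant_l1 T (w : T -> R) (u : T -> V -> R[i]) :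
  (forall t, 0 < w t) -> weighted_schwartz w u ->
  exists2 C, 0 <= C & forall t L, \sum_(k : J L)
     normc ((((period L)^-1) ^+ m)%:C * dft k (u t)) <= C / w t.
Proof.
move=> w0 Hu; have [C C0 HC] := interpolant_coef_le 0 w0 Hu; exists C => // t L.
apply: le_trans (HC t L); apply: ler_sum => k _; by rewrite expr0 mulr1.
Qed.

(** Interpolants are periodic, hence have no decay in [x], and the weight involves the index only.
    Each derivative uses up one power in [interpolant_coef_le]. *)
Lemma bounded_interpolant T (w : T -> R) (u : T -> V -> R[i]) :
  (forall t, 0 < w t) -> weighted_schwartz w u ->
  bounded_family (fun p _ => w p.1) (fun p : T * nat => interpolant p.2 (u p.1)).
Proof.
move=> w0 Hu.
have S L (c : J L -> R[i]) k : smooth (fun x : V => c k * character (freq k) x).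
  exact: smoothZ (smooth_character _).
split=> [[t L]|s]; first exact: (smooth_sum _ (S L (fun k => _ * dft k (u t)))).
have [C C0 HC] := interpolant_coef_le (size s) w0 Hu.
exists ((2 * pi) ^+ size s * C) => -[t L] x /=; have p0 := pi_gt0 R.
rewrite (partials_sum _ s (S L (fun k => _ * dft k (u t)))) mulrC -ler_pdivlMr// -mulrA.
apply: le_trans (ler_wpM2l _ (HC t L)); last by rewrite exprn_ge0// mulr_ge0// ltW.
apply: le_trans (normc_sum _ _ _) _; rewrite mulr_sumr; apply: ler_sum => k _.
rewrite (partialsZ _ s (smooth_character (freq k))) partials_character.
rewrite normcM [normc (_ * character _ _)]normcM normc_character mulr1 [leRHS]mulrCA ler_wpM2l ?normc_ge0//.
rewrite -exprMn normc_prod; elim: (s) => [|i s' IH]; first by rewrite big_nil.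
rewrite big_cons exprS; apply: ler_pM => //.
- exact: normc_ge0.
- by apply: prodr_ge0 => j _; exact: normc_ge0.
- exact: normc_freq_le.
Qed.

Lemma nearest_grid_point (r : R) L (x : V) : `|x| <= r -> r <= L.+1%:R ->
  exists l : J L, forall i, `|(grid_point (mesh L) l : V) 0 i - x 0 i| <= mesh L :> R.
Proof.
move=> xr rL; have e0 : 0 < mesh L :> R := mesh_gt0 L.
have ex i : exists j : 'I_(M L), `|mesh L * centered j - x 0 i| <= mesh L.
  pose z : R := L.+1%:R * x 0 i + (L.+1 ^ 2)%:R.
  have := le_trans (rV_coord_le x i) (le_trans xr rL).
  rewrite ler_norml => /andP[x1 x2].
  have l0 : 0 < L.+1%:R :> R by rewrite ltr0n.
  have zb : 0 <= z <= (2 * L.+1 ^ 2)%:R.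
    have h1 := ler_wpM2l (ltW l0) x1; have h2 := ler_wpM2l (ltW l0) x2.
    rewrite /z natrM natrX expr2; apply/andP; split; lra.
  have /andP[z0 z1] := zb.
  have tz := truncn_itv z0.
  have tM : (Num.truncn z < M L)%N.
    rewrite ltnS -(ler_nat R); move/andP: tz => [tz _]; exact: le_trans tz z1.
  exists (Ordinal tM); rewrite /centered /=.
  have -> : mesh L * ((Num.truncn z)%:R - (L.+1 ^ 2)%:R) - x 0 i =
      mesh L * ((Num.truncn z)%:R - z).
    by rewrite /z /mesh; field; rewrite gt_eqF.
  rewrite normrM (gtr0_norm e0) ler_piMr ?(ltW e0)//.
  by move: tz; rewrite -natr1 ler_norml => /andP[t1 t2]; apply/andP; split; lra.
have [f Hf] := choice ex; exists [ffun i => f i] => i.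
by rewrite mxE ffunE.
Qed.

(** The interpolant and [u] agree on the grid and their partial derivatives are bounded uniformly in
    [L], so both vary little between [x] and the nearest grid point. *)
Lemma interpolant_cvg (u : V -> R[i]) : schwartz u ->
  locally_vanishing (fun L x => interpolant L u x - u x).
Proof.
move=> su; have Hu : weighted_schwartz (fun _ : unit => 1 : R) (fun _ => u).
  by move=> k; apply: bounded_familyW ((schwartzP u).1 su k) => // t x; rewrite !mul1r.
have [Fs FB] := bounded_interpolant (fun _ => ltr01) Hu.
have /choice[C1 HC1] i := FB [:: i].
have /choice[C2 HC2] i := ((schwartzP u).1 su 0%N).2 [:: i].
pose K := \sum_i (`|C1 i| + `|C2 i|).
have K1 i : `|C1 i| + `|C2 i| <= K.
  by rewrite /K (bigD1 i)//= lerDl sumr_ge0// => j _; rewrite addr_ge0.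
have K0 : 0 <= K by apply: sumr_ge0 => j _; rewrite addr_ge0.
have B1 L i z : normc (partial i (interpolant L u) z) <= K.
  have := HC1 i (tt, L) z; rewrite mul1r => /le_trans; apply.
  apply: le_trans (K1 i); apply: le_trans (ler_norm _) _; by rewrite lerDl.
have B2 i z : normc (partial i u z) <= K.
  have := HC2 i tt z; rewrite /bracket_pow expr0 mul1r => /le_trans; apply.
  apply: le_trans (K1 i); apply: le_trans (ler_norm _) _; by rewrite lerDr.
(* Each of the two functions varies by at most [2 * K * m] times the mesh. *)
move=> r e e0; pose c := 1 + 4 * K * m%:R; have c0 : 0 < c by rewrite ltr_pwDl ?mulr_ge0.
exists (Num.truncn (`|r| + c / e)) => L NL x xr.
have Lbig : `|r| + c / e < L.+1%:R.
  by apply: lt_le_trans (truncnS_gt _) _; rewrite ler_nat.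
have ce0 : 0 < c / e by rewrite divr_gt0.
have rL : r <= L.+1%:R by have := ler_norm r; have := normr_ge0 r; lra.
have [l Hl] := nearest_grid_point xr rL.
set y := grid_point _ l in Hl.
have Lip (h : V -> R[i]) : smooth h -> (forall i z, normc (partial i h z) <= K) ->
    normc (h y - h x) <= 2 * K * m%:R * mesh L.
  move=> sh hB; have [h1 h2] : `|x| <= `|x| + `|y| /\ `|y| <= `|x| + `|y|.
    by rewrite lerDl lerDr.
  apply: le_trans (partial_lipschitz sh h1 h2 (fun i z _ => hB i z)) _.
  apply: le_trans (_ : \sum_(i < m) 2 * (K * mesh L) <= _).
    by apply: ler_sum => i _; rewrite ler_wpM2l// ler_wpM2l.
  by rewrite sumr_const card_ord -mulr_natr; lra.
have E : interpolant L u x - u x =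
    - (interpolant L u y - interpolant L u x) + (u y - u x).
  by rewrite /y interpolant_grid; ring.
rewrite E; apply: le_trans (le_normcD _ _) _; rewrite normcN.
have L1 := Lip _ (Fs (tt, L)) (B1 L); have L2 := Lip _ su.1 B2.
apply: le_trans (lerD L1 L2) _.
apply: le_trans (_ : c * mesh L <= _).
  have : 0 < mesh L :> R := mesh_gt0 L; rewrite /c => ?; lra.
rewrite /mesh ler_pdivrMr ?ltr0n// mulrC -ler_pdivrMr// ltW//.
by apply: le_lt_trans Lbig; rewrite lerDr.
Qed.

(* Multiplication by u is approximated by combinations of modulations, with
   coefficients bounded in l^1 by a Schwartz seminorm of u. *)
Lemma hull_multiplier T (w : T -> R) (u : T -> V -> R[i]) g :
  (forall t, 0 < w t) -> weighted_schwartz w u -> schwartz g ->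
  exists2 C, 0 <= C & forall t y, hull g (C / w t) (fun x => u t x * g (x - y)).
Proof.
move=> w0 Hu sg; have [C C0 HC] := interpolant_l1 w0 Hu; exists C => // t y.
have sgy : schwartz (fun x => g (x - y)).
  apply/schwartzP => k.
  have := bounded_family_translate (fun _ => - y) ((schwartzP g).1 sg k).
  apply: bounded_familyW (_ : 0 <= bracket_pow k y) _; first exact: bracket_pow_ge0.
  move=> _ x; rewrite mulrC -[x in leLHS](subrK y); exact: bracket_pow_add.
have sut : schwartz (u t).
  apply/schwartzP => k; have := bounded_family_reindex (fun _ : unit => t) (Hu k).
  apply: bounded_familyW (_ : 0 <= (w t)^-1) _; first by rewrite invr_ge0 ltW.
  by move=> _ x; rewrite mulrA mulVf ?mul1r// gt_eqF.
have Hut := weighted_reindex (fun _ : unit => t) Hu.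
have BI := bounded_family_reindex (fun L => (tt, L))
  (bounded_interpolant (fun _ => w0 t) Hut).
apply: (@hull_cvg _ _ _ _ (fun L x => interpolant L (u t) x * g (x - y))).
  move=> L; apply: hull_le (HC t L).
  rewrite (_ : (fun x => _) = (fun x => \sum_(k : J L)
     (((period L)^-1) ^+ m)%:C * dft k (u t) * tf_shift (freq k) y g x)); last first.
    by apply/funext => x; rewrite /interpolant mulr_suml; apply: eq_bigr => k _; rewrite !mulrA.
  apply: hull_sum => k; rewrite -[normc _]mulr1; apply: hull_scale.
  exact/hull_shift/hull_refl.
split.
(* The interpolants supply bounded derivatives, the translate of [g] supplies the decay. *)
- move=> k; have := bounded_familyM (fun _ _ => ltW (w0 t))
    (fun _ _ => bracket_pow_ge0 k _) BI (schwartz_family_cst nat sgy k).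
  apply: bounded_familyW (_ : 0 <= (w t)^-1) _; first by rewrite invr_ge0 ltW.
  by move=> _ x; rewrite mulrA mulVf ?mul1r// gt_eqF.
- apply/schwartzP => k; have := bounded_familyM (fun _ _ => bracket_pow_ge0 k _)
    (fun _ _ => bracket_pow_ge0 k _) ((schwartzP _).1 sut k) ((schwartzP _).1 sgy k).
  apply: bounded_familyW ler01 _ => _ x.
  by rewrite mul1r ler_peMr ?bracket_pow_ge0 ?bracket_pow_ge1.
- have [G0 HG] := ((schwartzP _).1 sgy 0%N).2 [::].
  have G1 : 0 < 1 + `|G0| by rewrite ltr_pwDl.
  move=> r e e0; have [N HN] := interpolant_cvg sut r (divr_gt0 e0 G1).
  exists N => n Nn x xr; rewrite -mulrBl normcM.
  have b1 := HN n Nn x xr.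
  have b2 : normc (g (x - y)) <= 1 + `|G0|.
    have := HG tt x; rewrite /bracket_pow expr0 mul1r /= => h.
    by apply: le_trans h _; rewrite (le_trans (ler_norm _))// lerDr.
  apply: le_trans (ler_pM _ _ b1 b2) _; rewrite ?normc_ge0//.
  by rewrite divfK// gt_eqF.
Qed.

End multipliers.

(** * Riemann sums of translates, and the hull of a nonzero window *)

Section riemann.
Context {R : realType} {m : nat}.
Local Notation V := 'rV[R]_m.
Local Notation e_ i := (delta_mx 0 i : V).
Local Notation half L := (L.+1 ^ 2)%N.
Local Notation M L := ((2 * (L.+1 ^ 2)%N).+1).
Local Notation J L := {ffun 'I_m -> 'I_(M L)}.
Implicit Types (g h G : V -> R[i]).

Lemma partials_cst_le (c : R[i]) s (x : V) : normc (partials s (fun _ : V => c) x) <= normc c.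
Proof.
have E : s = [::] \/ partials s (fun _ : V => c) = (fun=> 0).
  elim: s => [|i s [->|IH]]; first by left.
    by right; apply/funext => y; apply: partialE; exact: is_partial_cst.
  by right; apply/funext => y; rewrite /= IH; apply: partialE; exact: is_partial_cst.
by case: E => [->//|->]; rewrite normc0 normc_ge0.
Qed.

Lemma bounded_family_cst T (w : T -> R) (c : T -> R[i]) (K : R) :
  (forall t, 0 <= w t) -> (forall t, w t * normc (c t) <= K) ->
  bounded_family (fun t (_ : V) => w t) (fun t _ => c t).
Proof.
move=> w0 H; split=> [t|s]; first exact: smooth_cst.
exists K => t x; apply: le_trans (H t); apply: ler_wpM2l => //.
exact: partials_cst_le.
Qed.

(** A discretization of $\int G(x-z)\,dz$, which does not depend on [x]. *)
Definition riemann_sum G L : V -> R[i] :=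
  fun x => box_sum (half L) (mesh L) (fun z => G (x - z)).

Lemma smooth_riemann_sum G L : smooth G -> smooth (riemann_sum G L).
Proof.
move=> sG; apply: smoothZ.
apply: (@smooth_sum _ _ _ _ (fun (j : J L) x => G (x - grid_point (mesh L) j))) => j.
exact: smooth_translate.
Qed.

Lemma partials_riemann_sum G L s : smooth G ->
  partials s (riemann_sum G L) = riemann_sum (partials s G) L.
Proof.
move=> sG; have sj (j : J L) : smooth (fun x => G (x - grid_point (mesh L) j)).
  exact: smooth_translate.
rewrite /riemann_sum /box_sum.
rewrite (partialsZ _ s (smooth_sum (index_enum (J L)) sj)) (partials_sum _ s sj).
by apply/funext => x; congr (_ * _); apply: eq_bigr => j _; rewrite partials_translate.
Qed.

Lemma bracket_pow_sub k (x y : V) :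
  bracket_pow k y <= bracket_pow k x * bracket_pow k (x - y).
Proof.
by rewrite -[bracket_pow k (x - y)]bracket_powN opprB -{1}(subrKC x y) bracket_pow_add.
Qed.

Lemma riemann_sum_le G (B : R) L x :
  (forall z, bracket_pow (2 * m) z * normc (G z) <= B) ->
  normc (riemann_sum G L x) <= 3 ^+ m * (bracket_pow (2 * m) x * B).
Proof.
move=> GB; apply: box_sum_le (mesh_gt0 L) (mesh_le1 L) _ => z.
apply: le_trans (ler_wpM2l (bracket_pow_ge0 (2 * m) x) (GB (x - z))).
by rewrite mulrA ler_wpM2r ?normc_ge0// bracket_pow_sub.
Qed.

(** Moving [x] by one step shifts the summation grid by one step, so only boundary terms remain. Two
    spare powers of decay make them of order [mesh L ^+ 2], which leaves one power after the
    division by the step in Landau's inequality. *)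
Lemma riemann_sum_increment G (B : R) L x i :
  (forall z, bracket_pow (2 * m + 2) z * normc (G z) <= B) ->
  normc (riemann_sum G L (x + mesh L *: e_ i) - riemann_sum G L x) <=
  2 * 3 ^+ m * (bracket_pow (2 * m + 2) (x + mesh L *: e_ i) * B) * mesh L ^+ 2.
Proof.
move=> GB; set y := x + mesh L *: e_ i; pose H z := G (y - z).
have HB z : bracket_pow (2 * m + 2) z * normc (H z) <= bracket_pow (2 * m + 2) y * B.
  apply: le_trans (ler_wpM2l (bracket_pow_ge0 _ y) (GB (y - z))).
  by rewrite mulrA ler_wpM2r ?normc_ge0// bracket_pow_sub.
have B0 : 0 <= bracket_pow (2 * m + 2) y * B.
  by apply: le_trans (HB 0); rewrite mulr_ge0 ?normc_ge0 ?bracket_pow_ge0.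
have := box_sum_shift (half L) i (mesh_gt0 L) (mesh_le1 L) HB; rewrite mesh_half.
have -> : (fun z => H (z + mesh L *: e_ i)) = (fun z => G (x - z)).
  by apply/funext => z; rewrite /H /y opprD addrACA subrr addr0.
rewrite -normcN opprB => /le_trans; apply.
apply: ler_wpM2l; first by apply: mulr_ge0 B0; rewrite mulr_ge0 ?exprn_ge0.
rewrite /mesh exprVn lef_pV2 ?posrE ?exprn_gt0 ?addr_gt0//.
by rewrite lerXn2r ?nnegrE ?addr_ge0// lerDr.
Qed.

Lemma riemann_sum_partial_le G : schwartz G -> forall r, exists C, forall L i x,
  `|x| <= r -> normc (partial i (riemann_sum G L) x) <= C * mesh L.
Proof.
move=> sG r; have FG := (schwartzP G).1 sG.
have [B HB] := (FG (2 * m + 2)%N).2 [::].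
have /choice[D HD] i := (FG (2 * m)%N).2 [:: i; i].
pose D1 := \sum_i `|D i|.
have DD i : D i <= D1.
  by apply: le_trans (ler_norm _) _; rewrite /D1 (bigD1 i)//= lerDl sumr_ge0.
pose N := (2 * m + 2)%N; pose K := 3 ^+ m * ((1 + (`|r| + 1)) ^+ (2 * m) * D1).
exists (2 * (2 * 3 ^+ m * ((1 + (`|r| + 1)) ^+ N * `|B|) + 2 * K)) => L i x xr.
have e0 : 0 < mesh L :> R := mesh_gt0 L; have e1 : mesh L <= 1 :> R := mesh_le1 L.
have r0 : 0 <= `|r| + 1 by rewrite addr_ge0.
have near (s : R) : 0 <= s <= mesh L -> `|x + s *: e_ i| <= `|r| + 1.
  move=> /andP[s0 s1]; apply: le_trans (ler_normD _ _) _; apply: lerD.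
    exact: le_trans xr (ler_norm r).
  by apply: le_trans (norm_delta_le _ _) _; rewrite ger0_norm//; lra.
have sG' : smooth G := sG.1; have sR := smooth_riemann_sum L sG'.
have bm k (z : V) : `|z| <= `|r| + 1 -> bracket_pow k z <= (1 + (`|r| + 1)) ^+ k.
  by move=> zr; rewrite lerXn2r ?nnegrE ?addr_ge0// lerD2l.
have D0 : 0 <= D1 by apply: sumr_ge0.
have KB (s : R) : 0 <= s <= mesh L ->
    normc (partial i (partial i (riemann_sum G L)) (x + s *: e_ i)) <= K.
  move=> sI; have -> : partial i (partial i (riemann_sum G L)) =
      riemann_sum (partials [:: i; i] G) L by rewrite -partials_riemann_sum.
  apply: le_trans (riemann_sum_le L _ (fun z => le_trans (HD i tt z) (DD i))) _.
  by rewrite ler_wpM2l ?exprn_ge0// ler_wpM2r// bm// near.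
have lan := partial_landau sR (ltW e0) KB.
have inc := riemann_sum_increment L x i (fun z => le_trans (HB tt z) (ler_norm B)).
have bN : bracket_pow (2 * m + 2) (x + mesh L *: e_ i) <= (1 + (`|r| + 1)) ^+ N.
  by apply: bm; apply: near; rewrite lexx (ltW e0).
rewrite -(ler_pM2l e0); apply: le_trans lan _.
have {}inc : normc (riemann_sum G L (x + mesh L *: e_ i) - riemann_sum G L x) <=
    2 * 3 ^+ m * ((1 + (`|r| + 1)) ^+ N * `|B|) * mesh L ^+ 2.
  apply: le_trans inc _; rewrite ler_wpM2r ?exprn_ge0 ?(ltW e0)//.
  by rewrite ler_wpM2l ?mulr_ge0 ?exprn_ge0// ler_wpM2r.
apply: le_trans (_ : 2 * (2 * 3 ^+ m * ((1 + (`|r| + 1)) ^+ N * `|B|) * mesh L ^+ 2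
   + 2 * (K * mesh L) * mesh L) <= _).
  by rewrite ler_wpM2l// lerD2r.
by rewrite le_eqVlt; apply/orP; left; apply/eqP; ring.
Qed.

Lemma riemann_sum_equicontinuous G (x0 : V) : schwartz G ->
  locally_vanishing (fun L x => riemann_sum G L x - riemann_sum G L x0).
Proof.
move=> sG r e e0; pose r' := Num.max `|r| `|x0|.
have [C HC] := riemann_sum_partial_le sG r'.
have r0 : 0 <= r' by rewrite le_max normr_ge0.
pose c := 1 + 4 * `|C| * r' * m%:R; have c0 : 0 < c by rewrite ltr_pwDl ?mulr_ge0.
exists (Num.truncn (c / e)) => L NL x xr.
have Lbig : c / e < L.+1%:R.
  by apply: lt_le_trans (truncnS_gt _) _; rewrite ler_nat.
have xr' : `|x| <= r' by rewrite le_max (le_trans xr (ler_norm r)).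
have x0r : `|x0| <= r' by rewrite le_max lexx orbT.
have sR := smooth_riemann_sum L sG.1.
have m0 : 0 < mesh L :> R := mesh_gt0 L.
apply: le_trans (partial_lipschitz sR x0r xr' (fun i z zr => HC L i z zr)) _.
apply: le_trans (_ : \sum_(i < m) 2 * (`|C| * mesh L * (2 * r')) <= _).
  apply: ler_sum => i _; rewrite ler_wpM2l//.
  apply: le_trans (_ : `|C| * mesh L * `|x 0 i - x0 0 i| <= _).
    by rewrite ler_wpM2r// ler_wpM2r ?(ltW m0)// ler_norm.
  rewrite ler_wpM2l ?mulr_ge0 ?(ltW m0)//; apply: le_trans (ler_normB _ _) _.
  have := le_trans (rV_coord_le x i) xr'; have := le_trans (rV_coord_le x0 i) x0r; lra.
rewrite sumr_const card_ord -mulr_natr.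
apply: le_trans (_ : c * mesh L <= _).
  by rewrite /c mulrDl mul1r; have := m0; lra.
by rewrite /mesh ler_pdivrMr ?ltr0n// mulrC -ler_pdivrMr// ltW.
Qed.

(** It suffices to count the indices from [K] to [K + n], with [n] the integer part of [d / e]:
    there are $n+1\ge d/e$ of them, and the condition on [e * K] puts them in the box. *)
Lemma sum_centered_ball K (e d : R) : 0 < e -> d <= e * K%:R -> 0 <= d ->
  d <= \sum_(j < (2 * K).+1) e * (e * `|centered j : R| <= d)%R%:R.
Proof.
move=> e0 dK d0; pose n := Num.truncn (d / e).
have de0 : 0 <= d / e by rewrite divr_ge0// ltW.
have /andP[n1 n2] := truncn_itv de0; rewrite -/n in n1 n2.
have nK : (n <= K)%N.
  by rewrite -(ler_nat R) (le_trans n1)// ler_pdivrMr// mulrC.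
pose F (j : nat) : R := e * (e * `|j%:R - K%:R| <= d)%R%:R.
rewrite -(big_mkord xpredT F) (@big_cat_nat _ _ _ K)//=; last by lia.
rewrite [X in _ + X](@big_cat_nat _ _ _ (n.+1 + K))//=; [|by lia|by lia].
have F0 a b : 0 <= \sum_(a <= j < b) F j.
  by apply: sumr_ge0 => j _; rewrite mulr_ge0// ltW.
have S : d <= \sum_(K <= j < n.+1 + K) F j.
  rewrite -{1}[K]add0n big_addn addnK.
  rewrite (eq_big_nat _ _ (F2 := fun=> e)); last first.
    move=> j /andP[_ jn]; rewrite /F natrD addrK normr_nat.
    have jn' : j%:R <= n%:R :> R by rewrite ler_nat -ltnS.
    rewrite (_ : e * j%:R <= d) ?mulr1// mulrC -ler_pdivlMr//.
    exact: le_trans jn' n1.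
  rewrite sumr_const_nat subn0 -mulr_natr mulrC -ler_pdivrMr//; exact: ltW.
have := F0 0%N K; have := F0 (n.+1 + K)%N (2 * K).+1.
by move: S; lra.
Qed.

Lemma schwartz_conj_mul g : schwartz g -> schwartz (fun x => conjc (g x) * g x).
Proof.
move=> sg; apply/schwartzP => k; have Hg := (schwartzP g).1 sg k.
have := bounded_familyM (fun _ _ => bracket_pow_ge0 k _) (fun _ _ => bracket_pow_ge0 k _)
  (bounded_family_conj Hg) Hg.
apply: bounded_familyW ler01 _ => _ x.
by rewrite mul1r ler_peMr ?bracket_pow_ge0 ?bracket_pow_ge1.
Qed.

Lemma conjc_mul_normc (z : R[i]) : conjc z * z = (normc z ^+ 2)%:C.
Proof.
case: z => a b /=; rewrite sqr_sqrtr ?addr_ge0 ?sqr_ge0//.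
by apply/eqP; rewrite eq_complex /= !expr2 mulNr opprK eqxx /= mulNr mulrC subrr.
Qed.

(** By continuity the modulus of [g] is at least half its value at [x0] on a cube around [x0], and
    the grid points falling in this cube alone contribute [b ^+ 2 * d ^+ m]. *)
Lemma riemann_sum_lower_bound g (x0 : V) : schwartz g -> g x0 != 0 ->
  exists2 c, 0 < c & forall L, c <= normc (riemann_sum (fun x => conjc (g x) * g x) L x0).
Proof.
move=> sg gx0; pose b := normc (g x0) / 2.
have b0 : 0 < b.
  rewrite divr_gt0// lt_neqAle normc_ge0 andbT eq_sym.
  by apply: contra gx0 => /eqP/eq0_normc ->.
have /choice[D HD] i := ((schwartzP g).1 sg 0%N).2 [:: i].
pose K := \sum_i `|D i|; have K0 : 0 <= K by apply: sumr_ge0.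
have KB i z : normc (partial i g z) <= K.
  have := HD i tt z; rewrite /bracket_pow expr0 mul1r => /le_trans; apply.
  by apply: le_trans (ler_norm _) _; rewrite /K (bigD1 i)//= lerDl sumr_ge0.
pose c1 := 1 + 2 * K * m%:R; have c10 : 0 < c1 by rewrite ltr_pwDl ?mulr_ge0.
(* On a cube of half-width [d], [g] varies by at most [2 * K * m * d], hence by at most [b]. The
   condition [d <= 1] keeps the cube in every box. *)
pose d := Num.min 1 (b / c1).
have d0 : 0 < d by rewrite lt_min ltr01 divr_gt0.
have d1 : d <= 1 by rewrite ge_min lexx.
have gb (z : V) : (forall i, `|z 0 i| <= d) -> b <= normc (g (x0 - z)).
  move=> zd; have [h1 h2] : `|x0 - z| <= `|x0| + `|x0 - z| /\ `|x0| <= `|x0| + `|x0 - z|.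
    by rewrite lerDl lerDr.
  have := partial_lipschitz sg.1 h1 h2 (fun i y _ => KB i y).
  have : \sum_i 2 * (K * `|x0 0 i - (x0 - z) 0 i|) <= b.
    apply: le_trans (_ : \sum_(i < m) 2 * (K * d) <= _).
      apply: ler_sum => i _; rewrite ler_wpM2l// ler_wpM2l// !mxE.
      by rewrite opprB addrC subrK.
    rewrite sumr_const card_ord -mulr_natr.
    have : c1 * d <= b by rewrite mulrC -ler_pdivlMr// ge_min lexx orbT.
    by rewrite /c1; lra.
  move=> h3 h4; have := le_normcD (g x0 - g (x0 - z)) (g (x0 - z)).
  rewrite subrK => h5; have : normc (g x0) = 2 * b by rewrite /b mulrC divfK.
  lra.
exists (b ^+ 2 * d ^+ m) => [|L]; first by rewrite mulr_gt0 ?exprn_gt0.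
have m0 : 0 < mesh L :> R := mesh_gt0 L.
have -> : riemann_sum (fun x => conjc (g x) * g x) L x0 =
   (mesh L ^+ m * \sum_(j : J L) normc (g (x0 - grid_point (mesh L) j)) ^+ 2)%:C.
  rewrite rmorphM rmorph_sum /=; congr (_ * _); apply: eq_bigr => j _.
  exact: conjc_mul_normc.
rewrite normc_real ger0_norm; last first.
  by rewrite mulr_ge0 ?exprn_ge0 ?(ltW m0)// sumr_ge0// => j _; rewrite sqr_ge0.
apply: le_trans (_ : b ^+ 2 * \sum_(j : J L)
    \prod_i (mesh L * (mesh L * `|centered (j i) : R| <= d)%R%:R) <= _).
  rewrite ler_wpM2l ?sqr_ge0//.
  rewrite -(bigA_distr_bigA (fun=> fun k => mesh L * (mesh L * `|centered k : R| <= d)%R%:R)).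
  rewrite -[X in _ ^+ X]card_ord -prodr_const; apply: ler_prod => i _.
  rewrite (ltW d0)/=; apply: sum_centered_ball => //; last exact: ltW.
  by rewrite mesh_half (le_trans d1)// ler1n.
rewrite !mulr_sumr; apply: ler_sum => j _.
rewrite big_split /= prodr_const card_ord mulrCA ler_wpM2l ?exprn_ge0 ?(ltW m0)//.
have [H|] := boolP [forall i, mesh L * `|centered (j i) : R| <= d].
  rewrite big1 ?mulr1 => [|i _]; last by rewrite (forallP H i).
  rewrite lerXn2r ?nnegrE ?normc_ge0 ?(ltW b0)//; apply: gb => i.
  by rewrite mxE normrM (gtr0_norm m0); exact: (forallP H i).
rewrite negb_forall => /existsP[i Hi].
by rewrite (bigD1 i)//= (negbTE Hi) mul0r mulr0 sqr_ge0.
Qed.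

Theorem schwartz_in_hull g h : schwartz g -> g <> (fun=> 0) -> schwartz h ->
  exists C, hull g C h.
Proof.
move=> sg gn0 sh.
have [x0 gx0] : exists x0, g x0 != 0.
  apply: contrapT => H; apply: gn0; apply/funext => x; apply: contrapT => /eqP gx.
  by apply: H; exists x.
pose G x := conjc (g x) * g x.
have sG : schwartz G := schwartz_conj_mul sg.
have [c c0 Hc] := riemann_sum_lower_bound sg gx0.
(* This multiplier turns [g (x - y)] into [h x] times $|g(x-y)|^2$. By Peetre's inequality it
   decreases like any power of [y]; the power [2 * m] taken as [w] makes the costs summable over the
   grid, uniformly in the mesh. *)
pose u (y x : V) := h x * conjc (g (x - y)).
pose w (y : V) := bracket_pow (2 * m) y.
have w0 y : 0 < w y := bracket_pow_gt0 _ y.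
have Hu : weighted_schwartz w u.
  move=> k; have Hh := schwartz_family_cst V sh (k + 2 * m)%N.
  have Hg := bounded_family_translate (fun y : V => - y)
    (bounded_family_conj (schwartz_family_cst V sg (2 * m)%N)).
  have := bounded_familyM (fun _ x => bracket_pow_ge0 _ x)
    (fun y x => bracket_pow_ge0 _ (x - y)) Hh Hg.
  apply: bounded_familyW ler01 _ => y x.
  rewrite mul1r bracket_powD mulrC -mulrA ler_wpM2l ?bracket_pow_ge0//.
  exact: bracket_pow_sub.
have [C C0 HC] := hull_multiplier w0 Hu sg.
(* Dividing by the value at [x0] keeps the costs bounded, by [riemann_sum_lower_bound], and makes
   the limit exactly [h]. *)
pose a L x := (riemann_sum G L x0)^-1 *
  \sum_(y <- [seq grid_point (mesh L) j | j <- index_enum (J L)])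
     (mesh L ^+ m)%:C * (u y x * g (x - y)).
have aE L x : a L x = (riemann_sum G L x0)^-1 * (h x * riemann_sum G L x).
  rewrite /a; congr (_ * _); rewrite big_map /riemann_sum /box_sum mulrCA !mulr_sumr.
  by apply: eq_bigr => j _; rewrite /u /G !mulrA.
have ci L : normc (riemann_sum G L x0)^-1 <= c^-1.
  have := Hc L => HcL; rewrite normcV lef_pV2 ?posrE//; exact: lt_le_trans c0 HcL.
have sumw L : \sum_(y <- [seq grid_point (mesh L) j | j <- index_enum (J L)])
    (mesh L ^+ m * (w y)^-1) <= 3 ^+ m :> R.
  by rewrite big_map -mulr_sumr; exact: sum_bracket_le (mesh_gt0 L) (mesh_le1 L).
exists (c^-1 * (3 ^+ m * C)); apply: (@hull_cvg _ _ _ _ a).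
  move=> L; have HS := hull_sum [seq grid_point (mesh L) j | j <- index_enum (J L)]
    (fun y => hull_scale (mesh L ^+ m)%:C (HC y y)).
  apply: hull_le (hull_scale (riemann_sum G L x0)^-1 HS) _.
  apply: ler_pM => //; first exact: normc_ge0.
    by apply: sumr_ge0 => y _; rewrite mulr_ge0 ?normc_ge0// divr_ge0// ltW.
  apply: le_trans (ler_wpM2r C0 (sumw L)); rewrite mulr_suml; apply: ler_sum => y _.
  by rewrite normc_real ger0_norm ?exprn_ge0 ?(ltW (mesh_gt0 L))// -mulrA [C / _]mulrC.
split=> //.
  (* Seminorms are bounded term by term, over pairs of a mesh and a grid point. The factor
     [mesh ^+ m] enters through its inverse as a weight, so that the inverse weights add up to at
     most [3 ^+ m], up to the weight in [x]. *)
  move=> k; apply: (bounded_familyZ (fun _ x => bracket_pow_ge0 k x) ci).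
  have Bu : bounded_family (fun p x => w p.2 * bracket_pow k x * 1)
      (fun (p : nat * V) x => u p.2 x * g (x - p.2)).
    apply: bounded_familyM => //.
    - by move=> p x; rewrite mulr_ge0 ?bracket_pow_ge0// ltW.
    - exact: (bounded_family_reindex snd (Hu k)).
    - have := bounded_family_translate (fun p : nat * V => - p.2)
        (schwartz_family_cst (nat * V) sg 0%N).
      by apply: bounded_familyW ler01 _ => p x; rewrite /bracket_pow expr0 mul1r.
  have Bc : bounded_family (fun (p : nat * V) (_ : V) => (mesh p.1 ^+ m)^-1)
      (fun p _ => (mesh p.1 ^+ m)%:C).
    apply: (@bounded_family_cst _ _ _ 1) => p.
      by rewrite invr_ge0 exprn_ge0// ltW// mesh_gt0.
    rewrite normc_real ger0_norm ?exprn_ge0 ?(ltW (mesh_gt0 _))// mulVf//.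
    by rewrite expf_neq0// gt_eqF// mesh_gt0.
  have mi (p : nat * V) : 0 < (mesh p.1 ^+ m)^-1 :> R.
    by rewrite invr_gt0 exprn_gt0// mesh_gt0.
  have BF := bounded_familyM (fun p _ => ltW (mi p))
    (fun p x => mulr_ge0 (mulr_ge0 (ltW (w0 p.2)) (bracket_pow_ge0 k x)) ler01) Bc Bu.
  apply: (bounded_family_sum (K := 3 ^+ m) _ _ _ BF).
  - by move=> p x; rewrite mulr1 !mulr_gt0// bracket_pow_gt0.
  - by move=> L x; exact: bracket_pow_ge0.
  - move=> L x; apply: le_trans (sumw L); rewrite mulr_sumr.
    apply: ler_sum => y _ /=; rewrite le_eqVlt; apply/orP; left; apply/eqP.
    rewrite !mulr1; field.
    by rewrite !gt_eqF ?bracket_pow_gt0// exprn_gt0// mesh_gt0.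
have [H0 HH] := ((schwartzP h).1 sh 0%N).2 [::].
move=> r e e0; have h1 : 0 < 1 + `|H0| by rewrite ltr_pwDl.
have [N HN] := riemann_sum_equicontinuous x0 sG r (divr_gt0 (mulr_gt0 e0 c0) h1).
exists N => L NL x xr; have HL := HN L NL x xr.
have R0 : riemann_sum G L x0 != 0.
  by apply: contraTneq (Hc L) => ->; rewrite normc0 -ltNge.
have -> : a L x - h x = (riemann_sum G L x0)^-1 *
    (h x * (riemann_sum G L x - riemann_sum G L x0)).
  by rewrite aE; field.
rewrite !normcM.
have hb : normc (h x) <= 1 + `|H0|.
  have := HH tt x; rewrite /bracket_pow expr0 mul1r /= => hb.
  by apply: le_trans hb _; rewrite (le_trans (ler_norm _))// lerDr.
apply: le_trans (_ : c^-1 * ((1 + `|H0|) * (e * c / (1 + `|H0|))) <= _).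
  by rewrite !ler_pM ?mulr_ge0 ?normc_ge0.
by rewrite le_eqVlt; apply/orP; left; apply/eqP; field; rewrite !gt_eqF.
Qed.

End riemann.

(** * Lebesgue norms of nonnegative extended functions *)

Lemma le_poweR2 (R : realType) (r : R) (x y : \bar R) :
  (0 <= r)%R -> (0 <= x)%E -> (x <= y)%E -> (x `^ r <= y `^ r)%E.
Proof.
move=> r0 x0 xy; apply: gt0_ler_poweR => //; rewrite in_itv/= leey andbT//.
exact: le_trans xy.
Qed.

Section Lnorm_nonneg.
Context d {T : measurableType d} {R : realType}.
Variable mu : {measure set T -> \bar R}.
Local Open Scope ereal_scope.
Implicit Types (f g : T -> \bar R) (p B : \bar R).

Let mpoweR f (r : R) : measurable_fun [set: T] f ->
  measurable_fun [set: T] (fun x => `|f x| `^ r).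
Proof.
move=> mf; apply: (measurableT_comp (measurable_poweR r)).
exact: measurableT_comp.
Qed.

Lemma le_Lnorm p f g : 1 <= p -> measurable_fun [set: T] f -> measurable_fun [set: T] g ->
  (forall x, 0 <= f x <= g x) -> Lnorm mu p f <= Lnorm mu p g.
Proof.
case: p => [r|_|//]; rewrite unlock; last first.
  move=> mf mg fg; case: ifP => // _; apply: le_ess_sup; apply: nearW => x /=.
  by have /andP[f0 h] := fg x; rewrite !gee0_abs// (le_trans f0).
rewrite lee_fin => r1 mf mg fg; have r0 : (0 < r)%R by exact: lt_le_trans r1.
have i0 (h : T -> \bar R) : 0 <= \int[mu]_x (`|h x| `^ r).
  by apply: integral_ge0 => x _; exact: poweR_ge0.
apply: le_poweR2; [by rewrite invr_ge0 ltW|exact: i0|].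
apply: ge0_le_integral => //; do ?[exact: mpoweR | by move=> x _; exact: poweR_ge0].
move=> x _; apply: le_poweR2 => //; first exact: ltW.
by have /andP[f0 h] := fg x; rewrite !gee0_abs// (le_trans f0).
Qed.

Lemma limn_einfE (u : nat -> \bar R) : limn_einf u = ereal_sup (range (einfs u)).
Proof. by rewrite limn_einf_lim; apply: cvg_lim => //; exact: cvg_einfs_sup. Qed.

Lemma einfs_le_limn_einf (u : nat -> \bar R) n : einfs u n <= limn_einf u.
Proof. by rewrite limn_einfE; apply: ereal_sup_ubound; exists n. Qed.

Lemma limn_einf_ge0 (u : nat -> \bar R) : (forall n, 0 <= u n) -> 0 <= limn_einf u.
Proof.
move=> u0; apply: le_trans (einfs_le_limn_einf u 0%N).
by apply: le_ereal_inf_tmp => _ [n _ <-].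
Qed.

Lemma limn_einf_le_cst (u : nat -> \bar R) B : (forall n, u n <= B) -> limn_einf u <= B.
Proof.
move=> uB; rewrite limn_einfE; apply: ub_ereal_sup => _ [n _ <-].
by apply: le_trans (uB n); apply: ereal_inf_lbound; exists n => /=.
Qed.

Lemma le_limn_einf (u v : nat -> \bar R) : (forall n, u n <= v n) ->
  limn_einf u <= limn_einf v.
Proof.
move=> uv; rewrite limn_einfE; apply: ub_ereal_sup => _ [n _ <-].
apply: le_trans (einfs_le_limn_einf v n); apply: le_ereal_inf_tmp => _ [k nk <-].
by apply: le_trans (uv k); apply: ereal_inf_lbound; exists k.
Qed.

(** The power [r] and its inverse are both monotone, so the infima of the tails can be compared one
    by one. *)
Lemma poweR_limn_einf_le r (u : nat -> \bar R) : (0 < r)%R -> (forall n, 0 <= u n) ->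
  (limn_einf u) `^ r <= limn_einf (fun n => u n `^ r).
Proof.
move=> r0 u0; have ri : (0 <= r^-1)%R by rewrite invr_ge0 ltW.
have K (x : \bar R) : 0 <= x -> (x `^ r) `^ r^-1 = x.
  by move=> x0; rewrite -poweRrM divff ?poweRe1// gt_eqF.
have K' (x : \bar R) : 0 <= x -> (x `^ r^-1) `^ r = x.
  by move=> x0; rewrite -poweRrM mulVf ?poweRe1// gt_eqF.
have w0 : 0 <= limn_einf (fun n => u n `^ r).
  by apply: limn_einf_ge0 => n; exact: poweR_ge0.
rewrite -[leRHS]K'//; apply: le_poweR2; [exact: ltW|exact: limn_einf_ge0|].
rewrite [leLHS]limn_einfE; apply: ub_ereal_sup => _ [n _ <-].
have e0 : 0 <= einfs u n by apply: le_ereal_inf_tmp => _ [k _ <-].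
rewrite -[leLHS]K//; apply: le_poweR2 => //; first exact: poweR_ge0.
apply: le_trans (einfs_le_limn_einf _ n).
apply: le_ereal_inf_tmp => _ [k nk <-]; apply: le_poweR2 => //; first exact: ltW.
by apply: ereal_inf_lbound; exists k.
Qed.

(** For finite [p] this is Fatou's lemma for the [p]-th powers. For [p = +oo], outside a countable
    union of null sets every [a n x] is at most the essential supremum of [a n]. *)
Lemma Lnorm_fatou p (a : nat -> T -> \bar R) f : 1 <= p ->
  measurable_fun [set: T] f -> (forall n, measurable_fun [set: T] (a n)) ->
  (forall n x, 0 <= a n x) -> (forall x, 0 <= f x <= limn_einf (a ^~ x)) ->
  Lnorm mu p f <= limn_einf (fun n => Lnorm mu p (a n)).
Proof.
move=> p1 mf ma a0 fa.
move: p1; case: p => [r|_|//]; rewrite unlock; last first.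
  case: ifP => _; last by exact: limn_einf_ge0.
  apply/ess_supP.
  have : \forall x \ae mu, forall n, a n x <= ess_sup mu (abse \o a n).
    apply: ae_foralln => n; have := ess_sup_ge mu (abse \o a n).
    by apply: filterS => x /=; rewrite gee0_abs.
  apply: filterS => x aBx /=; have /andP[f0 fx] := fa x; rewrite gee0_abs//.
  by apply: le_trans fx _; exact: le_limn_einf.
rewrite lee_fin => r1; have r0 : (0 < r)%R by exact: lt_le_trans r1.
have i0 (h : T -> \bar R) : 0 <= \int[mu]_x (`|h x| `^ r).
  by apply: integral_ge0 => x _; exact: poweR_ge0.
have ri : (0 < r^-1)%R by rewrite invr_gt0.
apply: le_trans (poweR_limn_einf_le ri (fun n => i0 (a n))).
apply: le_poweR2 => //; first exact: ltW.
have ptw x : `|f x| `^ r <= limn_einf (fun n => `|a n x| `^ r).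
  have /andP[f0 fx] := fa x; rewrite gee0_abs//.
  under [in leRHS]eq_fun do rewrite gee0_abs//.
  by apply: le_trans (poweR_limn_einf_le r0 (a0 ^~ x)); exact: le_poweR2 (ltW r0) f0 fx.
apply: le_trans (_ : \int[mu]_x limn_einf (fun n => `|a n x| `^ r) <= _).
  apply: ge0_le_integral => //; do ?[exact: mpoweR | by move=> x _; exact: poweR_ge0].
  rewrite (_ : (fun x => _) =
      -%E \o (fun x => limn_esup (fun n => - (`|a n x| `^ r)))); last first.
    by apply/funext => x /=; rewrite -[LHS]oppeK -limn_esupN.
  apply: measurableT_comp => //; apply: measurable_fun_limn_esup => // n.
  by apply: measurableT_comp => //; exact: mpoweR.
apply: (fatou mu measurableT).
- by move=> n; exact: mpoweR.
- by move=> n x _; exact: poweR_ge0.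
Qed.

(** Minkowski's inequality for functions that may take the value [+oo], as inner norms can: it holds
    for truncations, which are real-valued, and [Lnorm_fatou] passes to the limit. *)
Lemma LnormD_ge0 p f g : 1 <= p -> measurable_fun [set: T] f -> measurable_fun [set: T] g ->
  (forall x, 0 <= f x) -> (forall x, 0 <= g x) ->
  Lnorm mu p (f \+ g) <= Lnorm mu p f + Lnorm mu p g.
Proof.
move=> p1 mf mg f0 g0.
pose tr (h : T -> \bar R) (n : nat) x := mine (h x) n%:R%:E.
have mtr h n : measurable_fun [set: T] h -> measurable_fun [set: T] (tr h n).
  by move=> mh; apply: measurable_mine => //; exact: measurable_cst.
have tr0 h n x : 0 <= h x -> 0 <= tr h n x <= h x.
  by move=> h0; rewrite le_min h0 lee_fin ler0n/= ge_min lexx.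
have trf h n x : 0 <= h x -> tr h n x = (fine (tr h n x))%:E.
  move=> h0; rewrite fineK// ge0_fin_numE; last by have /andP[] := tr0 _ n x h0.
  by rewrite /tr gt_min ltry orbT.
apply: le_trans (Lnorm_fatou (a := fun n x => tr f n x + tr g n x) p1 _ _ _ _) _.
- exact: emeasurable_funD.
- by move=> n; apply: emeasurable_funD; exact: mtr.
- by move=> n x; rewrite adde_ge0//; have /andP[] := tr0 _ n x (f0 x);
    have /andP[] := tr0 _ n x (g0 x).
- move=> x; rewrite adde_ge0//=.
  have cv h : 0 <= h x -> tr h ^~ x @ \oo --> h x.
    move=> h0; rewrite /tr; case E : (h x) h0 => [z| |]//= _.
    + apply: cvg_near_cst; exists (Num.truncn z).+1 => // n /= zn.
      apply/min_idPl; rewrite lee_fin ltW//; apply: lt_le_trans (truncnS_gt _) _.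
      by rewrite ler_nat.
    + under eq_fun do rewrite (min_idPr (leey _)).
      by apply/cvgeryP; exact: cvgr_idn.
  have c : (fun n => tr f n x + tr g n x) @ \oo --> f x + g x.
    by apply: cvgeD; [apply: ge0_adde_def; rewrite inE|exact: cv|exact: cv].
  by rewrite (cvg_limn_einf_sup c).1.
- apply: limn_einf_le_cst => n; apply: le_trans (_ : Lnorm mu p (tr f n) + Lnorm mu p (tr g n) <= _); last first.
    by apply: leeD; apply: (le_Lnorm p1 (mtr _ n _)) => // x; exact: tr0.
  have -> : tr f n = EFin \o (fine \o tr f n).
    by apply/funext => x; exact: trf.
  have -> : tr g n = EFin \o (fine \o tr g n).
    by apply/funext => x; exact: trf.
  rewrite -[X in Lnorm mu p X]/(EFin \o ((fine \o tr f n) \+ (fine \o tr g n))%R).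
  by apply: eminkowski => //; apply: measurableT_comp => //; exact: mtr.
Qed.

Lemma LnormZ_ge0 p (c : R) f : 1 <= p -> measurable_fun [set: T] f -> (forall x, 0 <= f x) ->
  (0 <= c)%R -> Lnorm mu p (fun x => c%:E * f x) = c%:E * Lnorm mu p f.
Proof.
move=> p1 mf f0 c0; move: p1; case: p => [r|_|//]; rewrite unlock; last first.
  case: ifP => [mu0|]; last by rewrite mule0.
  rewrite -ess_supZl//; congr ess_sup; apply/funext => x /=.
  by rewrite abseM gee0_abs.
rewrite lee_fin => r1; have r0 : (0 < r)%R by exact: lt_le_trans r1.
under eq_integral do rewrite abseM poweRM// gee0_abs//.
rewrite ge0_integralZl//.
- rewrite poweRM ?poweR_ge0//; last by apply: integral_ge0 => x _; exact: poweR_ge0.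
  by rewrite -poweRrM divff ?poweRe1// gt_eqF.
- exact: mpoweR.
- by move=> x _; exact: poweR_ge0.
- exact: poweR_ge0.
Qed.

End Lnorm_nonneg.

Section Lnorm_invariance.
Context d {T : measurableType d} {R : realType}.
Variable mu : {measure set T -> \bar R}.
Local Open Scope ereal_scope.

Lemma Lnorm_comp (tau : T -> T) p (f : T -> \bar R) : 1 <= p ->
  measurable_fun [set: T] tau ->
  (forall A, measurable A -> mu (tau @^-1` A) = mu A) ->
  measurable_fun [set: T] f -> Lnorm mu p (f \o tau) = Lnorm mu p f.
Proof.
move=> p1 mtau mutau mf; move: p1; case: p => [r|_|//]; rewrite unlock; last first.
  case: ifP => // _.
  have maf : measurable_fun [set: T] (abse \o f) by exact: measurableT_comp.
  rewrite !ess_supEmu0//; last by apply: measurableT_comp => //; exact: measurableT_comp.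
  congr ereal_inf; apply/seteqP; split => y /=.
    rewrite -[X in mu X = _]/(tau @^-1` ((abse \o f) @^-1` `]y, +oo[)) mutau//.
    by rewrite -[X in measurable X]setTI; apply: maf => //; exact: emeasurable_itv.
  rewrite -[X in _ -> mu X = _]/(tau @^-1` ((abse \o f) @^-1` `]y, +oo[)) mutau//.
  by rewrite -[X in measurable X]setTI; apply: maf => //; exact: emeasurable_itv.
move=> _; congr (_ `^ _).
have mh : measurable_fun [set: T] (fun x => `|f x| `^ r).
  by apply: (measurableT_comp (measurable_poweR r)); exact: measurableT_comp.
rewrite -[LHS]/(\int[mu]_(x in tau @^-1` setT) ((fun x => `|f x| `^ r) \o tau) x).
rewrite -ge0_integral_pushforward//; last by move=> x _; exact: poweR_ge0.
by apply: eq_measure_integral => A mA _; exact: mutau.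
Qed.

End Lnorm_invariance.

Section Lnorm_measurable.
Context d1 d2 {T1 : measurableType d1} {T2 : measurableType d2} {R : realType}.
Variable mu : {sigma_finite_measure set T1 -> \bar R}.
Local Open Scope ereal_scope.

(** Makes the inner norm a legitimate argument of the outer one. For finite [p] this is
    Fubini-Tonelli; for [p = +oo], the essential supremum exceeds [r] exactly when the section of
    the set where [F] exceeds [r] has positive measure, and that measure depends measurably on
    [y]. *)
Lemma measurable_Lnorm_section p (F : T1 * T2 -> \bar R) : 1 <= p ->
  measurable_fun [set: T1 * T2] F -> (forall z, 0 <= F z) ->
  measurable_fun [set: T2] (fun y => Lnorm mu p (fun x => F (x, y))).
Proof.
move=> p1 mF F0; move: p1; case: p => [r|_|//].
  rewrite lee_fin => r1; rewrite unlock /=.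
  have mG : measurable_fun [set: T1 * T2] (fun z => `|F z| `^ r).
    by apply: (measurableT_comp (measurable_poweR r)); exact: measurableT_comp.
  apply: (measurableT_comp (measurable_poweR r^-1)).
  exact: (measurable_fun_fubini_tonelli_G (m1 := mu) _ mG (fun z => poweR_ge0 _ _)).
have [mu0|mu0] := boolP (0 < mu [set: T1]); last first.
  by rewrite unlock /= (negbTE mu0); exact: measurable_cst.
rewrite unlock /= mu0; apply: (measurability _ (ErealGenOInfty.measurableE R)).
move=> _ [_ [r ->] <-].
pose A := F @^-1` `]r%:E, +oo[.
have mA : measurable A.
  by rewrite -[A]setTI; apply: mF => //; exact: emeasurable_itv.
have mS := measurable_fun_ysection mu mA.
rewrite (_ : _ `&` _ = [set: T2] `&` [set y | 0 < (mu \o ysection A) y]).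
  exact: emeasurable_fun_o_infty.
rewrite !setTI; apply/seteqP; split => y /=; rewrite in_itv/= andbT.
  rewrite !ltNge => /negP H; apply/negP; apply: contra_not H => H.
  apply/ess_supP; apply/ae_le_measureP.
    apply: measurableT_comp => //; apply: (measurableT_comp mF).
    exact: pair2_measurable.
  apply/eqP; rewrite eq_le measure_ge0 andbT; move: H; rewrite /A; congr (mu _ <= _).
  by apply/seteqP; split => x; rewrite /ysection /= in_setE /= gee0_abs.
rewrite !ltNge => /negP H; apply/negP; apply: contra_not H => /ess_supP/ae_le_measureP H.
rewrite (_ : ysection A y = (abse \o (fun x => F (x, y))) @^-1` `]r%:E, +oo[).
  rewrite H//; apply: measurableT_comp => //; apply: (measurableT_comp mF).
  exact: pair2_measurable.
by apply/seteqP; split => x; rewrite /ysection /= in_setE /= gee0_abs.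
Qed.

End Lnorm_measurable.

(** * Translation invariance of Lebesgue measure on tuples *)

Section translation.
Context {R : realType}.
Local Open Scope ereal_scope.

Lemma lebesgue_measure_translate (c : R) (A : set R) : measurable A ->
  @lebesgue_measure R ((fun x : R => x + c)%R @^-1` A) = @lebesgue_measure R A.
Proof.
move=> mA; have mt : measurable_fun [set: measurableTypeR R]
    (fun x : R => (x + c)%R : measurableTypeR R).
  by apply: measurable_funD => //; exact: measurable_cst.
pose nu := pushforward (@lebesgue_measure R)
  ((fun x : R => x + c)%R : measurableTypeR R -> measurableTypeR R).
pose HH := [the {measure set _ -> \bar R} of nu].
rewrite -[LHS]/(HH mt A); apply/esym/lebesgue_measure_unique => //= _ [[a b]] _ <-.
rewrite /nu /pushforward (_ : _ @^-1` _ = `](a - c)%R, (b - c)%R]%classic).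
  rewrite !lebesgue_measure_itv/= !lte_fin ltrD2r; case: ifP => // _.
  by congr EFin; ring.
by apply/seteqP; split => x /=; rewrite !in_itv/= ltrBlDr lerBrDr.
Qed.

(** The shift is a function on [nat] so that the induction on [m] can pass to [fun i => a i.+1]. *)
Definition tuple_translate m (a : nat -> R) (t : rtuple R m) : rtuple R m :=
  [tuple (tnth t i + a i)%R | i < m].

Lemma measurable_tuple_translate m a :
  measurable_fun [set: rtuple R m] (@tuple_translate m a).
Proof.
apply/measurable_fun_tnthP => i.
rewrite (_ : _ \o _ = (fun t : rtuple R m => tnth t i + a i)%R); last first.
  by apply/funext => t /=; rewrite tnth_mktuple.
by apply: measurable_funD; [exact: measurable_tnth|exact: measurable_cst].
Qed.

Lemma tuple_translate_cons m a (z : measurableTypeR R * rtuple R m) :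
  tuple_translate a (rtuple_cons z) =
  rtuple_cons ((z.1 + a 0)%R, tuple_translate (fun i => a i.+1) z.2).
Proof.
apply: eq_from_tnth => i; rewrite tnth_mktuple.
case: (unliftP ord0 i) => [j ->|->].
  by rewrite !tnthS tnth_mktuple.
by rewrite !tnth0.
Qed.

Lemma lebesgue_tuple_translate m a (A : set (rtuple R m)) : measurable A ->
  lebesgue_tuple m (tuple_translate a @^-1` A) = lebesgue_tuple m A.
Proof.
elim: m a A => [|m IH] a A mA.
  rewrite (_ : tuple_translate a @^-1` A = A)//.
  by apply/seteqP; split => t /=; rewrite (_ : tuple_translate a t = t)//;
    apply: eq_from_tnth => -[].
rewrite /= /lebesgue_cons /pushforward.
pose B := @rtuple_cons R m @^-1` A.
have mB : measurable B.
  by rewrite -[B]setTI; apply: measurable_rtuple_cons.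
pose tau (z : measurableTypeR R * rtuple R m) : measurableTypeR R * rtuple R m :=
  ((z.1 + a 0)%R, tuple_translate (fun i => a i.+1) z.2).
have mtau : measurable_fun setT tau.
  apply/measurable_fun_pair.
    by apply: measurable_funD; [exact: measurable_fst|exact: measurable_cst].
  exact: measurableT_comp (measurable_tuple_translate _) measurable_snd.
rewrite (_ : _ @^-1` (_ @^-1` A) = tau @^-1` B); last first.
  by apply/seteqP; split => z /=; rewrite /B /= tuple_translate_cons.
pose nu := pushforward (@lebesgue_measure R \x lebesgue_tuple m) tau.
pose HH := [the {measure set _ -> \bar R} of nu].
rewrite -[LHS]/(HH mtau B); apply/esym/product_measure_unique => // C D mC mD.
rewrite /HH /= /nu /pushforward.
rewrite (_ : tau @^-1` (C `*` D) = ((fun x : R => x + a 0)%R @^-1` C) `*`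
   (tuple_translate (fun i => a i.+1) @^-1` D)); last by [].
rewrite product_measure1E.
- by congr (_ * _); [exact: lebesgue_measure_translate mC|exact: IH mD].
- rewrite -[X in measurable X]setTI.
  have : measurable_fun [set: measurableTypeR R] (fun x : R => (x + a 0)%R : measurableTypeR R).
    by apply: measurable_funD => //; exact: measurable_cst.
  by apply.
- rewrite -[X in measurable X]setTI; exact: measurable_tuple_translate.
Qed.

End translation.

(** * Mixed norms *)

Section mixed_norm.
Context {R : realType} {m : nat}.
Local Notation V := 'rV[R]_m.
Local Notation T := (rtuple R m).
Local Notation mu := (lebesgue_tuple m).
Local Notation row := (@row_of_tuple R m).
Implicit Types (F G : V -> V -> R[i]) (p q : \bar R).

Definition measurable_stft F :=
  measurable_fun [set: T * T] (fun z => complex.Re (F (row z.1) (row z.2))) /\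
  measurable_fun [set: T * T] (fun z => complex.Im (F (row z.1) (row z.2))).

Definition modulus F (z : T * T) : \bar R := (normc (F (row z.1) (row z.2)))%:E.

Lemma modulus_ge0 F z : (0 <= modulus F z)%E.
Proof. by rewrite lee_fin normc_ge0. Qed.

Lemma measurable_modulus F : measurable_stft F -> measurable_fun [set: T * T] (modulus F).
Proof.
move=> [mR mI]; apply/measurable_EFinP.
rewrite (_ : (fun z => _) = Num.sqrt \o (fun z =>
  complex.Re (F (row z.1) (row z.2)) ^+ 2 + complex.Im (F (row z.1) (row z.2)) ^+ 2)); last first.
  by apply/funext => z /=; case: (F _ _).
apply: measurableT_comp; first by apply: continuous_measurable_fun; exact: sqrt_continuous.
by apply: measurable_funD; exact: measurable_funX.
Qed.

Lemma measurable_section F (y : T) : measurable_stft F ->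
  measurable_fun [set: T] (fun x => modulus F (x, y)).
Proof. by move=> /measurable_modulus mF; apply: (measurableT_comp mF); exact: pair2_measurable. Qed.

Definition inner_norm p F (y : T) : \bar R := Lnorm mu p (fun x => modulus F (x, y)).

Lemma mixed_normE p q F : mixed_norm p q F = Lnorm mu q (inner_norm p F).
Proof. by []. Qed.

Lemma inner_norm_ge0 p F y : (0 <= inner_norm p F y)%E.
Proof. exact: Lnorm_ge0. Qed.

Lemma measurable_inner_norm p F : (1 <= p)%E -> measurable_stft F ->
  measurable_fun [set: T] (inner_norm p F).
Proof.
move=> p1 /measurable_modulus mF; apply: measurable_Lnorm_section => // z.
exact: modulus_ge0.
Qed.

Lemma mixed_normD p q F G : (1 <= p)%E -> (1 <= q)%E ->
  measurable_stft F -> measurable_stft G ->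
  measurable_stft (fun x y => F x y + G x y) /\
  (mixed_norm p q (fun x y => F x y + G x y)%R <= mixed_norm p q F + mixed_norm p q G)%E.
Proof.
move=> p1 q1 mF mG.
have mFG : measurable_stft (fun x y => F x y + G x y).
  split; [under eq_fun do rewrite Re_addc|under eq_fun do rewrite Im_addc].
    exact: measurable_funD mF.1 mG.1.
  exact: measurable_funD mF.2 mG.2.
split=> //; rewrite !mixed_normE.
have mi := measurable_inner_norm p1.
apply: le_trans (LnormD_ge0 mu q1 (mi _ mF) (mi _ mG) (inner_norm_ge0 _ _) (inner_norm_ge0 _ _)).
apply: le_Lnorm => //; [exact: mi|exact: emeasurable_funD (mi _ mF) (mi _ mG)|] => y.
rewrite inner_norm_ge0 /=; have ms H mH := @measurable_section H y mH.
have n0 H x : (0 <= modulus H (x, y))%E by exact: modulus_ge0.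
apply: le_trans (LnormD_ge0 mu p1 (ms _ mF) (ms _ mG) (n0 F) (n0 G)).
apply: le_Lnorm => //; [exact: ms|exact: emeasurable_funD (ms _ mF) (ms _ mG)|] => x.
by rewrite n0 /= lee_fin le_normcD.
Qed.

Lemma le_mixed_norm p q F G (c : R) : (1 <= p)%E -> (1 <= q)%E -> 0 <= c ->
  measurable_stft F -> measurable_stft G ->
  (forall x y, normc (F x y) <= c * normc (G x y)) ->
  (mixed_norm p q F <= c%:E * mixed_norm p q G)%E.
Proof.
move=> p1 q1 c0 mF mG FG; rewrite !mixed_normE; have mi := measurable_inner_norm p1.
have i0 H y := inner_norm_ge0 p H y.
rewrite -(LnormZ_ge0 mu q1 (mi _ mG) (i0 G) c0).
have mZ d (T' : measurableType d) (h : T' -> \bar R) : measurable_fun [set: T'] h ->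
    measurable_fun [set: T'] (fun x => c%:E * h x)%E.
  by move=> mh; apply: emeasurable_funM => //; exact: measurable_cst.
apply: le_Lnorm => //; [exact: mi|exact: mZ (mi _ mG)|] => y.
rewrite i0 /=; have ms H mH := @measurable_section H y mH.
have n0 H x : (0 <= modulus H (x, y))%E by exact: modulus_ge0.
rewrite -(LnormZ_ge0 mu p1 (ms _ mG) (n0 G) c0).
apply: le_Lnorm => //; [exact: ms|exact: mZ (ms _ mG)|] => x.
by rewrite n0 /= lee_fin.
Qed.

Definition coords (v : V) (k : nat) : R := oapp (fun i : 'I_m => v 0 i) 0 (insub k).

Lemma row_translate (v : V) (t : T) : row (tuple_translate (coords v) t) = row t + v.
Proof.
apply/rowP => i; rewrite !mxE tnth_mktuple /coords.
by rewrite (_ : insub (i : nat) = Some i)// valK.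
Qed.

Lemma mixed_norm_translate p q F (a b : V) : (1 <= p)%E -> (1 <= q)%E ->
  measurable_stft F ->
  measurable_stft (fun x y => F (x + a) (y + b)) /\
  mixed_norm p q (fun x y => F (x + a) (y + b)) = mixed_norm p q F.
Proof.
move=> p1 q1 mF.
pose tau (z : T * T) := (tuple_translate (coords a) z.1, tuple_translate (coords b) z.2).
have mtau : measurable_fun [set: T * T] tau.
  apply/measurable_fun_pair.
    exact: measurableT_comp (measurable_tuple_translate _) measurable_fst.
  exact: measurableT_comp (measurable_tuple_translate _) measurable_snd.
split.
  split; [have := measurableT_comp mF.1 mtau|have := measurableT_comp mF.2 mtau];
    by congr measurable_fun; apply/funext => z /=; rewrite !row_translate.
rewrite !mixed_normE; have mi := measurable_inner_norm p1 mF.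
rewrite -[RHS](Lnorm_comp (tau := tuple_translate (coords b)) q1
  (measurable_tuple_translate _) (@lebesgue_tuple_translate R m _) mi).
congr Lnorm; apply/funext => y; rewrite /inner_norm /=.
rewrite -[RHS](Lnorm_comp (tau := tuple_translate (coords a)) p1
  (measurable_tuple_translate _) (@lebesgue_tuple_translate R m _)
  (measurable_section _ mF)).
by congr Lnorm; apply/funext => x; rewrite /modulus /= !row_translate.
Qed.

(** Fatou for the inner norm at each fixed [y], then for the outer norm. Measurability passes to the
    pointwise limit and is recorded because [Lpq] asks for it. *)
Lemma mixed_norm_fatou p q (Fn : nat -> V -> V -> R[i]) F (B : \bar R) :
  (1 <= p)%E -> (1 <= q)%E -> (forall n, measurable_stft (Fn n)) ->
  (forall x y (e : R), 0 < e -> exists N, forall n, (N <= n)%N ->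
     normc (Fn n x y - F x y) < e) ->
  (forall n, (mixed_norm p q (Fn n) <= B)%E) ->
  measurable_stft F /\ (mixed_norm p q F <= B)%E.
Proof.
move=> p1 q1 mFn cF BF.
have cvgF (P : R[i] -> R) : (forall z w, `|P z - P w| <= normc (z - w)) ->
    forall x y, P (Fn n x y) @[n --> \oo] --> P (F x y).
  move=> HP x y; apply/cvgrPdist_lt => e e0; have [N HN] := cF x y e e0.
  exists N => // n /= Nn; rewrite distrC; exact: le_lt_trans (HP _ _) (HN n Nn).
have mF : measurable_stft F.
  split.
    apply: (measurable_fun_cvg (h := fun n z => complex.Re (Fn n (row z.1) (row z.2)))).
      by move=> n; exact: (mFn n).1.
    move=> z _; apply: cvgF => u w; rewrite -Re_subc; exact: Re_le_normc.
  apply: (measurable_fun_cvg (h := fun n z => complex.Im (Fn n (row z.1) (row z.2)))).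
    by move=> n; exact: (mFn n).2.
  move=> z _; apply: cvgF => u w; rewrite -Im_subc; exact: Im_le_normc.
have cn x y : normc (Fn n x y) @[n --> \oo] --> normc (F x y).
  apply: cvgF => u w; rewrite ler_norml; apply/andP; split.
    by have := le_normcD (w - u) u; rewrite subrK -[normc (w - u)]normcN opprB; lra.
  by have := le_normcD (u - w) w; rewrite subrK; lra.
have inf_cn z : modulus F z = limn_einf (fun n => modulus (Fn n) z).
  rewrite (cvg_limn_einf_sup (l := modulus F z) _).1//.
  by apply: cvg_EFin; [exact: nearW|exact: cn].
split=> //; rewrite mixed_normE; have mi := measurable_inner_norm p1.
apply: le_trans (Lnorm_fatou (a := fun n => inner_norm p (Fn n)) mu q1 _ _ _ _) _.
- exact: mi.
- by move=> n; exact: mi.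
- by move=> n y; exact: inner_norm_ge0.
- move=> y; rewrite inner_norm_ge0 /=.
  apply: (Lnorm_fatou (a := fun n x => modulus (Fn n) (x, y)) mu p1).
  + exact: measurable_section.
  + by move=> n; exact: measurable_section.
  + by move=> n x; exact: modulus_ge0.
  + by move=> x; rewrite modulus_ge0 -inf_cn lexx.
- exact: limn_einf_le_cst.
Qed.

End mixed_norm.

(** * Time-frequency shifts and the twisted short-time Fourier transform *)

Section tf_shift_families.
Context {R : realType} {m : nat}.
Local Notation V := 'rV[R]_m.
Implicit Types (w y : V) (h : V -> R[i]).

Lemma schwartz_family_tf_shift T w y (a : T -> V -> R[i]) : schwartz_family a ->
  schwartz_family (fun t => tf_shift w y (a t)).
Proof.
move=> Fa k; have := bounded_familyM (fun _ _ => ler01) (fun t x => bracket_pow_ge0 k (x - y))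
  (bounded_family_character w) (bounded_family_translate (fun _ => - y) (Fa k)).
apply: (bounded_familyW (bracket_pow_ge0 k y)) => t x; rewrite mul1r.
by rewrite [X in bracket_pow k X <= _](_ : x = y + (x - y)) ?bracket_pow_add// addrC subrK.
Qed.

Lemma schwartz_tf_shift w y h : schwartz h -> schwartz (tf_shift w y h).
Proof. by move=> /schwartzP/(schwartz_family_tf_shift w y)/schwartzP. Qed.

Lemma locally_vanishing_tf_shift w y (a : nat -> V -> R[i]) : locally_vanishing a ->
  locally_vanishing (fun n => tf_shift w y (a n)).
Proof.
move=> La r e e0; have [N HN] := La (r + `|y|) e e0; exists N => n Nn x xr.
rewrite /tf_shift normcM normc_character mul1r; apply: HN => //.
by apply: le_trans (ler_normB _ _) _; rewrite lerD2r.
Qed.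

Lemma schwartz_family_conj T (a : T -> V -> R[i]) : schwartz_family a ->
  schwartz_family (fun t x => conjc (a t x)).
Proof. by move=> Fa k; exact: bounded_family_conj. Qed.

Lemma tempered_scale f (c : R[i]) h : tempered f -> schwartz h ->
  f (fun x => c * h x) = c * f h.
Proof.
move=> [lin _] sh; have s0 := schwartzZ 0 sh.
have E (b : R[i]) : (fun x => b * h x) = (fun x => b * h x + 0 * h x).
  by apply/funext => x; rewrite mul0r addr0.
have f0 : f (fun x => 0 * h x) = 0.
  have := lin 1 _ _ s0 s0; rewrite (_ : (fun x => _) = (fun x => 0 * h x)); last first.
    by apply/funext => x; rewrite mul0r mul1r addr0.
  by rewrite mul1r => /eqP; rewrite -subr_eq0 opprD addNKr oppr_eq0 => /eqP.
by rewrite E lin// f0 addr0.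
Qed.

Lemma tempered_add f g h : tempered f -> schwartz g -> schwartz h ->
  f (fun x => g x + h x) = f g + f h.
Proof.
move=> [lin _] sg sh; rewrite -[f g]mul1r -lin//; congr f.
by apply/funext => x; rewrite mul1r.
Qed.

End tf_shift_families.

Section twisted_covariance.
Context {R : realType} {n : nat}.
Local Notation V := 'rV[R]_(n + n).
Variables (lambda : R) (lambda0 : lambda != 0).
Implicit Types (w y z xi eta : V) (h g : V -> R[i]).

(* The matrix of the symplectic form: [symplectic z xi] is [dot (twist xi) z]. *)
Definition twist xi : V := row_mx (- rsubmx xi) (lsubmx xi).

Lemma twistD xi eta : twist (xi + eta) = twist xi + twist eta.
Proof. by rewrite /twist !linearD /= add_row_mx. Qed.

Lemma twistZ (k : R) xi : twist (k *: xi) = k *: twist xi.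
Proof. by rewrite /twist !linearZ /= scale_row_mx scalerN. Qed.

Lemma twistK xi : twist (twist xi) = - xi.
Proof. by rewrite /twist row_mxKl row_mxKr -opp_row_mx hsubmxK. Qed.

Lemma dot_row xi eta :
  dot xi eta = dot (lsubmx xi) (lsubmx eta) + dot (rsubmx xi) (rsubmx eta).
Proof.
rewrite /dot big_split_ord /=.
by congr (_ + _); apply: eq_bigr => i _; rewrite !mxE.
Qed.

Lemma symplecticE xi eta : symplectic xi eta = dot (twist eta) xi.
Proof.
rewrite dot_row /twist row_mxKl row_mxKr /symplectic addrC; congr (_ + _).
  by rewrite -[- rsubmx _]scaleN1r dotZl mulN1r.
by apply: eq_bigr => i _; rewrite mulrC.
Qed.

Let t := tanh (lambda / 2).
Let c := lambda / 2 * coth (lambda / 2).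

(** Parameters of the ordinary time-frequency shift, read off by expanding [Pi]. The second term of
    [phase] arises because the phase of the twisted translation is evaluated at the point already
    displaced by the twisted modulation. *)
Definition position xi eta : V := xi - t *: twist eta.
Definition frequency xi eta : V := - (lambda / 2) *: twist xi - c *: eta.
Definition phase xi eta : R :=
  lambda / 2 * coth lambda * dot xi eta - lambda / 2 * t * dot (twist xi) (twist eta).

Lemma Pi_tf_shift xi eta g : Pi lambda xi eta g =
  (fun z => expi (phase xi eta) * tf_shift (frequency xi eta) (position xi eta) g z).
Proof.
apply/funext => z; rewrite /Pi /twisted_modulation /twisted_translation /phase.
rewrite /frequency /position /c /t; move: (coth lambda) (coth (lambda / 2)) (tanh (lambda / 2)) => d c' t'.
have -> : row_mx (lsubmx z - t' *: rsubmx eta)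
    (rsubmx z + t' *: lsubmx eta) = z + t' *: twist eta.
  by rewrite /twist scale_row_mx -[in RHS](hsubmxK z) add_row_mx scalerN.
rewrite symplecticE dotDr dotZr /tf_shift /character.
have -> : z + t' *: twist eta - xi = z - (xi - t' *: twist eta).
  by rewrite /position opprB addrA addrAC [_ + t' *: _]addrC addrA [t' *: _ + z]addrC addrAC.
rewrite -mulrA [g _ * _ * _]mulrC [g _ * _]mulrC !mulrA -!expiD; congr (expi _ * _).
have -> : dot (lsubmx z) (lsubmx eta) + dot (rsubmx z) (rsubmx eta) = dot z eta.
  by rewrite dot_row.
rewrite -[- (_ *: eta)]scaleNr dotDl !dotZl.
rewrite (_ : dot z eta = dot eta z); last by apply: eq_bigr => i _; rewrite mulrC.
ring.
Qed.

Lemma positionD xi eta xi' eta' :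
  position (xi + xi') (eta + eta') = position xi eta + position xi' eta'.
Proof. by rewrite /position twistD scalerDr opprD addrACA. Qed.

Lemma frequencyD xi eta xi' eta' :
  frequency (xi + xi') (eta + eta') = frequency xi eta + frequency xi' eta'.
Proof. by rewrite /frequency twistD !scalerDr opprD addrACA. Qed.

(** Since $e^se^{-s}=1$, the difference equals $-4/((e^s+e^{-s})(e^s-e^{-s}))$. *)
Lemma tanh_coth_neq (s : R) : s != 0 -> tanh s - coth s != 0.
Proof.
move=> s0; rewrite /tanh /coth.
have p : expR s + expR (- s) != 0 by rewrite gt_eqF// addr_gt0 ?expR_gt0.
have q : expR s - expR (- s) != 0.
  rewrite subr_eq0; apply: contra s0 => /eqP/expR_inj; lra.
have e1 : expR s * expR (- s) = 1 by rewrite -expRD subrr expR0.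
rewrite (_ : _ - _ = - 4 * (expR s * expR (- s)) /
  ((expR s + expR (- s)) * (expR s - expR (- s)))).
  by rewrite e1 !mulf_neq0 ?invr_eq0 ?mulf_neq0 ?oppr_eq0 ?oner_eq0 ?pnatr_eq0.
by field; rewrite p q.
Qed.

(** Eliminating [xi] through the position, and using that [twist] squares to $-1$, turns the
    frequency into [k *: eta - (lambda / 2) *: twist y], where
    $k=\frac\lambda2(\tanh\frac\lambda2-\coth\frac\lambda2)$ is nonzero. *)
Lemma position_frequency_surj w y : exists xi eta, position xi eta = y /\ frequency xi eta = w.
Proof.
pose k := lambda / 2 * t - c.
have k0 : k != 0.
  rewrite /k /c -mulrBr mulf_neq0 ?tanh_coth_neq//;
  by rewrite mulf_neq0 ?invr_eq0 ?pnatr_eq0.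
pose eta := k^-1 *: (w + (lambda / 2) *: twist y).
exists (y + t *: twist eta), eta; split; first by rewrite /position addrK.
rewrite /frequency twistD twistZ twistK.
have -> : w = k *: eta - (lambda / 2) *: twist y by rewrite scalerA mulfV// scale1r addrK.
by apply/rowP => i; move: (twist y) eta => ry eta'; rewrite !mxE /k; ring.
Qed.

(** Time-frequency shifts compose additively up to a phase, and position and frequency are additive
    in [(xi, eta)]. The formula for [psi] is exported because [stft_shift] has to prove it
    measurable. *)
Lemma Pi_covariant w y : exists xi0 eta0 (psi : V -> V -> R),
  (forall xi eta, psi xi eta =
     phase xi eta - dot w (position xi eta) - phase (xi + xi0) (eta + eta0)) /\
  forall xi eta h, Pi lambda xi eta (tf_shift w y h) =
    (fun z => expi (psi xi eta) * Pi lambda (xi + xi0) (eta + eta0) h z).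
Proof.
have [xi0 [eta0 [Hy Hw]]] := position_frequency_surj w y.
exists xi0, eta0; eexists; split=> [xi eta|xi eta h]; first by reflexivity.
rewrite !Pi_tf_shift positionD frequencyD Hy Hw; apply/funext => z /=.
rewrite /tf_shift /character.
have -> : z - (position xi eta + y) = z - position xi eta - y by rewrite opprD addrA.
rewrite !mulrA -!expiD; congr (expi _ * _).
rewrite dotDl dotDr -[- position xi eta]scaleN1r dotZr; ring.
Qed.

End twisted_covariance.

(** * Measurability of phases and products in both variables *)

Section measurable_functions.
Context {R : realType} {m : nat}.
Local Notation V := 'rV[R]_m.
Local Notation T := (rtuple R m).
Local Notation row := (@row_of_tuple R m).
Implicit Types (F G : V -> V -> R[i]) (u v : V -> V -> R).

Lemma measurable_stftM F G : measurable_stft F -> measurable_stft G ->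
  measurable_stft (fun x y => F x y * G x y).
Proof.
move=> [F1 F2] [G1 G2]; split; [under eq_fun do rewrite Re_mulc|under eq_fun do rewrite Im_mulc].
  by apply: measurable_funB; exact: measurable_funM.
by apply: measurable_funD; exact: measurable_funM.
Qed.

Lemma measurable_stft_cst (c : R[i]) : measurable_stft (fun _ _ : V => c).
Proof. by split; exact: measurable_cst. Qed.

Definition measurable_real u := measurable_fun [set: T * T] (fun z => u (row z.1) (row z.2)).

Lemma measurable_stft_expi u : measurable_real u -> measurable_stft (fun x y => expi (u x y)).
Proof.
move=> mu; split; apply: measurableT_comp mu; apply: continuous_measurable_fun.
  exact: continuous_cos.
exact: continuous_sin.
Qed.

Lemma measurable_stft_conj F : measurable_stft F -> measurable_stft (fun x y => conjc (F x y)).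
Proof.
move=> [F1 F2]; split.
  by apply: eq_measurable_fun F1 => z _; case: (F _ _).
have := measurableT_comp (@oppr_measurable R setT) F2.
by apply: eq_measurable_fun => z _ /=; case: (F _ _).
Qed.

Definition measurable_row (X : V -> V -> V) := forall i, measurable_real (fun x y => X x y 0 i).

Lemma measurable_row_fst : measurable_row (fun x _ => x).
Proof.
move=> i; rewrite /measurable_real; under eq_fun do rewrite mxE.
exact: measurableT_comp (measurable_tnth i) measurable_fst.
Qed.

Lemma measurable_row_snd : measurable_row (fun _ y => y).
Proof.
move=> i; rewrite /measurable_real; under eq_fun do rewrite mxE.
exact: measurableT_comp (measurable_tnth i) measurable_snd.
Qed.

Lemma measurable_row_cst (c : V) : measurable_row (fun _ _ => c).
Proof. by move=> i; exact: measurable_cst. Qed.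

Lemma measurable_rowD (X Y : V -> V -> V) : measurable_row X -> measurable_row Y ->
  measurable_row (fun x y => X x y + Y x y).
Proof.
move=> mX mY i; rewrite /measurable_real; under eq_fun do rewrite mxE.
exact: measurable_funD (mX i) (mY i).
Qed.

Lemma measurable_rowZ (k : R) (X : V -> V -> V) : measurable_row X ->
  measurable_row (fun x y => k *: X x y).
Proof.
move=> mX i; rewrite /measurable_real; under eq_fun do rewrite mxE.
by apply: measurable_funM (mX i); exact: measurable_cst.
Qed.

Lemma measurable_dot (X Y : V -> V -> V) : measurable_row X -> measurable_row Y ->
  measurable_real (fun x y => dot (X x y) (Y x y)).
Proof.
move=> mX mY; apply: measurable_sum => i; exact: measurable_funM (mX i) (mY i).
Qed.

End measurable_functions.

Lemma measurable_row_twist (R : realType) (n : nat) (X : 'rV[R]_(n + n) -> 'rV_(n + n) -> 'rV_(n + n)) :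
  measurable_row X -> measurable_row (fun x y => twist (X x y)).
Proof.
move=> mX i; rewrite /measurable_real; case: (split_ordP i) => j ->.
  under eq_fun do rewrite /twist row_mxEl !mxE.
  exact: measurableT_comp (@oppr_measurable R setT) (mX (rshift n j)).
by under eq_fun do rewrite /twist row_mxEr !mxE; exact: mX.
Qed.

(** * The twisted transform under a change of window *)

Section window_change.
Context {R : realType} {n : nat}.
Local Notation V := 'rV[R]_(n + n).
Variables (lambda : R) (f : (V -> R[i]) -> R[i]).
Hypotheses (lambda0 : lambda != 0) (tf : tempered f).
Implicit Types (g h : V -> R[i]) (xi eta z : V) (p q : \bar R).
Local Notation stft := (twisted_stft lambda f).

Lemma measurable_phase (X Y : V -> V -> V) : measurable_row X -> measurable_row Y ->
  measurable_real (fun x y => phase lambda (X x y) (Y x y)).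
Proof.
move=> mX mY; apply: measurable_funB.
  by apply: measurable_funM (measurable_dot mX mY); exact: measurable_cst.
apply: measurable_funM; first exact: measurable_cst.
exact: measurable_dot (measurable_row_twist mX) (measurable_row_twist mY).
Qed.

Lemma schwartz_conj_Pi T (a : T -> V -> R[i]) xi eta : schwartz_family a ->
  schwartz_family (fun t z => conjc (Pi lambda xi eta (a t) z)).
Proof.
move=> Fa; apply: schwartz_family_conj.
rewrite (_ : (fun t => _) = (fun t z => expi (phase lambda xi eta) *
    tf_shift (frequency lambda xi eta) (position lambda xi eta) (a t) z)); last first.
  by apply/funext => t; rewrite Pi_tf_shift.
apply: (@schwartz_familyZ _ _ _ _ _ 1); first by move=> t; rewrite normc_expi.
exact: schwartz_family_tf_shift.
Qed.

Lemma schwartz_conj_Pi_at h xi eta : schwartz h ->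
  schwartz (fun z => conjc (Pi lambda xi eta h z)).
Proof. by move=> /schwartzP/(schwartz_conj_Pi xi eta)/schwartzP. Qed.

Lemma PiE xi eta h z : Pi lambda xi eta h z = expi (phase lambda xi eta) *
  tf_shift (frequency lambda xi eta) (position lambda xi eta) h z.
Proof. by rewrite Pi_tf_shift. Qed.

Lemma stft_add g h xi eta : schwartz g -> schwartz h ->
  stft (fun x => g x + h x) xi eta = stft g xi eta + stft h xi eta.
Proof.
move=> sg sh; rewrite -(tempered_add tf (schwartz_conj_Pi_at xi eta sg)
  (schwartz_conj_Pi_at xi eta sh)).
rewrite /twisted_stft /bracket; congr f; apply/funext => z.
by rewrite -(rmorphD (@conjc R)) !PiE /tf_shift -!mulrDr.
Qed.

Lemma stft_scale (c : R[i]) h xi eta : schwartz h ->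
  stft (fun x => c * h x) xi eta = conjc c * stft h xi eta.
Proof.
move=> sh; rewrite -(tempered_scale _ tf (schwartz_conj_Pi_at xi eta sh)).
congr f; apply/funext => z; rewrite -conjcM !PiE /tf_shift; congr conjc; ring.
Qed.

(** [Pi] at a fixed [(xi, eta)] preserves Schwartz convergence, so continuity of [f] gives pointwise
    convergence, the mode that [mixed_norm_fatou] takes as input. *)
Lemma stft_cvg (a : nat -> V -> R[i]) h xi eta (e : R) : schwartz_cvg a h -> 0 < e ->
  exists N, forall k, (N <= k)%N -> normc (stft (a k) xi eta - stft h xi eta) < e.
Proof.
move=> [Fa sh La] e0; pose P b := fun z => conjc (Pi lambda xi eta b z).
have D k : (fun z => P (a k) z - P h z) = P (fun x => a k x - h x).
  by apply/funext => z; rewrite /P !PiE /tf_shift -(rmorphB (@conjc R)) -mulrBr -mulrBr.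
have sP b : schwartz b -> schwartz (P b) by exact: schwartz_conj_Pi_at.
apply: (@tempered_cvg _ _ f (fun k => P (a k)) (P h) e tf (sP _ sh)) => //.
- by move=> k; apply: sP; exact: schwartz_family_at Fa.
- rewrite (_ : (fun k => _) = (fun k => P (fun x => a k x - h x))); last exact/funext.
  apply: schwartz_conj_Pi; apply: schwartz_familyB => //; exact: schwartz_family_cst.
- rewrite (_ : (fun k => _) = (fun k => P (fun x => a k x - h x))); last exact/funext.
  move=> r d d0; have [N HN] := locally_vanishing_tf_shift (frequency lambda xi eta)
    (position lambda xi eta) La r d0.
  by exists N => k Nk x xr; rewrite /P normc_conj PiE normcM normc_expi mul1r; exact: HN.
Qed.

Lemma stft_shift p q w y h : (1 <= p)%E -> (1 <= q)%E -> schwartz h ->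
  measurable_stft (stft h) ->
  measurable_stft (stft (tf_shift w y h)) /\
  (mixed_norm p q (stft (tf_shift w y h)) <= mixed_norm p q (stft h))%E.
Proof.
move=> p1 q1 sh mh; have [xi0 [eta0 [psi [psiE HPi]]]] := Pi_covariant lambda0 w y.
have E : stft (tf_shift w y h) =
    (fun xi eta => conjc (expi (psi xi eta)) * stft h (xi + xi0) (eta + eta0)).
  apply/funext => xi; apply/funext => eta.
  rewrite -(tempered_scale _ tf (schwartz_conj_Pi_at _ _ sh)).
  by congr f; apply/funext => z; rewrite HPi -conjcM.
have [mt <-] := mixed_norm_translate xi0 eta0 p1 q1 mh.
have mpsi : measurable_real psi.
  rewrite /measurable_real; under eq_fun do rewrite psiE.
  have m1 := @measurable_row_fst R (n + n); have m2 := @measurable_row_snd R (n + n).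
  have mc := @measurable_row_cst R (n + n).
  apply: measurable_funB; last exact: measurable_phase (measurable_rowD m1 (mc _)) (measurable_rowD m2 (mc _)).
  apply: measurable_funB; first exact: (measurable_phase m1 m2).
  apply: (measurable_dot (mc w)); rewrite /position.
  apply: measurable_rowD => //.
  have := measurable_rowZ (- tanh (lambda / 2)) (measurable_row_twist m2).
  by congr measurable_row; apply/funext => xi; apply/funext => eta; rewrite scaleNr.
have ms : measurable_stft (stft (tf_shift w y h)).
  by rewrite E; apply: measurable_stftM mt; exact: measurable_stft_conj (measurable_stft_expi mpsi).
split=> //; rewrite -[leRHS]mul1e; apply: le_mixed_norm => // xi eta.
by rewrite E normcM normc_conj normc_expi.
Qed.

Lemma mixed_norm_ge0 p q (F : V -> V -> R[i]) : (0 <= mixed_norm p q F)%E.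
Proof. exact: Lnorm_ge0. Qed.

(** Induction on [hull], one property of mixed norms per constructor. Being Schwartz and
    measurability belong to the induction because the norm estimates rest on them; Fatou lets the
    limit constructor keep the same constant. *)
Lemma hull_stft p q g C h : (1 <= p)%E -> (1 <= q)%E -> schwartz g ->
  measurable_stft (stft g) -> (mixed_norm p q (stft g) < +oo)%E -> hull g C h ->
  [/\ 0 <= C, schwartz h, measurable_stft (stft h) &
    (mixed_norm p q (stft h) <= C%:E * mixed_norm p q (stft g))%E].
Proof.
move=> p1 q1 sg mg fg; have g0 := mixed_norm_ge0 p q (stft g).
elim=> {C h} [|C D h _ [C0 sh mh Ch] CD|C D a b _ [C0 sa ma Ca] _ [D0 sb mb Db]
  |C h c _ [C0 sh mh Ch]|C h w y _ [C0 sh mh Ch]|C a h _ IH ah].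
- by split=> //; rewrite mul1e.
- split=> //; first exact: le_trans CD.
  by apply: le_trans Ch _; apply: lee_wpmul2r => //; rewrite lee_fin.
- have E : stft (fun x => a x + b x) = (fun xi eta => stft a xi eta + stft b xi eta).
    by apply/funext => xi; apply/funext => eta; exact: stft_add.
  have [mab nab] := mixed_normD p1 q1 ma mb.
  split; [exact: addr_ge0|exact: schwartzD|by rewrite E|rewrite E].
  by apply: le_trans nab _; rewrite EFinD ge0_muleDl ?lee_fin// leeD.
- have E : stft (fun x => c * h x) = (fun xi eta => conjc c * stft h xi eta).
    by apply/funext => xi; apply/funext => eta; exact: stft_scale.
  have mc : measurable_stft (fun xi eta => conjc c * stft h xi eta).
    by apply: measurable_stftM mh; exact: measurable_stft_cst.
  split; [by rewrite mulr_ge0 ?normc_ge0|exact: schwartzZ|by rewrite E|rewrite E].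
  rewrite EFinM -muleA.
  apply: (le_trans (le_mixed_norm p1 q1 (normc_ge0 c) mc mh _)).
    by move=> xi eta; rewrite normcM normc_conj.
  by apply: lee_wpmul2l => //; rewrite lee_fin normc_ge0.
- have [ms ns] := stft_shift w y p1 q1 sh mh.
  split=> //; [exact: schwartz_tf_shift|exact: le_trans ns Ch].
- have C0 : 0 <= C by have [] := IH 0%N.
  have [mh nh] := mixed_norm_fatou p1 q1 (fun k => let: And4 _ _ m _ := IH k in m)
    (fun xi eta e e0 => stft_cvg xi eta ah e0) (fun k => let: And4 _ _ _ b := IH k in b).
  by split=> //; have [_] := ah.
Qed.

End window_change.

(** * Independence of the window and equivalence of norms *)

Theorem theorem3p3 (R : realType) (n : nat) (lambda : R) (p q : \bar R)
    (hn : (0 < n)%N) (hlambda : lambda != 0)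
    (hp : (1 <= p)%E) (hq : (1 <= q)%E) :
  (forall f : ('rV[R]_(n + n) -> R[i]) -> R[i], tempered f ->
     forall g, schwartz g -> g <> (fun=> 0) ->
       Lpq p q (fun xi eta => bracket f (Pi lambda xi eta g)) ->
     forall g', schwartz g' ->
       Lpq p q (fun xi eta => bracket f (Pi lambda xi eta g')))
  /\
  (forall g g' : 'rV[R]_(n + n) -> R[i],
     schwartz g -> g <> (fun=> 0) -> schwartz g' -> g' <> (fun=> 0) ->
     exists c C : R, [/\ 0 < c, 0 < C &
       forall f, modulation_space lambda p q f ->
         (c%:E * modulation_norm lambda p q g f
            <= modulation_norm lambda p q g' f)%E /\
         (modulation_norm lambda p q g' f
            <= C%:E * modulation_norm lambda p q g f)%E]).
Proof.
have window_indep (f : ('rV[R]_(n + n) -> R[i]) -> R[i]) g g' C : tempered f -> schwartz g ->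
    hull g C g' -> Lpq p q (twisted_stft lambda f g) ->
    Lpq p q (twisted_stft lambda f g') /\
    (mixed_norm p q (twisted_stft lambda f g') <=
      C%:E * mixed_norm p q (twisted_stft lambda f g))%E.
  move=> tf sg hC [m1 m2 fin].
  have [C0 _ [m3 m4] le] := hull_stft hlambda tf hp hq sg (conj m1 m2) fin hC.
  split=> //; split=> //; apply: le_lt_trans le _.
  by rewrite lte_mul_pinfty ?lee_fin ?mixed_norm_ge0.
split=> [f tf g sg g0 gL g' sg'|g g' sg g0 sg' g'0].
  have [C hC] := schwartz_in_hull sg g0 sg'.
  exact: (window_indep f g g' C tf sg hC gL).1.
have [C1 h1] := schwartz_in_hull sg g0 sg'.
have [C2 h2] := schwartz_in_hull sg' g'0 sg.
(* The maximum with 1 makes both constants positive, as inverting [D2] requires. *)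
pose D1 := Num.max C1 1; pose D2 := Num.max C2 1.
have D1_gt0 : 0 < D1 by rewrite lt_max ltr01 orbT.
have D2_gt0 : 0 < D2 by rewrite lt_max ltr01 orbT.
have k1 : hull g D1 g' by apply: hull_le h1 _; rewrite le_max lexx.
have k2 : hull g' D2 g by apply: hull_le h2 _; rewrite le_max lexx.
exists D2^-1, D1; split=> //; first by rewrite invr_gt0.
(* The window [g1] depends on [f], so it only serves to put the transform for [g] in [Lpq]; the
   constants of the equivalence come from [g] and [g'] alone. *)
move=> f [tf [g1 [sg1 g10 L1]]].
have [C hC] := schwartz_in_hull sg1 g10 sg.
have [Lg _] := window_indep f g1 g C tf sg1 hC L1.
have [Lg' le1] := window_indep f g g' D1 tf sg k1 Lg.
have [_ le2] := window_indep f g' g D2 tf sg' k2 Lg'.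
split=> //; rewrite /modulation_norm.
apply: le_trans (lee_wpmul2l _ le2) _; first by rewrite lee_fin invr_ge0 ltW.
by rewrite muleA -EFinM mulVf ?gt_eqF// mul1e.
Qed.
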